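(* Let $(X,A)$ be a full Hilbert bimodule, let $(Z,C)$ be a Hilbert bimodule, and let $(\delta_Z,\delta_C):(Z,C)\to(Q(X),Q(A))$ be a morphism of Hilbert bimodules into the corona bimodule of $(X,A)$. Then there exists an extension $(Y,B)$ of $(X,A)$ whose Busby morphism is $(\delta_Z,\delta_C)$ (under an identification of $(Y/X,B/A)$ with $(Z,C)$). Furthermore, this extension is essential if and only if $(\delta_Z,\delta_C)$ is injective.
   Context: For a $C^*$-algebra $A$, a right Hilbert $A$-module is a Banach space $X$ with a non-degenerate right action of $A$ and an $A$-valued inner product $\langle\cdot,\cdot\rangle_X$ with $\langle \xi,\eta a\rangle_X=\langle\xi,\eta\rangle_X a$, $\langle\eta,\xi\rangle_X=\langle\xi,\eta\rangle_X^*$, $\langle\xi,\xi\rangle_X\ge 0$ and $\|\xi\|=\|\langle\xi,\xi\rangle_X\|^{1/2}$. A left Hilbert $A$-module is a Banach space with a non-degenerate left action of $A$ and an $A$-valued inner product ${}_X\langle\cdot,\cdot\rangle$ with ${}_X\langle a\xi,\eta\rangle=a\,{}_X\langle\xi,\eta\rangle$, ${}_X\langle\eta,\xi\rangle={}_X\langle\xi,\eta\rangle^*$, ${}_X\langle\xi,\xi\rangle\ge0$ and $\|\xi\|=\|{}_X\langle\xi,\xi\rangle\|^{1/2}$. The pair $(X,A)$ is a Hilbert bimodule if $X$ is simultaneously a left and a right Hilbert $A$-module and ${}_X\langle\xi,\eta\rangle\zeta=\xi\langle\eta,\zeta\rangle_X$ for all $\xi,\eta,\zeta\in X$. It is full if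 both ${}_X\langle X,X\rangle$ and $\langle X,X\rangle_X$ span dense subspaces of $A$ (i.e. $X$ is an imprimitivity bimodule). A morphism $(X,A)\to(Y,B)$ of Hilbert bimodules is a pair $(\psi_X,\psi_A)$ with $\psi_X:X\to Y$ linear and $\psi_A:A\to B$ a $*$-homomorphism such that $\psi_X(\xi a)=\psi_X(\xi)\psi_A(a)$, $\psi_X(a\xi)=\psi_A(a)\psi_X(\xi)$, $\psi_A(\langle\xi,\eta\rangle_X)=\langle\psi_X(\xi),\psi_X(\eta)\rangle_Y$ and $\psi_A({}_X\langle\xi,\eta\rangle)={}_Y\langle\psi_X(\xi),\psi_X(\eta)\rangle$. The morphism is called injective if $\psi_A$ is injective (then $\psi_X$ is also injective). An ideal $I$ (closed, two-sided) of $A$ is invariant with respect to $X$ if $IX=XI$. A Hilbert bimodule $(Y,B)$ is an extension of $(X,A)$ if $B$ is a $C^*$-algebra containing $A$ as an ideal, there is a morphism of Hilbert bimodules $(\psi_X,\psi_A):(X,A)\to(Y,B)$ such that $\psi_A$ is the inclusion of $A$ in $B$, and $A$ is invariant with respect to $Y$. The extension is essential if $A$ is an essential ideal in $B$. The quotient $(Y/X,B/A)$ (where $Y/X$ means $Y/\psi_X(X)$) is a Hilbert bimodule with the actions and inner products induced from $(Y,B)$, and the pair of quotient maps $(q_Y,q_B):(Y,B)\to(Y/X,B/A)$ is a morphism. Multiplier bimodule: $\mathcal L(\cdot,\cdot)$ denotes adjointable operators with respect to the right inner products, and $\mathcal K(X)$ is the closed span in $\mathcal L(X)$ of the operators $\theta_{\eta,\xi}(\zeta)=\eta\langle\xi,\zeta\rangle_X$.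 View $A$ as a Hilbert bimodule over itself by multiplication, with $\langle a,b\rangle_A=a^*b$ and ${}_A\langle a,b\rangle=ab^*$, and identify $M(A)=\mathcal L(A)$. Put $M(X):=\mathcal L(A,X)$. If $(X,A)$ is full, the left action $\phi(a)\xi=a\xi$ is an isomorphism $A\to\mathcal K(X)$ and extends to an isomorphism $\overline\phi:M(A)\to\mathcal L(X)$. Then $(M(X),M(A))$ is a Hilbert bimodule with right action given by composition, left action $(mT)(a)=\overline\phi(m)(T(a))$, right inner product $\langle S,T\rangle_{M(X)}=S^*T$ and left inner product ${}_{M(X)}\langle S,T\rangle=\overline\phi^{-1}(ST^* )$. The canonical embedding $(\iota_X,\iota_A):(X,A)\to(M(X),M(A))$ is $\iota_X(\xi)(b)=\xi b$, $\iota_A(a)(b)=ab$; with it $(M(X),M(A))$ is an extension of $(X,A)$. Corona bimodule and Busby morphism: $Q(X):=M(X)/X$, $Q(A):=M(A)/A$, and $(Q(X),Q(A))$ with the quotient structure is the corona bimodule, with quotient morphism $(q_{M(X)},q_{M(A)})$. For an extension $(Y,B)$ of the full bimodule $(X,A)$ there is a unique morphism $(\lambda_Y,\lambda_B):(Y,B)\to(M(X),M(A))$ with $(\lambda_Y,\lambda_B)\circ(\psi_X,\psi_A)=(\iota_X,\iota_A)$. The Busby morphism of the extension is the unique morphism $(\delta_Y,\delta_B):(Y/X,B/A)\to(Q(X),Q(A))$ with $(\delta_Y,\delta_B)\circ(q_Y,q_B)=(q_{M(X)},q_{M(A)})\circ(\lambda_Y,\lambda_B)$. *)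

(* Defs.v *)
From HB Require Import structures.
From mathcomp Require Import all_boot all_order all_algebra.
From mathcomp Require Import complex.
From mathcomp Require Import all_classical all_reals.
From mathcomp Require Import topology normedtype.
Set Implicit Arguments.
Unset Strict Implicit.
Unset Printing Implicit Defensive.
Import Order.TTheory GRing.Theory Num.Theory.
Import numFieldNormedType.Exports.
Local Open Scope classical_set_scope.
Local Open Scope ring_scope.
Local Open Scope complex_scope.

Definition lspan (R : realType) (V : lmodType R[i]) (S : set V) : set V :=
  [set x | exists (n : nat) (c : 'I_n -> R[i]) (s : 'I_n -> V),
     (forall i, S (s i)) /\ x = \sum_(i < n) c i *: s i].

Definition closed_span (R : realType) (V : normedModType R[i]) (S : set V) :
    set V :=
  closure (lspan S).

(* Algebras are not assumed to be unital, so MathComp's [algType] does not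
   apply.  The operations are separated from the axioms: morphisms only involve
   the operations, and so do the quotient constructions below. *)
HB.mixin Record hasMulStar (R : realType) A of GRing.Lmodule R[i] A := {
  amul : A -> A -> A;
  astar : A -> A
}.

#[short(type="starAlgType")]
HB.structure Definition StarAlg (R : realType) :=
  {A of GRing.Lmodule R[i] A & hasMulStar R A}.

Notation "a ** b" := (amul a b) (at level 40, left associativity) : ring_scope.
Notation "a ^#" := (astar a) (at level 2, format "a ^#") : ring_scope.

HB.mixin Record isCStarAlg (R : realType) A
    of CompleteNormedModule R[i] A & StarAlg R A := {
  amulA : forall a b c : A, a ** (b ** c) = (a ** b) ** c;
  amulDl : forall a b c : A, (a + b) ** c = a ** c + b ** c;
  amulDr : forall a b c : A, a ** (b + c) = a ** b + a ** c;
  amulZl : forall (k : R[i]) (a b : A), (k *: a) ** b = k *: (a ** b);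
  amulZr : forall (k : R[i]) (a b : A), a ** (k *: b) = k *: (a ** b);
  astarD : forall a b : A, (a + b)^# = a^# + b^#;
  astarZ : forall (k : R[i]) (a : A), (k *: a)^# = (Num.conj k) *: a^#;
  astarK : forall a : A, a^#^# = a;
  astarM : forall a b : A, (a ** b)^# = b^# ** a^#;
  amul_norm : forall a b : A, `|a ** b| <= `|a| * `|b|;
  cstar_norm : forall a : A, `|a^# ** a| = `|a| ^+ 2
}.

#[short(type="cstarType")]
HB.structure Definition CStarAlg (R : realType) :=
  {A of CompleteNormedModule R[i] A & StarAlg R A & isCStarAlg R A}.

Definition cstar_pos (R : realType) (A : cstarType R) (a : A) : Prop :=
  exists b : A, a = b^# ** b.

Record closed_ideal (R : realType) (B : cstarType R) (I : set B) : Prop := {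
  ideal_closed : closed I;
  ideal_0 : I 0;
  ideal_D : forall a b, I a -> I b -> I (a + b);
  ideal_Z : forall (k : R[i]) a, I a -> I (k *: a);
  ideal_Ml : forall b a, I a -> I (b ** a);
  ideal_Mr : forall a b, I a -> I (a ** b)
}.

Definition essential_ideal (R : realType) (B : cstarType R) (I : set B) : Prop :=
  forall J : set B, closed_ideal J -> J <> [set 0] -> I `&` J <> [set 0].

HB.mixin Record hasBimodOps (R : realType) (A : starAlgType R) X
    of GRing.Lmodule R[i] X := {
  lact : A -> X -> X;
  ract : X -> A -> X;
  lip : X -> X -> A;
  rip : X -> X -> A
}.

#[short(type="bimodOpsType")]
HB.structure Definition BimodOps (R : realType) (A : starAlgType R) :=
  {X of GRing.Lmodule R[i] X & hasBimodOps R A X}.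

Notation "a >* x" := (lact a x) (at level 40, left associativity) : ring_scope.
Notation "x *< a" := (ract x a) (at level 40, left associativity) : ring_scope.

(* The part of the axioms that is needed to make adjointable operators between
   two modules a vector space. *)
HB.mixin Record isRightInner (R : realType) (A : cstarType R) X
    of BimodOps R A X := {
  ripDr : forall x y z : X, rip x (y + z) = rip x y + rip x z;
  ripZr : forall (k : R[i]) (x y : X), rip x (k *: y) = k *: rip x y;
  ripC : forall x y : X, rip y x = (rip x y)^#
}.

#[short(type="rightInnerType")]
HB.structure Definition RightInner (R : realType) (A : cstarType R) :=
  {X of BimodOps R A X & isRightInner R A X}.

HB.mixin Record isHilbertBimod (R : realType) (A : cstarType R) X
    of RightInner R A X & CompleteNormedModule R[i] X := {
  ractDl : forall (x y : X) (a : A), (x + y) *< a = x *< a + y *< a;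
  ractDr : forall (x : X) (a b : A), x *< (a + b) = x *< a + x *< b;
  ractZl : forall (k : R[i]) (x : X) (a : A), (k *: x) *< a = k *: (x *< a);
  ractZr : forall (k : R[i]) (x : X) (a : A), x *< (k *: a) = k *: (x *< a);
  ractA : forall (x : X) (a b : A), x *< (a ** b) = (x *< a) *< b;
  ract_nondeg : closed_span [set x *< a | x in [set: X] & a in [set: A]] = setT;
  rip_ract : forall (x y : X) (a : A), rip x (y *< a) = rip x y ** a;
  rip_pos : forall x : X, cstar_pos (rip x x);
  rip_norm : forall x : X, `|x| = sqrtC `|rip x x|;
  lactDl : forall (a b : A) (x : X), (a + b) >* x = a >* x + b >* x;
  lactDr : forall (a : A) (x y : X), a >* (x + y) = a >* x + a >* y;
  lactZl : forall (k : R[i]) (a : A) (x : X), (k *: a) >* x = k *: (a >* x);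
  lactZr : forall (k : R[i]) (a : A) (x : X), a >* (k *: x) = k *: (a >* x);
  lactA : forall (a b : A) (x : X), (a ** b) >* x = a >* (b >* x);
  lact_nondeg : closed_span [set a >* x | a in [set: A] & x in [set: X]] = setT;
  lipDl : forall x y z : X, lip (x + y) z = lip x z + lip y z;
  lipZl : forall (k : R[i]) (x y : X), lip (k *: x) y = k *: lip x y;
  lipC : forall x y : X, lip y x = (lip x y)^#;
  lip_lact : forall (a : A) (x y : X), lip (a >* x) y = a ** lip x y;
  lip_pos : forall x : X, cstar_pos (lip x x);
  lip_norm : forall x : X, `|x| = sqrtC `|lip x x|;
  lip_rip : forall x y z : X, lip x y >* z = x *< rip y z
}.

#[short(type="hilbertBimodType")]
HB.structure Definition HilbertBimod (R : realType) (A : cstarType R) :=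
  {X of CompleteNormedModule R[i] X & RightInner R A X & isHilbertBimod R A X}.

Definition full_bimod (R : realType) (A : cstarType R) (X : hilbertBimodType A) : Prop :=
  closed_span [set lip x y | x in [set: X] & y in [set: X]] = [set: A] /\
  closed_span [set rip x y | x in [set: X] & y in [set: X]] = [set: A].

Definition bimod_invariant (R : realType) (B : cstarType R) (Y : hilbertBimodType B)
    (I : set B) : Prop :=
  closed_span [set a >* y | a in I & y in [set: Y]] =
  closed_span [set y *< a | y in [set: Y] & a in I].

Record star_morphism (R : realType) (A B : starAlgType R)
    (f : {linear A -> B}) : Prop := {
  star_morphM : forall a b, f (a ** b) = f a ** f b;
  star_morph_star : forall a, f a^# = (f a)^#
}.

Record bimod_morphism (R : realType) (A B : starAlgType R)
    (X : bimodOpsType A) (Y : bimodOpsType B)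
    (fX : {linear X -> Y}) (fA : {linear A -> B}) : Prop := {
  bimod_morph_star : star_morphism fA;
  bimod_morph_ract : forall x a, fX (x *< a) = fX x *< fA a;
  bimod_morph_lact : forall a x, fX (a >* x) = fA a >* fX x;
  bimod_morph_rip : forall x y, fA (rip x y) = rip (fX x) (fX y);
  bimod_morph_lip : forall x y, fA (lip x y) = lip (fX x) (fX y)
}.

Definition bimod_isomorphism (R : realType) (A B : starAlgType R)
    (X : bimodOpsType A) (Y : bimodOpsType B)
    (fX : {linear X -> Y}) (fA : {linear A -> B}) : Prop :=
  [/\ bimod_morphism fX fA, bijective fX & bijective fA].

Section Coker.
Variables (R : realType) (U V : lmodType R[i]) (f : {linear U -> V}).

Definition in_range : V -> bool := fun v => `[< range f v >].

Lemma in_range_zmod : zmod_closed in_range.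
Proof.
split; first by apply/asboolP; exists 0 => //; exact: raddf0.
move=> x y /asboolP[u _ <-] /asboolP[v _ <-].
by apply/asboolP; exists (u - v) => //; exact: raddfB.
Qed.

HB.instance Definition _ := GRing.isZmodClosed.Build V in_range in_range_zmod.

Definition coker : Type := @Quotient.quot V (GRing.ZmodClosed.clone V in_range _).
HB.instance Definition _ := GRing.Zmodule.on coker.
HB.instance Definition _ := Quotient.on coker.

Definition coker_pi (v : V) : coker := \pi_coker%qT v.

Lemma coker_piP v w : coker_pi v = coker_pi w <-> range f (v - w).
Proof.
rewrite /coker_pi; split=> [/eqP|vw].
  by rewrite -Quotient.idealrBE => /asboolP.
by apply/eqP; rewrite -Quotient.idealrBE; apply/asboolP.
Qed.

Lemma coker_reprK (x : coker) : coker_pi (repr x) = x.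
Proof. exact: reprK. Qed.

Lemma coker_piD v w : coker_pi (v + w) = coker_pi v + coker_pi w.
Proof. exact: raddfD. Qed.

Definition coker_scale (k : R[i]) (x : coker) : coker := coker_pi (k *: repr x).

Lemma coker_piZ k v : coker_pi (k *: v) = coker_scale k (coker_pi v).
Proof.
apply/coker_piP; rewrite -scalerBr.
have /coker_piP[u _ <-] : coker_pi v = coker_pi (repr (coker_pi v)).
  by rewrite coker_reprK.
by exists (k *: u) => //; rewrite linearZ.
Qed.

Lemma coker_scaleA k l x :
  coker_scale k (coker_scale l x) = coker_scale (k * l) x.
Proof. by rewrite -(coker_reprK x) -!coker_piZ scalerA. Qed.

Lemma coker_scale1 : left_id 1 coker_scale.
Proof. by move=> x; rewrite -(coker_reprK x) -!coker_piZ scale1r. Qed.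

Lemma coker_scaleDr : right_distributive coker_scale +%R.
Proof.
move=> k x y; rewrite -(coker_reprK x) -(coker_reprK y).
by rewrite -coker_piD -!coker_piZ scalerDr coker_piD.
Qed.

Lemma coker_scaleDl x : {morph coker_scale^~ x : k l / k + l}.
Proof.
by move=> k l; rewrite -(coker_reprK x) -!coker_piZ scalerDl coker_piD.
Qed.

HB.instance Definition _ := GRing.Zmodule_isLmodule.Build R[i] coker
  coker_scaleA coker_scale1 coker_scaleDr coker_scaleDl.

Lemma coker_pi_linear : linear coker_pi.
Proof. by move=> k v w; rewrite coker_piD coker_piZ. Qed.

HB.instance Definition _ :=
  GRing.isLinear.Build R[i] V coker _ coker_pi coker_pi_linear.

End Coker.

(* Operations on quotients are computed on representatives.  They are
   independent of the choice of representatives for the quotients in use here: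
   the multiplier bimodule by its canonical submodule, and an extension by the
   bimodule that it extends. *)
HB.instance Definition _ (R : realType) (A : lmodType R[i]) (B : starAlgType R)
    (f : {linear A -> B}) :=
  hasMulStar.Build R (coker f)
    (fun x y => coker_pi f (repr x ** repr y))
    (fun x => coker_pi f (repr x)^#).

(* An alias of [coker fX] whose type also records [fA]. *)
Definition quotient_bimod (R : realType) (A X : lmodType R[i])
  (B : starAlgType R) (Y : bimodOpsType B) (fX : {linear X -> Y})
  (fA : {linear A -> B}) : Type := coker fX.

Section QuotientBimodule.
Variables (R : realType) (A X : lmodType R[i]) (B : starAlgType R)
  (Y : bimodOpsType B) (fX : {linear X -> Y}) (fA : {linear A -> B}).
Local Notation YX := (quotient_bimod fX fA).

HB.instance Definition _ := GRing.Lmodule.on YX.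
HB.instance Definition _ := hasBimodOps.Build R (coker fA) YX
  (fun b y => coker_pi fX (repr b >* repr (y : coker fX)))
  (fun y b => coker_pi fX (repr (y : coker fX) *< repr b))
  (fun y z => coker_pi fA (lip (repr (y : coker fX)) (repr (z : coker fX))))
  (fun y z => coker_pi fA (rip (repr (y : coker fX)) (repr (z : coker fX)))).
End QuotientBimodule.

Section Adjointable.
Variables (R : realType) (A : cstarType R) (E F : rightInnerType A).

Definition is_adjoint (T : E -> F) (S : F -> E) : Prop :=
  forall x y, rip (T x) y = rip x (S y).

Definition adjointable : {pred E -> F} :=
  fun T => `[< exists S, is_adjoint T S >].

Record adjop := Adjop { adj_fun :> E -> F; adj_funP : adj_fun \in adjointable }.

HB.instance Definition _ := [isSub for adj_fun].
HB.instance Definition _ := [Choice of adjop by <:].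

Lemma ripDl (G : rightInnerType A) (x y z : G) :
  rip (x + y) z = rip x z + rip y z.
Proof. by rewrite ripC ripDr astarD -!ripC. Qed.

Lemma ripZl (G : rightInnerType A) (k : R[i]) (x y : G) :
  rip (k *: x) y = Num.conj k *: rip x y.
Proof. by rewrite ripC ripZr astarZ -ripC. Qed.

Lemma adjointable_submod : submod_closed adjointable.
Proof.
split.
  apply/asboolP; exists 0 => x y /=.
  have -> : (0 : E -> F) x = 0 *: (0 : F) by rewrite scaler0.
  have -> : (0 : F -> E) y = 0 *: (0 : E) by rewrite scaler0.
  by rewrite ripZl ripZr conjC0 !scale0r.
move=> k T T' /asboolP[S TS] /asboolP[S' TS'].
apply/asboolP; exists (Num.conj k *: S + S') => x y /=.
have -> : (k *: T + T') x = k *: T x + T' x by [].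
have -> : (Num.conj k *: S + S') y = Num.conj k *: S y + S' y by [].
by rewrite ripDl ripDr ripZl ripZr TS TS'.
Qed.

HB.instance Definition _ :=
  GRing.isSubmodClosed.Build R[i] (E -> F) adjointable adjointable_submod.
HB.instance Definition _ := [SubChoice_isSubLmodule of adjop by <:].

Lemma adjop_ex (T : adjop) : exists S, is_adjoint T S.
Proof. by have /asboolP := adj_funP T. Qed.

End Adjointable.

Lemma adjoint_subproof (R : realType) (A : cstarType R) (E F : rightInnerType A)
  (T : adjop E F) : sval (cid (adjop_ex T)) \in @adjointable R A F E.
Proof.
apply/asboolP; exists T => y x; case: cid => S /= TS.
by rewrite ripC -TS -ripC.
Qed.

(* The adjoint is unique when the inner product of [E] is definite, as it is
   for every module considered here. *)
Definition adjoint (R : realType) (A : cstarType R) (E F : rightInnerType A)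
  (T : adjop E F) : adjop F E := Adjop (adjoint_subproof T).

Lemma adjointP (R : realType) (A : cstarType R) (E F : rightInnerType A)
  (T : adjop E F) : is_adjoint T (adjoint T).
Proof. by rewrite /=; case: cid. Qed.

Lemma adjcomp_subproof (R : realType) (A : cstarType R)
    (E F G : rightInnerType A) (S : adjop F G) (T : adjop E F) :
  S \o T \in @adjointable R A E G.
Proof.
by apply/asboolP; exists (adjoint T \o adjoint S) => x y; rewrite 2!adjointP.
Qed.

Definition adjcomp (R : realType) (A : cstarType R) (E F G : rightInnerType A)
  (S : adjop F G) (T : adjop E F) : adjop E G := Adjop (adjcomp_subproof S T).

HB.instance Definition _ (R : realType) (A : cstarType R) (E : rightInnerType A) :=
  hasMulStar.Build R (adjop E E) (@adjcomp R A E E E) (@adjoint R A E E).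

(* An alias that carries the bimodule structure of A over itself. *)
Definition selfmod (R : realType) (A : cstarType R) : Type := A.

Section SelfModule.
Variables (R : realType) (A : cstarType R).

HB.instance Definition _ := GRing.Lmodule.on (selfmod A).
HB.instance Definition _ := hasBimodOps.Build R A (selfmod A)
  (fun a b => (a : A) ** b) (fun a b => (a : A) ** b)
  (fun a b => (a : A) ** (b : A)^#) (fun a b => (a : A)^# ** b).

Lemma self_ripDr (a b c : selfmod A) : rip a (b + c) = rip a b + rip a c.
Proof. exact: amulDr. Qed.

Lemma self_ripZr (k : R[i]) (a b : selfmod A) : rip a (k *: b) = k *: rip a b.
Proof. exact: amulZr. Qed.

Lemma self_ripC (a b : selfmod A) : rip b a = (rip a b)^#.
Proof. by rewrite /rip /= astarM astarK. Qed.

HB.instance Definition _ :=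
  isRightInner.Build R A (selfmod A) self_ripDr self_ripZr self_ripC.

Definition multalg : Type := adjop (selfmod A) (selfmod A).

HB.instance Definition _ := StarAlg.on multalg.

Lemma iota_alg_subproof (a : A) :
  (fun b : selfmod A => (a ** b : selfmod A)) \in
    @adjointable R A (selfmod A) (selfmod A).
Proof.
apply/asboolP; exists (fun b : selfmod A => a^# ** b : selfmod A) => x y.
by rewrite /rip /= astarM amulA.
Qed.

Definition iota_alg (a : A) : multalg := Adjop (iota_alg_subproof a).

Lemma iota_alg_linear : linear iota_alg.
Proof.
by move=> k a b; apply/val_inj/funext => x; rewrite /= amulDl amulZl.
Qed.

HB.instance Definition _ :=
  GRing.isLinear.Build R[i] A multalg _ iota_alg iota_alg_linear.

End SelfModule.

Section MultiplierBimodule.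
Variables (R : realType) (A : cstarType R) (X : hilbertBimodType A).

Definition multmod : Type := adjop (selfmod A) X.

HB.instance Definition _ := GRing.Lmodule.on multmod.

Lemma iota_mod_subproof (x : X) :
  (fun b : selfmod A => x *< (b : A)) \in @adjointable R A (selfmod A) X.
Proof.
apply/asboolP; exists (fun y : X => rip x y : selfmod A) => b y.
by rewrite ripC rip_ract astarM -ripC.
Qed.

Definition iota_mod (x : X) : multmod := Adjop (iota_mod_subproof x).

Lemma iota_mod_linear : linear iota_mod.
Proof.
by move=> k x y; apply/val_inj/funext => b; rewrite /= ractDl ractZl.
Qed.

HB.instance Definition _ :=
  GRing.isLinear.Build R[i] X multmod _ iota_mod iota_mod_linear.

(* [phibar] is the isomorphism M(A) -> L(X) that extends the left action
   A -> K(X).  It exists, and is unique, when X is full; otherwise its value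
   is irrelevant. *)
Definition is_phibar (F : multalg A -> adjop X X) : Prop :=
  [/\ linear F,
      forall m n, F (m ** n) = F m ** F n,
      forall m, F m^# = (F m)^#,
      bijective F &
      forall a x, F (iota_alg a) x = a >* x].

Definition phibar : multalg A -> adjop X X := xget (fun=> 0) is_phibar.

Definition phibar_inv (P : adjop X X) : multalg A :=
  xget 0 [set m | phibar m = P].

HB.instance Definition _ := hasBimodOps.Build R (multalg A) multmod
  (fun (m : multalg A) (T : multmod) => adjcomp (phibar m) T)
  (fun (T : multmod) (m : multalg A) => adjcomp T m)
  (fun S T : multmod => phibar_inv (adjcomp S (adjoint T)))
  (fun S T : multmod => adjcomp (adjoint S) T).

End MultiplierBimodule.

Notation corona_alg A := (coker (@iota_alg _ A)).
Notation corona_mod X := (quotient_bimod (@iota_mod _ _ X) (@iota_alg _ _)).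

Record extension (R : realType) (A : cstarType R) (X : hilbertBimodType A) :=
    Extension {
  ext_alg : cstarType R;
  ext_mod : hilbertBimodType ext_alg;
  ext_psiA : {linear A -> ext_alg};
  ext_psiX : {linear X -> ext_mod};
  ext_morph : bimod_morphism ext_psiX ext_psiA;
  (* [ext_psiA] identifies A with an ideal of [ext_alg] *)
  ext_inj : injective ext_psiA;
  ext_ideal : closed_ideal (range ext_psiA);
  ext_invariant : bimod_invariant ext_mod (range ext_psiA)
}.

Notation ext_quot_alg E := (coker (ext_psiA E)).
Notation ext_quot_mod E := (quotient_bimod (ext_psiX E) (ext_psiA E)).

Section Busby.
Variables (R : realType) (A : cstarType R) (X : hilbertBimodType A)
  (E : extension X).

Definition essential_extension : Prop := essential_ideal (range (ext_psiA E)).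

Definition multiplier_lift (lX : {linear ext_mod E -> multmod X})
    (lA : {linear ext_alg E -> multalg A}) : Prop :=
  [/\ bimod_morphism lX lA,
      forall x, lX (ext_psiX E x) = iota_mod x &
      forall a, lA (ext_psiA E a) = iota_alg a].

(* When X is full, exactly one pair [(lX, lA)] satisfies [multiplier_lift], so
   that at most one pair [(dX, dA)] is as below. *)
Definition busby_morphism (dX : {linear ext_quot_mod E -> corona_mod X})
    (dA : {linear ext_quot_alg E -> corona_alg A}) : Prop :=
  bimod_morphism dX dA /\
  exists (lX : {linear ext_mod E -> multmod X})
         (lA : {linear ext_alg E -> multalg A}),
    [/\ multiplier_lift lX lA,
        forall y, dX (coker_pi (ext_psiX E) y) =
                  coker_pi (@iota_mod _ _ X) (lX y) &
        forall b, dA (coker_pi (ext_psiA E) b) =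
                  coker_pi (@iota_alg _ A) (lA b)].

End Busby.

(* Main.v *)
(* The extension is the pullback of (Z, C) and (M(X), M(A)) over the corona
   bimodule: B consists of the pairs (c, m) with deltaC c = m mod A, and Y of the
   pairs (z, T) with deltaZ z = T mod X.  The pairs (0, a) and (0, x) form the
   copy of (X, A), the first projections identify (Y/X, B/A) with (Z, C), and the
   second projections are the canonical morphism into the multipliers, so that
   the Busby morphism is the given one.  If deltaC c = 0 with c <> 0 then the
   pairs (c, 0) form a nonzero ideal that does not meet A; conversely an ideal J
   of B with J A = 0 consists of pairs (c, m) with m A = 0, that is with m = 0,
   so it lies in the kernel of deltaC.

   B is complete because deltaC is contractive for the quotient norm of M(A)/A:
   a selfadjoint contraction c is the real part of a unitary c + i sqrt(1 - c^2)
   of the unitization, and a lift of a unitary has norm at most 1 after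
   multiplication by 1 - u for suitable approximate units u of A.  The inner
   products of Y are positive since T^*T and TT^* are positive multipliers, by
   Kaplansky's argument that b^*b = - d^*d only for d = 0. *)
Require Import Defs.
From HB Require Import structures.
From mathcomp Require Import all_boot all_order all_algebra.
From mathcomp Require Import complex.
From mathcomp Require Import all_classical all_reals.
From mathcomp Require Import topology normedtype.
From mathcomp Require Import ring lra.
Set Implicit Arguments.
Unset Strict Implicit.
Unset Printing Implicit Defensive.
Import Order.TTheory GRing.Theory Num.Theory.
Import numFieldNormedType.Exports.
Local Open Scope classical_set_scope.
Local Open Scope ring_scope.
Local Open Scope complex_scope.

(** * Real-valued norms *)

(** [adjop] asks only for a set-theoretic adjoint and [phibar] is a bare choice, so three facts
    precede the pullback: boundedness of adjointable operators, the C*-norm of M(A), and the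
    isomorphism of M(A) with L(X). Instead of functional calculus, square roots come from an
    iteration, and positivity of a selfadjoint [h] is the inequality [|t - h| <= t] for some [t],
    which passes to pullbacks because the norm there is a maximum. The corona is given no norm.
    Contractivity of [deltaC] is expressed by lifts: every lift of [c] lies within [|c| + e] of A
    for each [e > 0], which makes the graph of [deltaC] closed. The same then holds for [deltaZ],
    since T belongs to X as soon as its inner square belongs to A. *)

Section SeqNorm.
Variables (R : realType) (V : zmodType) (N : V -> R).

(** The norm is an arbitrary real function, so that the same notions serve [gn] and [opn], which
    live on types without a normed structure. *)
Definition seq_cauchy (u : nat -> V) := forall e, 0 < e ->
  exists n0, forall m n, (n0 <= m)%N -> (n0 <= n)%N -> N (u m - u n) <= e.

Definition seq_lim (u : nat -> V) (l : V) := forall e, 0 < e ->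
  exists n0, forall n, (n0 <= n)%N -> N (u n - l) <= e.

Definition seq_complete := forall u, seq_cauchy u -> exists l, seq_lim u l.

End SeqNorm.

Section RealNorm.
Variable R : realType.

Lemma normC_Re (z : R[i]) : `|z| = (complex.Re `|z|)%:C.
Proof. by case: z => a b; rewrite normc_def. Qed.

Lemma ge0_Re (z : R[i]) : 0 <= z -> z = (complex.Re z)%:C.
Proof. by case: z => a b; rewrite lecE /= => /andP[/eqP -> _]. Qed.

Lemma conj_real (t : R) : Num.conj (t%:C : R[i]) = t%:C.
Proof. exact: conjc_real. Qed.

Lemma conj_i : Num.conj ('i : R[i]) = - 'i.
Proof. by apply/eqP; rewrite eq_complex /= oppr0 !eqxx. Qed.

Lemma norm_real (t : R) : `|t%:C : R[i]| = `|t|%:C.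
Proof. by rewrite normc_def /= expr0n /= addr0 sqrtr_sqr. Qed.

Lemma lec_real (s t : R) : (s%:C <= t%:C :> R[i]) = (s <= t).
Proof. by rewrite lecR. Qed.

Lemma ltc_real (s t : R) : (s%:C < t%:C :> R[i]) = (s < t).
Proof. by rewrite ltcR. Qed.

Lemma realC0 : 0%:C = 0 :> R[i]. Proof. by []. Qed.

Lemma gtc0_real (e : R[i]) : 0 < e -> 0 < complex.Re e /\ e = (complex.Re e)%:C.
Proof.
move=> e0; have eE := ge0_Re (ltW e0); split => //.
by rewrite -ltc_real -eE realC0.
Qed.

End RealNorm.

(** The norm of a complex normed module is [R[i]]-valued; [lra] and [nra] need a real one. *)
Definition nm (R : realType) (V : normedModType R[i]) (x : V) : R :=
  complex.Re `|x|.

Section NmTheory.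
Variables (R : realType) (V : normedModType R[i]).
Implicit Types x y : V.

Lemma nmE x : `|x| = (nm x)%:C.
Proof. exact: ge0_Re (normr_ge0 _). Qed.

Lemma nm_ge0 x : 0 <= nm x.
Proof. by rewrite -lec_real -nmE normr_ge0. Qed.

Lemma nmD x y : nm (x + y) <= nm x + nm y.
Proof. by rewrite -lec_real rmorphD /= -!nmE ler_normD. Qed.

Lemma nmN x : nm (- x) = nm x.
Proof. by rewrite /nm normrN. Qed.

Lemma nmB x y : nm (x - y) <= nm x + nm y.
Proof. by rewrite -(nmN y) nmD. Qed.

Lemma nmC x y : nm (x - y) = nm (y - x).
Proof. by rewrite -opprB nmN. Qed.

Lemma nmZ (k : R[i]) x : nm (k *: x) = complex.Re `|k| * nm x.
Proof.
by apply: (@complexI R); rewrite rmorphM /= -nmE -normC_Re normrZ -nmE.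
Qed.

Lemma nmZr (t : R) x : nm (t%:C *: x) = `|t| * nm x.
Proof. by rewrite nmZ norm_real. Qed.

Lemma nm0 : nm (0 : V) = 0.
Proof. by rewrite /nm normr0. Qed.

Lemma nm_eq0 x : nm x = 0 -> x = 0.
Proof. by move=> x0; apply/normr0_eq0; rewrite nmE x0. Qed.

Lemma nm_le0 x : nm x <= 0 -> x = 0.
Proof. by move=> x0; apply/nm_eq0/le_anti; rewrite x0 nm_ge0. Qed.

Lemma nm_eps0 x : (forall e, 0 < e -> nm x <= e) -> x = 0.
Proof.
move=> h; apply: nm_le0; rewrite leNgt; apply/negP => x0.
by have := h (nm x / 2) ltac:(lra); lra.
Qed.

Lemma nm_dist y x z : nm (x - z) <= nm (x - y) + nm (y - z).
Proof. by rewrite (le_trans _ (nmD _ _)) // addrA subrK. Qed.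

Lemma closureP (S : set V) x :
  closure S x <-> forall e, 0 < e -> exists2 y, S y & nm (x - y) <= e.
Proof.
split=> [clx e e0|h B].
  have /clx[y [Sy]] : nbhs x (ball_ Num.norm x e%:C).
    by rewrite -nbhs_nbhs_norm; exists e%:C => //=; rewrite ltc_real.
  by rewrite /= nmE ltc_real => /ltW; exists y.
rewrite -nbhs_nbhs_norm => -[e /= /gtc0_real[e0 eE] xeB].
have [y Sy yx] := h (complex.Re e / 2) ltac:(lra).
exists y; split=> //; apply: xeB; rewrite /= nmE eE ltc_real.
by apply: (le_lt_trans yx); lra.
Qed.

Lemma closed_nm (S : set V) :
  (forall x, (forall e, 0 < e -> exists2 y, S y & nm (x - y) <= e) -> S x) ->
  closed S.
Proof. by move=> h x /closureP/h. Qed.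

End NmTheory.

Section Complete.
Variables (R : realType) (V : completeNormedModType R[i]).

Lemma nm_complete : seq_complete (@nm R V).
Proof.
move=> u cu.
have /cauchy_cvg : cauchy (u @ \oo).
  apply/cauchy_exP => e /gtc0_real[e0 eE].
  have [n0 h] := cu (complex.Re e / 2) ltac:(lra).
  exists (u n0), n0 => // n /= nn0; rewrite -ball_normE /= nmE eE ltc_real.
  by apply: le_lt_trans (h _ _ _ _) _ => //; lra.
move=> /cvg_ex[l /cvgrPdist_le ul]; exists l => e e0.
have [n0 _ h] := ul e%:C ltac:(by rewrite ltc_real).
by exists n0 => n /h /=; rewrite nmE lec_real nmC.
Qed.

End Complete.

(** The multiplier algebra, the pullback algebra and the pullback module obtain their Banach
    structure from real norms for which only sequential completeness is shown. *)
HB.factory Record Lmodule_isBanach (R : realType) V of GRing.Lmodule R[i] V := {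
  bnm : V -> R;
  bnmD : forall x y, bnm (x + y) <= bnm x + bnm y;
  bnmZ : forall (k : R[i]) x, bnm (k *: x) = complex.Re `|k| * bnm x;
  bnm_eq0 : forall x, bnm x = 0 -> x = 0;
  bnm_complete : seq_complete bnm
}.

HB.builders Context R V of Lmodule_isBanach R V.

Let norm (x : V) : R[i] := (bnm x)%:C.

Let ler_normD (x y : V) : norm (x + y) <= norm x + norm y.
Proof. by rewrite /norm -rmorphD /= lec_real bnmD. Qed.

Let normrZ (k : R[i]) (x : V) : norm (k *: x) = `|k| * norm x.
Proof. by rewrite /norm bnmZ rmorphM /= -normC_Re. Qed.

Let normr0_eq0 (x : V) : norm x = 0 -> x = 0.
Proof. by move=> /(@complexI R); exact: bnm_eq0. Qed.

HB.instance Definition _ :=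
  Lmodule_isNormed.Build R[i] V ler_normD normrZ normr0_eq0.

Let nm_bnm (x : V) : nm x = bnm x.
Proof. by []. Qed.

Let complete (F : set_system V) : ProperFilter F -> cauchy F -> cvg F.
Proof.
move=> FF /(@cauchyP R[i] V) cF.
(* A Cauchy filter is replaced by a sequence: [u n] is within [1/(n+1)] of a whole member of the
   filter, and any two members meet, so [u] is Cauchy. *)
have small n : exists x : V, \forall y \near F, nm (x - y) <= n.+1%:R^-1.
  have e0 : 0 < (n.+1%:R^-1)%:C :> R[i] by rewrite ltc_real invr_gt0.
  have [x Fx] := cF _ e0; exists x.
  by apply: filterS Fx => y; rewrite -ball_normE /= nmE ltc_real => /ltW.
have [u uF] := choice small.
have arch (e : R) : 0 < e -> exists n0, forall n, (n0 <= n)%N -> n.+1%:R^-1 <= e.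
  move=> e0; exists (Num.truncn e^-1) => n n0n.
  rewrite -[leRHS]invrK lef_pV2 ?posrE ?invr_gt0 ?ltr0n//.
  by apply/ltW; rewrite (lt_le_trans (truncnS_gt _)) // ler_nat.
have cu : seq_cauchy bnm u.
  move=> e e0; have [n0 n0e] := arch (e / 2) ltac:(lra).
  exists n0 => m n mn nn.
  have [y [ym yn]] := @filter_ex _ _ FF _ (filterI (uF m) (uF n)).
  rewrite -nm_bnm (le_trans (nm_dist y _ _)) // (nmC y).
  move: ym yn (n0e m mn) (n0e n nn) => /=.
  by move: (m.+1%:R^-1) (n.+1%:R^-1) => p q; lra.
have [l ul] := bnm_complete cu.
apply/cvg_ex; exists l; apply/cvgrPdist_le => e /gtc0_real[e0 eE].
have [n1 n1e] := arch (complex.Re e / 2) ltac:(lra).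
have [n2 n2e] := ul (complex.Re e / 2) ltac:(lra).
apply: filterS (uF (maxn n1 n2)) => y yu; rewrite nmE eE lec_real.
rewrite (le_trans (nm_dist (u (maxn n1 n2)) _ _)) // (nmC l).
move: yu (n1e _ (leq_maxl n1 n2)) (n2e _ (leq_maxr n1 n2)) => /=.
by rewrite -nm_bnm (nmC (u _)); move: (_.+1%:R^-1) => p; lra.
Qed.

HB.instance Definition _ := Uniform_isComplete.Build V complete.

HB.end.

(** * Identities in modules and algebras *)

(** Products do not commute, so [ring] cannot treat these identities directly. Reified as linear
    combinations of opaque atoms, they leave one scalar equation per atom, for [ring] or [field]. *)
Inductive lexp (K : Type) : Type :=
  | LZero | LAtom of nat | LAdd of lexp K & lexp K | LOpp of lexp K
  | LScale of K & lexp K.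
Arguments LZero {K}.
Arguments LAtom {K}.

Section Lexp.
Variables (K : comPzRingType) (V : lmodType K).

Fixpoint leval (env : seq V) (e : lexp K) : V :=
  match e with
  | LZero => 0
  | LAtom i => nth 0 env i
  | LAdd a b => leval env a + leval env b
  | LOpp a => - leval env a
  | LScale k a => k *: leval env a
  end.

Fixpoint lcoef (i : nat) (e : lexp K) : K :=
  match e with
  | LZero => 0
  | LAtom j => if Nat.eqb i j then 1 else 0
  | LAdd a b => lcoef i a + lcoef i b
  | LOpp a => - lcoef i a
  | LScale k a => k * lcoef i a
  end.

Lemma leval_sum env e :
  leval env e = \sum_(i < size env) lcoef i e *: nth 0 env i.
Proof.
elim: e => [|j|a IHa b IHb|a IHa|k a IHa] /=.
- by rewrite big1 // => i _; rewrite scale0r.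
- have eqE i : Nat.eqb i j = (i == j) by apply/PeanoNat.Nat.eqb_spec/eqP.
  have [js|sj] := ltnP j (size env).
    rewrite (bigD1 (Ordinal js)) //= eqE eqxx scale1r big1 ?addr0 // => i.
    by rewrite eqE -val_eqE /= => /negPf ->; rewrite scale0r.
  rewrite nth_default // big1 // => i _; rewrite eqE.
  by rewrite ltn_eqF ?scale0r // (leq_trans _ sj).
- by rewrite IHa IHb -big_split; apply: eq_bigr => i _; rewrite scalerDl.
- by rewrite IHa -sumrN; apply: eq_bigr => i _; rewrite scaleNr.
- by rewrite IHa scaler_sumr; apply: eq_bigr => i _; rewrite scalerA.
Qed.

Fixpoint lcheck (n : nat) (a b : lexp K) : Prop :=
  if n is n'.+1 then lcoef n' a = lcoef n' b /\ lcheck n' a b else True.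

Lemma lcheck_eval env a b :
  lcheck (size env) a b -> leval env a = leval env b.
Proof.
move=> h; rewrite !leval_sum; apply: eq_bigr => i _; congr (_ *: _).
elim: (size env) h i => [_ []//|n IHn /= [e h] i].
have [->//|ni] := eqVneq (i : nat) n.
have iltn : (i < n)%N by rewrite ltn_neqAle ni -ltnS ltn_ord.
exact: (IHn h (Ordinal iltn)).
Qed.

End Lexp.

(* Atoms are compared up to conversion, since the same product can be inferred
   from different structures on its carrier. *)
Ltac lm_idx x l :=
  match l with
  | cons ?y _ => let _ := constr:(erefl x : x = y) in constr:(O)
  | cons _ ?t => let n := lm_idx x t in constr:(S n)
  end.

Ltac lm_in x l :=
  match l with
  | nil => constr:(false)
  | cons ?y _ => let _ := constr:(erefl x : x = y) in constr:(true)
  | cons _ ?t => lm_in x t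
  end.

Ltac lm_atoms e l :=
  lazymatch e with
  | GRing.add ?a ?b => let l1 := lm_atoms a l in lm_atoms b l1
  | GRing.opp ?a => lm_atoms a l
  | GRing.scale _ ?a => lm_atoms a l
  | GRing.zero => l
  | _ => let b := lm_in e l in
         lazymatch b with true => l | false => constr:(cons e l) end
  end.

Ltac lm_reify K e l :=
  lazymatch e with
  | GRing.add ?a ?b =>
    let a' := lm_reify K a l in let b' := lm_reify K b l in
    constr:(@LAdd K a' b')
  | GRing.opp ?a => let a' := lm_reify K a l in constr:(@LOpp K a')
  | GRing.scale ?k ?a => let a' := lm_reify K a l in constr:(@LScale K k a')
  | GRing.zero => constr:(@LZero K)
  | _ => let n := lm_idx e l in constr:(@LAtom K n)
  end.

Ltac lmod_goals K V :=
  lazymatch goal with |- ?a = ?b =>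
    let l0 := lm_atoms a (@nil V) in
    let l := lm_atoms b l0 in
    let a' := lm_reify K a l in
    let b' := lm_reify K b l in
    apply: (@lcheck_eval _ _ l a' b');
    cbn [lcheck lcoef size Nat.eqb]; repeat split
  end.

(** * C*-algebra identities and the isometry of the involution *)

Section StarAlgebra.
Variables (R : realType) (A : cstarType R).
Implicit Types a b c : A.

(* Restatements of the axioms in which the operations are inferred from the
   abstract structure, so that [lmod] identifies the products that they yield
   with those written by hand. *)
Lemma cmulA a b c : a ** (b ** c) = a ** b ** c. Proof. exact: amulA. Qed.
Lemma cmulDl a b c : (a + b) ** c = a ** c + b ** c. Proof. exact: amulDl. Qed.
Lemma cmulDr a b c : a ** (b + c) = a ** b + a ** c. Proof. exact: amulDr. Qed.
Lemma cmulZl (k : R[i]) a b : (k *: a) ** b = k *: (a ** b).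
Proof. exact: amulZl. Qed.
Lemma cmulZr (k : R[i]) a b : a ** (k *: b) = k *: (a ** b).
Proof. exact: amulZr. Qed.
Lemma cstarD a b : (a + b)^# = a^# + b^#. Proof. exact: astarD. Qed.
Lemma cstarZ (k : R[i]) a : (k *: a)^# = Num.conj k *: a^#.
Proof. exact: astarZ. Qed.
Lemma cstarM a b : (a ** b)^# = b^# ** a^#. Proof. exact: astarM. Qed.
Lemma cstarK a : a^#^# = a. Proof. exact: astarK. Qed.

Lemma amul0l b : 0 ** b = 0 :> A.
Proof. by rewrite -[X in X ** _](scale0r 0) amulZl scale0r. Qed.

Lemma amul0r b : b ** 0 = 0 :> A.
Proof. by rewrite -[X in _ ** X](scale0r 0) amulZr scale0r. Qed.

Lemma amulNl a b : (- a) ** b = - (a ** b).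
Proof. by rewrite -[- a]scaleN1r amulZl scaleN1r. Qed.

Lemma amulNr a b : a ** (- b) = - (a ** b).
Proof. by rewrite -[- b]scaleN1r amulZr scaleN1r. Qed.

Lemma astar0 : 0^# = 0 :> A.
Proof. by rewrite -[X in X^#](scale0r 0) astarZ rmorph0 scale0r. Qed.

Lemma astarN a : (- a)^# = - a^#.
Proof. by rewrite -[- a]scaleN1r astarZ rmorphN rmorph1 scaleN1r. Qed.

Lemma nm_amul a b : nm (a ** b) <= nm a * nm b.
Proof. by rewrite -lec_real rmorphM /= -!nmE amul_norm. Qed.

Lemma nm_cstar a : nm (a^# ** a) = nm a ^+ 2.
Proof. by apply: (@complexI R); rewrite rmorphXn /= -!nmE cstar_norm. Qed.

Lemma nm_star a : nm a^# = nm a.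
Proof.
suff le b : nm b <= nm b^# by apply/le_anti; rewrite le -{2}(astarK a) le.
have := nm_amul b^# b; rewrite nm_cstar expr2.
have := nm_ge0 b; rewrite le_eqVlt => /predU1P[<- _|b0]; first exact: nm_ge0.
by rewrite ler_pM2r.
Qed.

Lemma nm_cstar' a : nm (a ** a^#) = nm a ^+ 2.
Proof. by rewrite -{1}(astarK a) nm_cstar nm_star. Qed.

Lemma star_self_eq0 a : a^# ** a = 0 -> a = 0.
Proof.
by move=> a0; apply/nm_eq0/eqP; rewrite -sqrf_eq0 -nm_cstar a0 nm0.
Qed.

End StarAlgebra.

Definition ncE := (@cmulDl, @cmulDr, @amulNl, @amulNr, @cmulZl, @cmulZr,
                   @amul0l, @amul0r).

Lemma mul_ii (R : realType) : 'i * 'i = -1 :> R[i].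
Proof. by rewrite -expr2 sqrCi. Qed.

Ltac lmod R :=
  lazymatch goal with |- @eq ?V _ _ =>
    let K := constr:(complex (Real.sort R)) in lmod_goals K V; ring end.

(** * Limits of sequences in a C*-algebra *)

Section Limits.
Variables (R : realType) (A : cstarType R).
Implicit Types (u v : nat -> A) (l m : A).
Local Notation lim := (seq_lim (@nm R A)).

Lemma seq_lim_unique u l m : lim u l -> lim u m -> l = m.
Proof.
move=> ul um; apply/subr0_eq/nm_eps0 => e e0.
have [n1 h1] := ul (e / 2) ltac:(lra); have [n2 h2] := um (e / 2) ltac:(lra).
rewrite (le_trans (nm_dist (u (maxn n1 n2)) _ _)) // (nmC l).
by have := h1 _ (leq_maxl n1 n2); have := h2 _ (leq_maxr n1 n2); lra.
Qed.

Lemma seq_limD u v l m : lim u l -> lim v m -> lim (fun n => u n + v n) (l + m).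
Proof.
move=> ul vm e e0.
have [n1 h1] := ul (e / 2) ltac:(lra); have [n2 h2] := vm (e / 2) ltac:(lra).
exists (maxn n1 n2) => n; rewrite geq_max => /andP[/h1 n1n /h2 n2n].
by rewrite opprD addrACA (le_trans (nmD _ _)) //; lra.
Qed.

Lemma seq_lim_bounded u l f K : 0 < K ->
  (forall n, nm (f (u n) - f l) <= K * nm (u n - l)) ->
  lim u l -> lim (f \o u) (f l).
Proof.
move=> K0 fK ul e e0; have [n0 h] := ul (e / K) ltac:(exact: divr_gt0).
exists n0 => n n0n /=; apply: (le_trans (fK n)).
by rewrite mulrC -ler_pdivlMr // h.
Qed.

Lemma seq_lim_cst l : lim (fun=> l) l.
Proof. by move=> e e0; exists 0%N => n _; rewrite subrr nm0 ltW. Qed.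

Lemma seq_lim_shift u l : lim u l -> lim (fun n => u n.+1) l.
Proof.
by move=> ul e /ul[n0 h]; exists n0 => n n0n; rewrite h // leqW.
Qed.

Lemma seq_lim_nm_le u l K : (forall n, nm (u n) <= K) -> lim u l -> nm l <= K.
Proof.
move=> uK ul; apply/ler_addgt0Pr => e /ul[n h].
have := nmD (u n) (l - u n); rewrite addrC subrK nmC.
by have := h n (leqnn n); have := uK n; lra.
Qed.

Lemma seq_lim_mull u l a : lim u l -> lim (fun n => a ** u n) (a ** l).
Proof.
apply: (@seq_lim_bounded _ _ (amul a) (nm a + 1)) => [|n].
  by have := nm_ge0 a; lra.
rewrite -amulNr -amulDr (le_trans (nm_amul _ _)) // ler_wpM2r ?nm_ge0 //; lra.
Qed.

Lemma seq_lim_star u l : lim u l -> lim (fun n => (u n)^#) l^#.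
Proof.
apply: (@seq_lim_bounded _ _ (@astar _ A) 1) => // n.
by rewrite -astarN -astarD nm_star mul1r.
Qed.

Lemma seq_lim_mulr u l a : lim u l -> lim (fun n => u n ** a) (l ** a).
Proof.
move=> /seq_lim_star/(seq_lim_mull a^#)/seq_lim_star; rewrite astarM !astarK.
by congr lim; apply/funext => n; rewrite astarM !astarK.
Qed.

Lemma seq_lim_scale u l (k : R[i]) : lim u l -> lim (fun n => k *: u n) (k *: l).
Proof.
apply: (@seq_lim_bounded _ _ (fun x => k *: x) (complex.Re `|k| + 1)) => [|n].
  by rewrite ltr_wpDl // -lec_real -normC_Re normr_ge0.
by rewrite -scalerBr nmZ ler_wpM2r ?nm_ge0 //; lra.
Qed.

Lemma seq_lim_sqr u l K : (forall n, nm (u n) <= K) -> lim u l ->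
  lim (fun n => u n ** u n) (l ** l).
Proof.
move=> uK ul; have lK := seq_lim_nm_le uK ul.
apply: (@seq_lim_bounded _ _ (fun x => x ** x) (2 * `|K| + 1)) ul => [|n].
  by have := normr_ge0 K; lra.
have -> : u n ** u n - l ** l = (u n - l) ** u n + l ** (u n - l).
  by rewrite !ncE; lmod R.
rewrite (le_trans (nmD _ _)) // (le_trans (lerD (nm_amul _ _) (nm_amul _ _))) //.
have d0 := nm_ge0 (u n - l); have Kk := ler_norm K.
have := ler_wpM2l d0 (le_trans (uK n) Kk).
have := ler_wpM2r d0 (le_trans lK Kk).
by move: (nm _) (nm _) (nm _) d0 => p q r; move: `|K| => k; nra.
Qed.

End Limits.

(** * Square roots and positivity *)

Section SqrtMajorant.
Variable R : realType.

(** This is [sqrt_iter] for the real number 1. It increases, is bounded by 1, and dominates the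
    norms of the iterates and of their steps for every contraction. *)
Fixpoint sqrt_majorant n : R :=
  if n is n'.+1 then (1 + sqrt_majorant n' ^+ 2) / 2 else 0.

Lemma sqrt_majorant_bounds n :
  [/\ 0 <= sqrt_majorant n, sqrt_majorant n <= 1 &
      sqrt_majorant n <= sqrt_majorant n.+1].
Proof.
elim: n => [|n [r0 r1 _]] /=; first by split; lra.
move: (sqrt_majorant n) r0 r1 => r r0 r1.
by split; [nra | nra |]; have := sqr_ge0 ((1 + r ^+ 2) / 2 - 1); nra.
Qed.

Lemma sqrt_majorant_cauchy (e : R) : 0 < e -> exists n0, forall m n,
  (n0 <= n)%N -> (n <= m)%N -> sqrt_majorant m - sqrt_majorant n <= e.
Proof.
move=> e0; pose S := range sqrt_majorant.
have hS : has_sup S.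
  split; first by exists (sqrt_majorant 0), 0%N.
  by exists 1 => _ [n _ <-]; have [] := sqrt_majorant_bounds n.
have mono : {homo sqrt_majorant : m n / (m <= n)%N >-> m <= n}.
  apply: homo_leq => // [y x z|n]; first exact: le_trans.
  by have [] := sqrt_majorant_bounds n.
have [_ [n0 _ <-] hn0] := sup_adherent e0 hS.
exists n0 => m n n0n nm.
have /ubP/(_ (sqrt_majorant m)) := sup_upper_bound hS.
by move=> /(_ (ex_intro2 _ _ m I erefl)); have := mono _ _ n0n; lra.
Qed.

End SqrtMajorant.

Section SquareRoot.
Variables (R : realType) (A : cstarType R).
Implicit Types x e : A.
Local Notation half := ((2^-1 : R)%:C).

(** A fixed point satisfies [e = (x + e^2) / 2], that is [(1 - e)^2 = 1 - x], without mention of a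
    unit. *)
Fixpoint sqrt_iter x n : A :=
  if n is n'.+1 then half *: (x + sqrt_iter x n' ** sqrt_iter x n') else 0.

Lemma nm_half (y : A) : nm (half *: y) = nm y / 2.
Proof. by rewrite nmZr ger0_norm ?invr_ge0 // mulrC. Qed.

Lemma sqrt_iter_nm x n : nm x <= 1 -> nm (sqrt_iter x n) <= sqrt_majorant R n.
Proof.
move=> x1; elim: n => [|n IHn] /=; first by rewrite nm0.
rewrite nm_half ler_wpM2r ?invr_ge0 // (le_trans (nmD _ _)) // lerD //.
rewrite (le_trans (nm_amul _ _)) // expr2 ler_pM ?nm_ge0 //.
Qed.

(** A difference of squares is [p (p - q) + (p - q) q] even when [p] and [q] do not commute, so the
    steps obey the recursion of the real majorant. *)
Lemma sqrt_iter_step x n : nm x <= 1 ->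
  nm (sqrt_iter x n.+1 - sqrt_iter x n) <=
  sqrt_majorant R n.+1 - sqrt_majorant R n.
Proof.
move=> x1; elim: n => [|n IHn].
  rewrite /= amul0l !subr0 addr0 nm_half expr0n /= addr0 ler_wpM2r ?invr_ge0 //.
have -> : sqrt_iter x n.+2 - sqrt_iter x n.+1 =
    half *: (sqrt_iter x n.+1 ** (sqrt_iter x n.+1 - sqrt_iter x n)
             + (sqrt_iter x n.+1 - sqrt_iter x n) ** sqrt_iter x n).
  rewrite [in LHS]/=  -[half *: (x + sqrt_iter x n ** _)]/(sqrt_iter x n.+1).
  rewrite -[X in _ - X = _]/(half *: (x + sqrt_iter x n ** sqrt_iter x n)).
  move: (sqrt_iter x n.+1) (sqrt_iter x n) => p q.
  by rewrite !ncE; lmod R.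
have [] := sqrt_majorant_bounds R n; have [] := sqrt_majorant_bounds R n.+1.
have := sqrt_iter_nm n x1; have := sqrt_iter_nm n.+1 x1.
rewrite -[sqrt_majorant R n.+2]/((1 + sqrt_majorant R n.+1 ^+ 2) / 2).
rewrite -[X in _ <= _ - X]/((1 + sqrt_majorant R n ^+ 2) / 2).
move: IHn; move: (sqrt_majorant R n.+1) (sqrt_majorant R n) => r s.
move: (sqrt_iter x n.+1) (sqrt_iter x n) => p q pq pr qs r0 _ _ s0 _ _.
have -> : (1 + r ^+ 2) / 2 - (1 + s ^+ 2) / 2 =
          (r * (r - s) + (r - s) * s) / 2 by lra.
rewrite nm_half ler_wpM2r ?invr_ge0 // (le_trans (nmD _ _)) // lerD //.
  by rewrite (le_trans (nm_amul _ _)) // ler_pM ?nm_ge0.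
by rewrite (le_trans (nm_amul _ _)) // ler_pM ?nm_ge0.
Qed.

(* [1 - e] is a square root of [1 - x]. *)
Lemma sqrt_fixpoint x : x^# = x -> nm x <= 1 -> exists e,
  [/\ e^# = e, nm e <= 1, e + e - e ** e = x &
      forall z, z ** x = x ** z -> z ** e = e ** z].
Proof.
move=> xs x1; pose u := sqrt_iter x.
have dist m n : (n <= m)%N ->
    nm (u m - u n) <= sqrt_majorant R m - sqrt_majorant R n.
  elim: m => [|m IHm]; first by rewrite leqn0 => /eqP ->; rewrite !subrr nm0.
  rewrite leq_eqVlt => /predU1P[->|]; first by rewrite !subrr nm0.
  rewrite ltnS => /IHm; have := sqrt_iter_step m x1.
  by have := nm_dist (u m) (u m.+1) (u n); rewrite -/u; lra.
have /nm_complete[e ue] : seq_cauchy (@nm R A) u.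
  move=> d d0; have [n0 h] := sqrt_majorant_cauchy d0; exists n0 => m n n0m n0n.
  have [nm|/ltnW mn] := leqP n m; first exact: le_trans (dist _ _ _) (h _ _ _ _).
  by rewrite nmC; exact: le_trans (dist _ _ _) (h _ _ _ _).
have u1 n : nm (u n) <= 1.
  by apply: le_trans (sqrt_iter_nm n x1) _; have [] := sqrt_majorant_bounds R n.
exists e; split.
- apply: seq_lim_unique (seq_lim_star ue) _.
  have <- : u = fun n => (u n)^# by
    apply/funext; elim=> [|n IHn]; rewrite /u /= ?astar0 // cstarZ conj_real
      cstarD xs cstarM -/u -IHn.
  exact: ue.
- exact: seq_lim_nm_le u1 ue.
- have eE : e = half *: (x + e ** e).
    apply: seq_lim_unique (seq_lim_shift ue) _.
    exact: seq_lim_scale half (seq_limD (seq_lim_cst x) (seq_lim_sqr u1 ue)).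
  rewrite {1 2}eE (_ : half = 2^-1); last by rewrite fmorphV rmorph_nat.
  by rewrite -scalerDl -[2^-1]div1r -splitr scale1r addrK.
- move=> z zx; apply: seq_lim_unique (seq_lim_mull z ue) _.
  have -> : (fun n => z ** u n) = (fun n => u n ** z).
    apply/funext; elim=> [|n IHn]; first by rewrite amul0r amul0l.
    rewrite /u /= -/u cmulZr cmulZl cmulDr cmulDl zx cmulA IHn.
    by rewrite -!cmulA IHn.
  exact: seq_lim_mulr.
Qed.

End SquareRoot.

Lemma nm_double (R : realType) (V : normedModType R[i]) (x : V) :
  nm (x + x) = 2 * nm x.
Proof.
rewrite -mulr2n -scaler_nat nmZ normr_nat.
by have -> : (2%:R : R[i]) = 2%:R%:C by rewrite rmorph_nat.
Qed.

(** * Unital C*-algebras: Kaplansky's argument, positivity, approximate units *)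

Section Unital.
Variables (R : realType) (U : cstarType R) (one : U).
Hypothesis one_l : forall a : U, one ** a = a.
Hypothesis one_r : forall a : U, a ** one = a.
Implicit Types a b h k x : U.

Lemma one_star : one^# = one.
Proof. by rewrite -[LHS]one_l -{1}[one]cstarK -cstarM one_l cstarK. Qed.

(** Equality fails in the zero algebra, which is allowed. *)
Lemma nm_one_le1 : nm one <= 1.
Proof.
have := nm_cstar one; rewrite one_r -[nm one^#]/(nm one^#) nm_star => h.
have [->//|n0] := eqVneq (nm one) 0.
by rewrite -(mulfK n0 (nm one)) -expr2 -h divff.
Qed.

Definition uE := (ncE, one_l, one_r).

Lemma nm_real_one (t : R) : 0 <= t -> nm (t%:C *: one) <= t.
Proof.
by move=> t0; rewrite nmZr ger0_norm // ler_piMr // nm_one_le1.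
Qed.

(** Rescaling by [t] reduces to the contraction [x = 1 - h / t], with root [sqrt t (1 - e)]. The
    last clause puts the root under the same hypothesis, with [sqrt t] for [t], so that roots can be
    iterated. *)
Lemma unital_sqrt h (t : R) : 0 < t -> h^# = h -> nm (t%:C *: one - h) <= t ->
  exists k, [/\ k^# = k, k ** k = h,
    forall z, z ** h = h ** z -> z ** k = k ** z &
    nm ((Num.sqrt t)%:C *: one - k) <= Num.sqrt t].
Proof.
move=> t0 hs ht.
have tC : (t%:C : R[i]) != 0 by rewrite -realC0 (inj_eq (@complexI R)) gt_eqF.
pose x := one - (t%:C)^-1 *: h.
have xE : x = (t^-1)%:C *: (t%:C *: one - h).
  by rewrite scalerBr scalerA fmorphV mulVf // scale1r.
have xs : x^# = x.
  by rewrite xE cstarZ conj_real cstarD astarN cstarZ conj_real one_star hs.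
have x1 : nm x <= 1.
  rewrite xE nmZr ger0_norm ?invr_ge0 ?(ltW t0) // ler_pdivrMl // mulr1 //.
have [e [es e1 ex ec]] := sqrt_fixpoint xs x1.
pose s := Num.sqrt t; have s0 : 0 <= s := sqrtr_ge0 t.
have ss : s%:C * s%:C = t%:C :> R[i].
  by rewrite -rmorphM -expr2 sqr_sqrtr // ltW.
exists (s%:C *: (one - e)); split.
- by rewrite cstarZ conj_real cstarD astarN one_star es.
- have -> : h = t%:C *: (one - x).
    by rewrite opprB addrC subrK scalerA mulfV ?scale1r.
  by rewrite -ex -ss !uE; lmod R.
- move=> z zh; have /ec ze : z ** x = x ** z by rewrite /x !uE zh.
  by rewrite !uE ze.
- rewrite -/s (_ : _ - _ = s%:C *: e); last by lmod R.
  by rewrite nmZr ger0_norm // ler_piMr.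
Qed.

(* The operator [u := h + i l] satisfies [u^# ** u = t], which bounds
   [2 i l = u - u^#] and [4 i h l = u^2 - (u^#)^2]. *)
Lemma sqr_le_sqrt h (t : R) : 0 < t -> h^# = h -> nm (h ** h) <= t -> exists l,
  [/\ l^# = l, l ** l = t%:C *: one - h ** h,
      forall z, z ** h = h ** z -> z ** l = l ** z,
      nm (t%:C *: one - h ** h) <= t & nm (h ** l) <= t / 2].
Proof.
move=> t0 hs hh.
have gs : (t%:C *: one - h ** h)^# = t%:C *: one - h ** h.
  by rewrite cstarD astarN cstarZ conj_real one_star cstarM hs.
have gt : nm (t%:C *: one - (t%:C *: one - h ** h)) <= t.
  by rewrite opprB addrC subrK.
have [l [ls ll lc _]] := unital_sqrt t0 gs gt.
have lc' z : z ** h = h ** z -> z ** l = l ** z.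
  by move=> zh; apply: lc; rewrite !uE cmulA zh -!cmulA zh.
have hl : h ** l = l ** h by exact: lc'.
pose u := h + 'i *: l.
have us : u^# = h - 'i *: l.
  by rewrite cstarD cstarZ conj_i scaleNr hs ls.
have prod (i : R[i]) : (h - i *: l) ** (h + i *: l) = h ** h - (i * i) *: (l ** l).
  by rewrite !uE hl; lmod R.
have uu : u^# ** u = t%:C *: one.
  by rewrite us prod mul_ii scaleN1r opprK ll addrC subrK.
have u2 : nm u ^+ 2 <= t by rewrite -nm_cstar uu nm_real_one // ltW.
have i2 : complex.Re `|'i *+ 2 : R[i]| = 2.
  by rewrite normrMn normCi -[1]/(1%:C) -rmorphMn.
have l1 : nm l <= nm u.
  have := nmB u u^#; rewrite nm_star us.
  rewrite (_ : u - _ = ('i *+ 2) *: l); last by rewrite /u; lmod R.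
  by rewrite nmZ i2; lra.
exists l; split=> //.
  rewrite -ll -{1}ls nm_cstar (le_trans _ u2) // lerXn2r ?nnegrE ?nm_ge0 //.
have := nmB (u ** u) (u^# ** u^#).
have := nm_amul u u; have := nm_amul u^# u^#; rewrite nm_star us.
rewrite (_ : u ** u - _ = ('i *+ 2) *: (h ** l + h ** l)); last first.
  by rewrite /u !uE hl; lmod R.
by rewrite nmZ i2 nm_double; nra.
Qed.

(* For [g := d^2] and [b := |g|] one has [g (T + g) = (T + b) g - g (b - g)], where
   the last term has norm at most [b^2 / 4]. *)
Lemma sqr_mul_bound_eq0 d (T : R) : d^# = d -> 0 <= T ->
  nm (d ** d ** (T%:C *: one + d ** d)) <= T * nm (d ** d) -> d = 0.
Proof.
move=> ds T0 hT; apply: star_self_eq0; rewrite ds.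
have := nm_ge0 (d ** d); rewrite le_eqVlt => /predU1P[|b0].
  by move/esym/nm_eq0.
have [l [ls ll lc _ dl]] := sqr_le_sqrt b0 ds (lexx _).
move: ll dl hT b0; set b := nm (d ** d) => ll dl hT b0.
have dlC : d ** l = l ** d by exact: lc.
have dE : (T + b)%:C *: (d ** d) =
    d ** d ** (T%:C *: one + d ** d) + (d ** l) ** (d ** l).
  rewrite {2}dlC -(cmulA d l) (cmulA l l) ll !uE !cmulA rmorphD /=.
  by lmod R.
have : nm ((T + b)%:C *: (d ** d)) <= T * b + b / 2 * (b / 2).
  rewrite dE (le_trans (nmD _ _)) // lerD // (le_trans (nm_amul _ _)) //.
  by rewrite ler_pM ?nm_ge0.
rewrite nmZr ger0_norm -/b; last by rewrite addr_ge0 // ltW.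
(* For [b > 0], [(T + b) b <= T b + b^2 / 4] is absurd. *)
by move=> le; exfalso; move: le b0; clear; nra.
Qed.

(* [b b^#] is positive, being twice a sum of squares plus [d^2].  Hence
   [|T - b b^#| <= T] for some [T], and
   [b^# (T - b b^#) b = - (T d^2 + d^4)] has norm at most [T |d^2|]. *)
Lemma neg_square_eq0 b d : d^# = d -> b^# ** b = - (d ** d) -> d = 0.
Proof.
move=> ds bd.
have pos h : h^# = h -> exists2 t : R, 0 <= t & nm (t%:C *: one - h ** h) <= t.
  move=> hs; have t0 : 0 < nm (h ** h) + 1 by have := nm_ge0 (h ** h); lra.
  exists (nm (h ** h) + 1); first exact: ltW.
  by have [|l []] := sqr_le_sqrt t0 hs; first lra.
(* [x := b + b^#] and [y := i (b - b^#)] are selfadjoint with [x^2 + y^2 = 2 (b b^# + b^# b)], hence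
   [b b^# = (x^2 + y^2) / 2 + d^2]; this dictates the constant [T]. *)
have xs : (b + b^#)^# = b + b^# by rewrite cstarD cstarK addrC.
have ys : ('i *: (b - b^#))^# = 'i *: (b - b^#).
  by rewrite cstarZ conj_i cstarD astarN cstarK scaleNr -scalerN opprB.
have [t1 t10 h1] := pos _ xs; have [t2 t20 h2] := pos _ ys.
have [t3 t30 h3] := pos _ ds.
pose T := (t1 + t2) / 2 + t3; have T0 : 0 <= T by rewrite /T; lra.
have hT : nm (T%:C *: one - b ** b^#) <= T.
  have -> : T%:C *: one - b ** b^# =
      (2^-1)%:C *: ((t1%:C *: one - (b + b^#) ** (b + b^#)) +
       (t2%:C *: one - 'i *: (b - b^#) ** ('i *: (b - b^#)))) +
      (t3%:C *: one - d ** d).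
    rewrite -[X in _ + (_ - X)]opprK -bd [_ ** ('i *: _)]cmulZr cmulZl scalerA.
    rewrite mul_ii.
    rewrite !uE /T !(rmorphD, rmorphM) /= !(fmorphV, rmorph_nat).
    by lmod_goals (R[i]) U; field.
  rewrite (le_trans (nmD _ _)) // lerD // nmZr ger0_norm ?invr_ge0 //.
  by have := nmD (t1%:C *: one - (b + b^#) ** (b + b^#))
     (t2%:C *: one - 'i *: (b - b^#) ** ('i *: (b - b^#))); lra.
apply: (sqr_mul_bound_eq0 ds T0).
rewrite -nmN (_ : - _ = b^# ** (T%:C *: one - b ** b^#) ** b); last first.
  rewrite !uE -!cmulA bd (cmulA b^# b) bd !uE !cmulA; lmod R.
rewrite (le_trans (nm_amul _ _)) //.
have -> : nm (d ** d) = nm b * nm b by rewrite -nmN -bd nm_cstar expr2.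
rewrite mulrA ler_wpM2r ?nm_ge0 // (le_trans (nm_amul _ _)) // nm_star.
by rewrite mulrC ler_wpM2r ?nm_ge0.
Qed.

(* The hypothesis is applied to [n := |h| - h] and [k := |h|^(1/2) n]. *)
Lemma jordan_pos h : h^# = h ->
  (forall n k, n^# = n -> k^# = k -> n ** h ** n = - (k ** k) -> k = 0) ->
  exists2 t : R, 0 <= t & nm (t%:C *: one - h) <= t.
Proof.
move=> hs hP; have t0 : 0 < nm (h ** h) + 1 by have := nm_ge0 (h ** h); lra.
have [|l [_ _ _ h2 _]] := sqr_le_sqrt t0 hs; first lra.
have h2s : (h ** h)^# = h ** h by rewrite cstarM hs.
(* [r] is the absolute value of [h], and [q] below is its square root. *)
have [r [rs rr rc rt]] := unital_sqrt t0 h2s h2.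
have s0 : 0 < Num.sqrt (nm (h ** h) + 1) by rewrite sqrtr_gt0.
have [q [qs qq qc _]] := unital_sqrt s0 rs rt.
have hr : h ** r = r ** h by apply: rc; rewrite cmulA.
have [n nE] : exists n, n = r - h by exists (r - h).
have ns : n^# = n by rewrite nE cstarD astarN rs hs.
have nr : n ** r = r ** n by rewrite nE !uE hr.
have qn : q ** n = n ** q by rewrite (qc n nr).
(* As [h n = - r n] and [r n^2 = (q n)^2], the hypothesis gives [q n = 0]; then [n^3 = 2 r n^2 = 0],
   and the selfadjoint [n = r - h] vanishes. *)
have hn : h ** n = - (r ** n) by rewrite nE !uE rr hr; lmod R.
have nn : n ** n = 2 *: (r ** n) by rewrite {1}nE !uE hn; lmod R.
have nhE : n ** h = h ** n by rewrite nE !uE hr.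
have kE : (q ** n) ** (q ** n) = r ** n ** n.
  by rewrite {1}qn -(cmulA n q) (cmulA q q n) qq cmulA nr.
have ks : (q ** n)^# = q ** n by rewrite cstarM qs ns qn.
have k0 : q ** n = 0.
  by apply: (hP n _ ns ks); rewrite nhE hn !uE kE.
have n3 : n ** n ** n = 0 by rewrite nn cmulZl -kE k0 amul0l scaler0.
have n2 : n ** n = 0.
  by apply: star_self_eq0; rewrite cstarM ns cmulA n3 amul0l.
have n0 : n = 0 by apply: star_self_eq0; rewrite ns.
exists (Num.sqrt (nm (h ** h) + 1)); first exact: ltW.
by move: n0 rt; rewrite nE => /subr0_eq <-.
Qed.

(* [1 - h v] is an average of the powers of the contraction [f := 1 - h / t];
   multiplication by [h] turns it into a telescoping sum. *)
Lemma approx_unit h (t e : R) : 0 < t -> 0 < e -> h^# = h ->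
  nm (t%:C *: one - h) <= t ->
  exists v, [/\ v^# = v, v ** h = h ** v, nm (one - h ** v) <= 1 &
                nm ((one - h ** v) ** h) <= e].
Proof.
move=> t0 e0 hs ht.
have tC : (t%:C : R[i]) != 0 by rewrite -realC0 (inj_eq (@complexI R)) gt_eqF.
pose f := one - (t%:C)^-1 *: h.
have fs : f^# = f.
  by rewrite /f -fmorphV cstarD astarN cstarZ conj_real one_star hs.
have f1 : nm f <= 1.
  rewrite (_ : f = (t^-1)%:C *: (t%:C *: one - h)).
    by rewrite nmZr ger0_norm ?invr_ge0 ?(ltW t0) // ler_pdivrMl // mulr1.
  by rewrite scalerBr scalerA fmorphV mulVf // scale1r.
(* [p] is [f^n] written as [1 - h V], and [n - h W] is the sum of the [f^j] for [j < n]; its product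
   with [h = t (1 - f)] telescopes to [t (1 - p)]. *)
have iter n : exists V W p : U,
    [/\ V^# = V, W^# = W, V ** h = h ** V, W ** h = h ** W & p = one - h ** V] /\
    [/\ nm p <= 1, (n%:R *: one - h ** W) ** h = t%:C *: (one - p) &
        nm (n%:R *: one - h ** W) <= n%:R].
  elim: n => [|n [V [W [p [[Vs Ws Vh Wh pE] [p1 ph nW]]]]]].
    exists 0, 0, one; split.
      by rewrite astar0 amul0l amul0r subr0.
    by rewrite nm_one_le1 amul0r subr0 scale0r amul0l subrr scaler0 nm0.
  have pC : p ** h = h ** p by rewrite pE !uE -cmulA Vh.
  have ps : p^# = p by rewrite pE cstarD astarN one_star cstarM hs Vs Vh.
  exists (V + (t%:C)^-1 *: p), (W + V), (p ** f); split; split.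
  - by rewrite cstarD -fmorphV cstarZ conj_real Vs ps.
  - by rewrite cstarD Vs Ws.
  - by rewrite !uE Vh pC.
  - by rewrite !uE Vh Wh.
  - by rewrite /f !uE pC {1}pE; lmod R.
  - rewrite (le_trans (nm_amul _ _)) // -[1]mulr1 ler_pM ?nm_ge0 //.
  - rewrite (_ : _ - _ = (n%:R *: one - h ** W) + p); last first.
      by rewrite pE !uE -natr1; lmod R.
    rewrite cmulDl ph /f !uE; lmod_goals (R[i]) U; field; exact: tC.
  - rewrite (_ : _ - _ = (n%:R *: one - h ** W) + p); last first.
      by rewrite pE !uE -natr1; lmod R.
    by rewrite (le_trans (nmD _ _)) // -natr1 lerD.
(* The telescoped sum has norm at most [2 t], and division by [n > 2 t / e] brings it below [e]. *)
pose n := (Num.truncn (2 * t / e)).+1.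
have n0 : 0 < n%:R :> R by rewrite ltr0n.
have nC : (n%:R : R[i]) != 0 by rewrite pnatr_eq0.
have [V [W [p [[Vs Ws Vh Wh pE] [p1 ph nW]]]]] := iter n.
have wE : one - h ** ((n%:R^-1)%:C *: W) = (n%:R^-1)%:C *: (n%:R *: one - h ** W).
  by rewrite scalerBr scalerA fmorphV rmorph_nat mulVf // scale1r cmulZr.
exists ((n%:R^-1)%:C *: W); split.
- by rewrite cstarZ conj_real Ws.
- by rewrite cmulZl Wh cmulZr.
- by rewrite wE nmZr ger0_norm ?invr_ge0 ?(ltW n0) // ler_pdivrMl // mulr1.
- rewrite wE cmulZl ph !nmZr !ger0_norm ?invr_ge0 ?(ltW n0) ?(ltW t0) //.
  rewrite mulrC ler_pdivrMr // -ler_pdivrMl //.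
  have : 2 * t / e < n%:R by exact: truncnS_gt.
  rewrite ltr_pdivrMr // => ht2.
  have := nmB one p; have := nm_one_le1 => ? ?; rewrite mulrC ler_pdivrMr //.
  by nra.
Qed.

End Unital.

(** * Hilbert modules and adjointable operators *)

Definition gn (R : realType) (A : cstarType R) (E : rightInnerType A) (x : E) : R :=
  Num.sqrt (nm (rip x x)).

(** Stated for [gn] because operators act between [selfmod A] and X, and the former carries an inner
    product but no norm; both satisfy it, by [hilbert_self] and [hilbert_bimod]. *)
Record hilbert_module (R : realType) (A : cstarType R) (E : rightInnerType A) :
    Prop := {
  hm_CS : forall x y : E, nm (rip x y) <= gn x * gn y;
  hm_def : forall x : E, gn x = 0 -> x = 0;
  hm_complete : seq_complete (@gn R A E);
  hm_ract : forall (x y : E) (a : A), rip x (y *< a) = rip x y ** a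
}.

Section HilbertModule.
Variables (R : realType) (A : cstarType R) (E : rightInnerType A).
Implicit Types x y z : E.

Lemma rip0r x : rip x 0 = 0.
Proof. by rewrite -(scale0r (0 : E)) ripZr scale0r. Qed.

Lemma ripNr x y : rip x (- y) = - rip x y.
Proof. by rewrite -[- y]scaleN1r ripZr scaleN1r. Qed.

Lemma ripBr x y z : rip x (y - z) = rip x y - rip x z.
Proof. by rewrite ripDr ripNr. Qed.

Lemma ripNl x y : rip (- x) y = - rip x y.
Proof. by rewrite ripC ripNr astarN -ripC. Qed.

Lemma ripBl x y z : rip (x - y) z = rip x z - rip y z.
Proof. by rewrite ripDl ripNl. Qed.

Lemma gn_ge0 x : 0 <= gn x. Proof. exact: sqrtr_ge0. Qed.

Lemma gn_sqr x : gn x ^+ 2 = nm (rip x x).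
Proof. by rewrite sqr_sqrtr // nm_ge0. Qed.

Lemma gn_ext x (y : E) : rip x x = rip y y -> gn x = gn y.
Proof. by rewrite /gn => ->. Qed.

Lemma gnZ (k : R[i]) x : gn (k *: x) = complex.Re `|k| * gn x.
Proof.
have k0 : 0 <= complex.Re `|k| by rewrite -lec_real -normC_Re normr_ge0.
rewrite /gn ripZl ripZr scalerA nmZ normrM norm_conjC -expr2.
rewrite (normC_Re k) -rmorphXn /= sqrtrM ?exprn_ge0 // sqrtr_sqr ger0_norm //.
Qed.

Lemma gnZr (t : R) x : gn (t%:C *: x) = `|t| * gn x.
Proof. by rewrite gnZ norm_real. Qed.

Lemma gnN x : gn (- x) = gn x.
Proof. by apply: gn_ext; rewrite ripNl ripNr opprK. Qed.

Lemma gn0 : gn (0 : E) = 0.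
Proof. by rewrite /gn rip0r nm0 sqrtr0. Qed.

Lemma gnC x y : gn (x - y) = gn (y - x).
Proof. by rewrite -opprB gnN. Qed.

Hypothesis hE : hilbert_module E.

Lemma gnD x y : gn (x + y) <= gn x + gn y.
Proof.
rewrite -(@ler_pXn2r _ 2) ?nnegrE ?addr_ge0 ?gn_ge0 //.
rewrite gn_sqr ripDl !ripDr.
apply: (le_trans (nmD _ _)); apply: (le_trans (lerD (nmD _ _) (nmD _ _))).
rewrite -!gn_sqr.
have := hm_CS hE x y; have := hm_CS hE y x.
by move: (nm _) (nm _) (gn x) (gn y) => p q r s; lra.
Qed.

Lemma gn_dist y x z : gn (x - z) <= gn (x - y) + gn (y - z).
Proof. by rewrite (le_trans _ (gnD _ _)) // addrA subrK. Qed.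

Lemma rip_injr x y : (forall z, rip z x = rip z y) -> x = y.
Proof.
move=> h; apply/subr0_eq/(hm_def hE).
by rewrite /gn ripBr h subrr nm0 sqrtr0.
Qed.

End HilbertModule.

Section Bimodule.
Variables (R : realType) (A : cstarType R) (X : hilbertBimodType A).
Implicit Types (x y z : X) (a b : A).

Lemma nm_sqr_of_norm (p : R) (q : R) : 0 <= p -> 0 <= q ->
  p%:C = sqrtC (q%:C : R[i]) -> p ^+ 2 = q.
Proof.
move=> p0 q0 e; apply: (@complexI R).
by rewrite rmorphXn /= e sqrtCK.
Qed.

Lemma nm_rip x : nm (rip x x) = nm x ^+ 2.
Proof.
by apply/esym/nm_sqr_of_norm; rewrite ?nm_ge0 // -!nmE rip_norm.
Qed.

Lemma nm_lip x : nm (lip x x) = nm x ^+ 2.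
Proof.
by apply/esym/nm_sqr_of_norm; rewrite ?nm_ge0 // -!nmE lip_norm.
Qed.

Lemma gn_nm x : gn x = nm x.
Proof. by rewrite /gn nm_rip sqrtr_sqr ger0_norm ?nm_ge0. Qed.

Lemma lip_lact_r a x y : lip x (a >* y) = lip x y ** a^#.
Proof. by rewrite lipC lip_lact cstarM -lipC. Qed.

Lemma ract0l a : 0 *< a = 0 :> X.
Proof. by rewrite -(scale0r (0 : X)) ractZl !scale0r. Qed.

Lemma lact0l x : 0 >* x = 0 :> X.
Proof. by rewrite -(scale0r (0 : A)) lactZl !scale0r. Qed.

Lemma ract0r x : x *< 0 = 0 :> X.
Proof. by rewrite -(scale0r (0 : A)) ractZr !scale0r. Qed.

Lemma lact0r a : a >* 0 = 0 :> X.
Proof. by rewrite -(scale0r (0 : X)) lactZr !scale0r. Qed.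

Lemma ractNr x a : x *< (- a) = - (x *< a).
Proof. by rewrite -[- a]scaleN1r ractZr scaleN1r. Qed.

Lemma lactNl x a : (- a) >* x = - (a >* x).
Proof. by rewrite -[- a]scaleN1r lactZl scaleN1r. Qed.

Lemma lactNr x a : a >* (- x) = - (a >* x).
Proof. by rewrite -[- x]scaleN1r lactZr scaleN1r. Qed.

(* The difference of both sides annihilates X from the right, as
   z<ax,y> = <z,ax>y = <z,x>a^#y = z<x,a^#y>. *)
Lemma rip_lact a x y : rip (a >* x) y = rip x (a^# >* y).
Proof.
have [r rE] : exists r, r = rip (a >* x) y - rip x (a^# >* y) by eexists.
have zr z : z *< r = 0.
  rewrite rE ractDr ractNr -!lip_rip lip_lact_r lactA; exact: subrr.
apply/subr0_eq/star_self_eq0; rewrite -rE {1}rE.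
by rewrite cstarD astarN -!ripC !ncE -!rip_ract !zr !rip0r subrr.
Qed.

Lemma nm_lact a x : nm (a >* x) <= nm a * nm x.
Proof.
rewrite -(@ler_pXn2r _ 2) ?nnegrE ?mulr_ge0 ?nm_ge0 //.
rewrite -nm_lip lip_lact lip_lact_r (le_trans (nm_amul _ _)) //.
rewrite exprMn expr2 -mulrA ler_wpM2l ?nm_ge0 //.
by rewrite (le_trans (nm_amul _ _)) // nm_star nm_lip mulrC.
Qed.

(* [|<x,y>|^2 = |<y,<x,x>y>| = |b y|^2] for [<x,x> = b^# b]. *)
Lemma cauchy_schwarz x y : nm (rip x y) <= nm x * nm y.
Proof.
rewrite -(@ler_pXn2r _ 2) ?nnegrE ?mulr_ge0 ?nm_ge0 //.
rewrite -nm_cstar -ripC -rip_ract -lip_rip exprMn -nm_lip.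
have [b ->] := lip_pos x; rewrite lactA -rip_lact nm_rip nm_cstar -exprMn.
by rewrite ler_pXn2r ?nnegrE ?mulr_ge0 ?nm_ge0 // nm_lact.
Qed.

Lemma nm_ract x a : nm (x *< a) <= nm x * nm a.
Proof.
rewrite -(@ler_pXn2r _ 2) ?nnegrE ?mulr_ge0 ?nm_ge0 //.
rewrite -nm_rip rip_ract [rip (x *< a) x]ripC rip_ract.
rewrite (le_trans (nm_amul _ _)) // nm_star exprMn -nm_rip [nm a ^+ 2]expr2.
by rewrite mulrA ler_wpM2r ?nm_ge0 // nm_amul.
Qed.

Lemma hilbert_bimod : hilbert_module X.
Proof.
split=> [x y|x|u|x y a].
- by rewrite !gn_nm cauchy_schwarz.
- by rewrite gn_nm; exact: nm_eq0.
- have -> : @gn R A X = @nm R X by apply/funext => x; rewrite gn_nm.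
  exact: nm_complete.
- exact: rip_ract.
Qed.

End Bimodule.

Section SelfHilbert.
Variables (R : realType) (A : cstarType R).

Lemma gn_self (a : selfmod A) : gn a = nm (a : A).
Proof. by rewrite /gn /rip /= nm_cstar sqrtr_sqr ger0_norm ?nm_ge0. Qed.

Lemma hilbert_self : hilbert_module (selfmod A).
Proof.
split=> [x y|x|u|x y a].
- by rewrite !gn_self (le_trans (nm_amul _ _)) // nm_star.
- by rewrite gn_self; exact: nm_eq0.
- have -> : @gn R A (selfmod A) = @nm R A by apply/funext => x; rewrite gn_self.
  exact: (@nm_complete R A).
- exact: amulA.
Qed.

End SelfHilbert.

Section AdjointBasics.
Variables (R : realType) (A : cstarType R) (E F : rightInnerType A).
Implicit Types (T : adjop E F) (x y z : E).

Lemma rip_adj_r T (y : F) x : rip y (T x) = rip (adjoint T y) x.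
Proof. by rewrite ripC (adjointP T) -ripC. Qed.

Hypothesis hF : hilbert_module F.

Lemma adj_add T x y : T (x + y) = T x + T y.
Proof.
by apply: (rip_injr hF) => z; rewrite ripDr !rip_adj_r ripDr.
Qed.

Lemma adj_scale T (k : R[i]) x : T (k *: x) = k *: T x.
Proof.
by apply: (rip_injr hF) => z; rewrite ripZr !rip_adj_r ripZr.
Qed.

Lemma adj_opp T x : T (- x) = - T x.
Proof. by rewrite -scaleN1r adj_scale scaleN1r. Qed.

Lemma adj_sub T x y : T (x - y) = T x - T y.
Proof. by rewrite adj_add adj_opp. Qed.

Lemma adj0 T : T 0 = 0.
Proof. by rewrite -(scale0r (0 : E)) adj_scale scale0r. Qed.

Hypothesis hE : hilbert_module E.

Lemma adj_ract T x a : T (x *< a) = T x *< a.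
Proof.
by apply: (rip_injr hF) => z; rewrite rip_adj_r !(hm_ract hE, hm_ract hF) rip_adj_r.
Qed.

Lemma adjoint_uniq T (S : adjop F E) : is_adjoint T S -> adjoint T = S.
Proof.
move=> TS; apply/val_inj/funext => y /=; apply: (rip_injr hE) => x.
by rewrite -TS -adjointP.
Qed.

End AdjointBasics.

(** * Boundedness of adjointable operators *)

Section UniformBound.
Variables (R : realType) (A : cstarType R) (E F : rightInnerType A).
Hypotheses (hE : hilbert_module E) (hF : hilbert_module F).

Definition third n : R := (3 ^ n)%N%:R^-1.

Lemma third_gt0 n : 0 < third n.
Proof. by rewrite invr_gt0 ltr0n expn_gt0. Qed.

Lemma thirdS n : third n.+1 = third n / 3.
Proof. by rewrite /third expnS natrM invfM mulrC. Qed.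

Lemma third_arch (e : R) : 0 < e -> exists n0, forall n, (n0 <= n)%N -> third n <= e.
Proof.
move=> e0; exists (Num.truncn e^-1) => n n0n.
rewrite /third -[leRHS]invrK lef_pV2 ?posrE ?invr_gt0 // ?ltr0n ?expn_gt0 //.
apply/ltW/(lt_le_trans (truncnS_gt _)); rewrite ler_nat.
by apply: (leq_ltn_trans n0n); exact: ltn_expl.
Qed.

(* Gliding hump: a unit vector [y n] on which the adjoint has norm at least
   [n * 3 ^ n] is detected by [T x] for the limit [x] of vectors [hump n], each
   of which is obtained from its predecessor by a step of length [3 ^- n] in the
   direction of [adjoint T (y n)]. *)
Lemma adjoint_bounded (T : adjop E F) :
  exists2 K : R, 0 <= K & forall x, gn (T x) <= K * gn x.
Proof.
(* A bound for the adjoint is one for T, since [|T x|^2 <= |x| |adjoint T (T x)|]. *)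
suff [K K0 KS] : exists2 K : R, 0 <= K & forall y, gn (adjoint T y) <= K * gn y.
  exists K => // x; have [->|Tx0] := eqVneq (gn (T x)) 0.
    by rewrite mulr_ge0 ?gn_ge0.
  have Tx : 0 < gn (T x) by rewrite lt_neqAle eq_sym Tx0 gn_ge0.
  rewrite -(ler_pM2r Tx) -expr2 gn_sqr rip_adj_r.
  apply: (le_trans (hm_CS hE _ _)); rewrite mulrAC ler_wpM2r ?gn_ge0 //.
apply: contrapT => noK.
have big n : exists y : F, gn y <= 1 /\ n%:R / third n < gn (adjoint T y).
  apply: contrapT => no; apply: noK; exists (n%:R / third n).
    by rewrite mulr_ge0 // invr_ge0 ltW // third_gt0.
  move=> y; rewrite leNgt; apply/negP => lt; apply: no.
  have [y0|yn0] := eqVneq (gn y) 0.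
    by move: lt; rewrite (hm_def hF y0) (adj0 hE) !gn0 mulr0 ltxx.
  have y0 : 0 < gn y by rewrite lt_neqAle eq_sym yn0 gn_ge0.
  exists (((gn y)^-1)%:C *: y).
  rewrite (adj_scale hE) !gnZr ger0_norm ?invr_ge0 ?gn_ge0 // mulVf //.
  by rewrite -(ltr_pM2l y0) mulVKf // mulrC.
have [y yP] := choice big.
pose u n := adjoint T (y n).
have u0 n : 0 < gn (u n).
  by apply: le_lt_trans (yP n).2; rewrite mulr_ge0 // invr_ge0 ltW // third_gt0.
pose v n := (third n / gn (u n))%:C *: u n.
have vn n : gn (v n) = third n.
  rewrite gnZr ger0_norm ?divr_ge0 ?(ltW (third_gt0 _)) ?(ltW (u0 _)) //.
  by rewrite divfK ?gt_eqF.
have uv n : nm (rip (u n) (v n)) = third n * gn (u n).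
  rewrite ripZr nmZr -gn_sqr ger0_norm ?divr_ge0 ?(ltW (third_gt0 _))
    ?(ltW (u0 _)) //.
  by rewrite expr2 mulrA divfK ?gt_eqF.
(* The inner products of [u n] with [hump n + v n] and [hump n - v n] differ by twice [<u n, v n>],
   so one of the two signs makes it large. *)
pose hump := fix hump n := if n is n'.+1 then
  (if third n' * gn (u n') <= nm (rip (u n') (hump n' + v n'))
   then hump n' + v n' else hump n' - v n') else 0.
have hump_big n : third n * gn (u n) <= nm (rip (u n) (hump n.+1)).
  rewrite /=; case: ifPn => //; rewrite -ltNge => lt.
  have := nmB (rip (u n) (hump n + v n)) (rip (u n) (hump n - v n)).
  rewrite -ripBr opprB [hump n + _ + _]addrC addrA subrK ripDr nm_double uv.
  by move: lt; move: (nm _) (nm _) (_ * _) => p q r; lra.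
have hump_step n : gn (hump n.+1 - hump n) = third n.
  by rewrite /=; case: ifP => _; rewrite addrAC subrr add0r ?gnN vn.
have hump_dist m n : (n <= m)%N ->
    gn (hump m - hump n) <= 3 / 2 * (third n - third m).
  elim: m => [|m IHm]; first by rewrite leqn0 => /eqP ->; rewrite !subrr gn0 mulr0.
  rewrite leq_eqVlt => /predU1P[->|]; first by rewrite !subrr gn0 mulr0.
  rewrite ltnS => /IHm; have := gn_dist hE (hump m) (hump m.+1) (hump n).
  by rewrite hump_step thirdS; lra.
have /(hm_complete hE)[x xP] : seq_cauchy (@gn R A E) hump.
  move=> e e0; have [n0 n0e] := third_arch (e := e / 2) ltac:(lra).
  have small m n : (n0 <= n)%N -> (n <= m)%N -> gn (hump m - hump n) <= e.
    move=> /n0e n0n /hump_dist; have := third_gt0 m.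
    by move: (gn _) n0n; move: (third n) (third m) => p q r; lra.
  exists n0 => m n n0m n0n; have [|/ltnW] := leqP n m; first exact: small.
  by rewrite gnC; exact: small.
have xh n : gn (x - hump n) <= 3 / 2 * third n.
  apply/ler_addgt0Pr => e /xP[n0 h].
  have := gn_dist hE (hump (maxn n n0)) x (hump n).
  have := h _ (leq_maxr n n0); have := hump_dist _ _ (leq_maxl n n0).
  have := third_gt0 (maxn n n0); rewrite (gnC x (hump (maxn n n0))).
  by move: (third n) (third _) (gn _) (gn _) (gn _) => o p q r s; lra.
(* After [hump n.+1] the remaining steps total at most [third n / 2], so [<u n, x>] keeps a norm of
   at least [third n * |u n| / 2], which exceeds [n / 2]. *)
have bound n : n%:R <= 2 * gn (T x).
  have Tx : nm (rip (u n) x) <= gn (T x).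
    rewrite -rip_adj_r (le_trans (hm_CS hF _ _)) // ler_piMl ?gn_ge0 //.
    exact: (yP n).1.
  have := nmD (rip (u n) (hump n.+1 - x)) (rip (u n) x); rewrite -ripDr subrK.
  have := hm_CS hE (u n) (hump n.+1 - x).
  have := ler_wpM2l (ltW (u0 n)) (xh n.+1); rewrite gnC thirdS.
  have := hump_big n; have := (yP n).2; rewrite ltr_pdivrMr ?third_gt0 //.
  rewrite -/(u n) [gn (u n) * third n]mulrC; move: Tx.
  move: (nm _) (nm _) (nm _) (gn (T x)) (gn (hump _ - x)) => a b c d e.
  move: (gn (u n)) (third n) => f g; move: (n%:R) => r.
  by nra.
have := bound (Num.truncn (2 * gn (T x))).+1.
by rewrite leNgt truncnS_gt.
Qed.

End UniformBound.

(** * The operator norm and its C*-identity *)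

Section OperatorNorm.
Variables (R : realType) (A : cstarType R) (E F : rightInnerType A).

Lemma adjopD (S T : adjop E F) x : (S + T) x = S x + T x. Proof. by []. Qed.
Lemma adjopZ (k : R[i]) (T : adjop E F) x : (k *: T) x = k *: T x.
Proof. by []. Qed.
Lemma adjopP (S T : adjop E F) : (forall x, S x = T x) -> S = T.
Proof. by move=> ST; apply/val_inj/funext. Qed.

Definition opn (T : adjop E F) : R :=
  inf [set K | 0 <= K /\ forall x, gn (T x) <= K * gn x].

Lemma opn_le (T : adjop E F) (K : R) :
  0 <= K -> (forall x, gn (T x) <= K * gn x) -> opn T <= K.
Proof.
by move=> K0 KT; apply: ge_inf; [exists 0 => ? []|split].
Qed.

Hypotheses (hE : hilbert_module E) (hF : hilbert_module F).

Lemma opn_set (T : adjop E F) :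
  [set K | 0 <= K /\ forall x, gn (T x) <= K * gn x] !=set0.
Proof. by have [K K0 KT] := adjoint_bounded hE hF T; exists K. Qed.

Lemma opn_ge0 T : 0 <= opn T.
Proof. by apply: lb_le_inf (opn_set T) _ => K []. Qed.

Lemma opnP (T : adjop E F) x : gn (T x) <= opn T * gn x.
Proof.
have [x0|x0] := eqVneq (gn x) 0.
  by rewrite (hm_def hE x0) (adj0 hF) !gn0 mulr0.
have xp : 0 < gn x by rewrite lt_neqAle eq_sym x0 gn_ge0.
rewrite -ler_pdivrMr //; apply: lb_le_inf (opn_set T) _ => K [_ KT].
by rewrite ler_pdivrMr.
Qed.

Lemma opnD S T : opn (S + T) <= opn S + opn T.
Proof.
apply: opn_le => [|x]; first by rewrite addr_ge0 ?opn_ge0.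
by rewrite mulrDl (le_trans (gnD hF _ _)) // lerD // opnP.
Qed.

Lemma opn_eq0 T : opn T = 0 -> T = 0.
Proof.
move=> T0; apply: adjopP => x; apply/(hm_def hF)/le_anti.
by rewrite gn_ge0 andbT (le_trans (opnP T x)) // T0 mul0r.
Qed.

Lemma opnZ (k : R[i]) T : opn (k *: T) = complex.Re `|k| * opn T.
Proof.
have le (l : R[i]) S : opn (l *: S) <= complex.Re `|l| * opn S.
  have l0 : 0 <= complex.Re `|l| by rewrite -lec_real -normC_Re normr_ge0.
  apply: opn_le => [|x]; first by rewrite mulr_ge0 // opn_ge0.
  by rewrite adjopZ gnZ -mulrA ler_wpM2l // opnP.
apply/le_anti; rewrite le andTb.
have [->|k0] := eqVneq k 0; first by rewrite normr0 mul0r opn_ge0.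
have kp : 0 < complex.Re `|k| by rewrite -ltc_real -normC_Re normr_gt0.
rewrite -ler_pdivlMl // -[X in opn X <= _](scale1r T) -(mulVf k0) -scalerA.
apply: le_trans (le _ _) _; rewrite normfV.
suff -> : complex.Re (`|k|^-1) = (complex.Re `|k|)^-1 by [].
by rewrite [in LHS]normC_Re -fmorphV.
Qed.

Lemma opn0 : opn 0 = 0.
Proof. by rewrite -(scale0r 0) opnZ normr0 mul0r. Qed.

Lemma opnN T : opn (- T) = opn T.
Proof. by rewrite -scaleN1r opnZ normrN1 mul1r. Qed.

End OperatorNorm.

Lemma adjcompE (R : realType) (A : cstarType R) (E F G : rightInnerType A)
  (S : adjop F G) (T : adjop E F) x : adjcomp S T x = S (T x).
Proof. by []. Qed.

Section AdjointAlgebra.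
Variables (R : realType) (A : cstarType R) (E F : rightInnerType A).
Hypotheses (hE : hilbert_module E) (hF : hilbert_module F).

Lemma adjointK (T : adjop E F) : adjoint (adjoint T) = T.
Proof.
apply: (adjoint_uniq hF) => y x; by rewrite rip_adj_r.
Qed.

Lemma adjointD (S T : adjop E F) : adjoint (S + T) = adjoint S + adjoint T.
Proof.
by apply: (adjoint_uniq hE) => x y; rewrite ripDl ripDr !adjointP.
Qed.

Lemma adjointZ (k : R[i]) (T : adjop E F) :
  adjoint (k *: T) = Num.conj k *: adjoint T.
Proof.
by apply: (adjoint_uniq hE) => x y; rewrite ripZl ripZr !adjointP.
Qed.

Lemma adjointB (S T : adjop E F) : adjoint (S - T) = adjoint S - adjoint T.
Proof.
by apply: (adjoint_uniq hE) => x y; rewrite ripBl ripBr !adjointP.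
Qed.

Lemma adjoint_comp (G : rightInnerType A) (S : adjop F G) (T : adjop E F) :
  adjoint (adjcomp S T) = adjcomp (adjoint T) (adjoint S).
Proof. by apply: (adjoint_uniq hE) => x y; rewrite !adjcompE !adjointP. Qed.

Lemma opn_adjoint_le (T : adjop E F) : opn (adjoint T) <= opn T.
Proof.
apply: opn_le => [|y]; first exact: opn_ge0.
have [->|Ty0] := eqVneq (gn (adjoint T y)) 0.
  by rewrite mulr_ge0 ?gn_ge0 ?opn_ge0.
have Ty : 0 < gn (adjoint T y) by rewrite lt_neqAle eq_sym Ty0 gn_ge0.
rewrite -(ler_pM2r Ty) -expr2 gn_sqr -rip_adj_r.
apply: (le_trans (hm_CS hF _ _)).
by rewrite [leRHS]mulrAC mulrC ler_wpM2r ?gn_ge0 // opnP.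
Qed.

Lemma opn_star_self (T : adjop E F) : opn (adjcomp (adjoint T) T) = opn T ^+ 2.
Proof.
apply/le_anti/andP; split.
  apply: opn_le => [|x]; first by rewrite exprn_ge0 ?opn_ge0.
  rewrite adjcompE expr2 -mulrA (le_trans (opnP hF hE _ _)) //.
  rewrite ler_pM ?opn_ge0 ?gn_ge0 //.
    exact: opn_adjoint_le.
  exact: opnP.
rewrite -[leRHS]sqr_sqrtr ?opn_ge0 // ler_pXn2r ?nnegrE ?opn_ge0 ?sqrtr_ge0 //.
apply: opn_le => [|x]; first exact: sqrtr_ge0.
rewrite -(@ler_pXn2r _ 2) ?nnegrE ?mulr_ge0 ?gn_ge0 ?sqrtr_ge0 //.
rewrite [gn (T x) ^+ 2]gn_sqr exprMn sqr_sqrtr ?opn_ge0 //.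
rewrite rip_adj_r ripC nm_star.
apply: (le_trans (hm_CS hE _ _)); rewrite expr2 mulrCA ler_wpM2l ?gn_ge0 //.
exact: (opnP hE hE (adjcomp (adjoint T) T)).
Qed.

Lemma opn_comp (G : rightInnerType A) (hG : hilbert_module G)
  (S : adjop F G) (T : adjop E F) : opn (adjcomp S T) <= opn S * opn T.
Proof.
apply: opn_le => [|x]; first by rewrite mulr_ge0 ?opn_ge0.
rewrite adjcompE -mulrA (le_trans (opnP hF hG _ _)) // ler_wpM2l ?opn_ge0 //.
exact: opnP.
Qed.

End AdjointAlgebra.

Section OperatorComplete.
Variables (R : realType) (A : cstarType R) (E F : rightInnerType A).
Hypotheses (hE : hilbert_module E) (hF : hilbert_module F).

Lemma opn_adjoint (T : adjop E F) : opn (adjoint T) = opn T.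
Proof.
apply/le_anti; rewrite opn_adjoint_le // andTb.
by rewrite -{1}(adjointK hF T) opn_adjoint_le.
Qed.

Lemma pointwise_lim (E' F' : rightInnerType A) (hE' : hilbert_module E')
    (hF' : hilbert_module F') (u : nat -> adjop E' F') :
  seq_cauchy (@opn R A E' F') u ->
  exists f : E' -> F', forall e, 0 < e -> exists n0, forall n, (n0 <= n)%N ->
    forall x, gn (u n x - f x) <= e * gn x.
Proof.
move=> cu.
have ux x : exists y, seq_lim (@gn R A F') (fun n => u n x) y.
  apply: (hm_complete hF') => e e0.
  have gx : 0 < gn x + 1 by have := gn_ge0 x; lra.
  have [n0 h] := cu _ (divr_gt0 e0 gx); exists n0 => m n /h hm /hm le.
  rewrite -[_ - _]/((u m - u n) x) (le_trans (opnP hE' hF' _ _)) //.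
  apply: (le_trans (ler_wpM2r (gn_ge0 _) le)).
  by rewrite mulrAC ler_pdivrMr // ler_wpM2l //; lra.
have [f uf] := choice ux; exists f => e e0.
have [n0 h] := cu e e0; exists n0 => n n0n x.
apply/ler_addgt0Pr => d /(uf x)[n1 h1].
apply: (le_trans (gn_dist hF' (u (maxn n0 n1) x) _ _)).
rewrite lerD ?h1 ?leq_maxr // -[_ - _]/((u n - u _) x).
by rewrite (le_trans (opnP hE' hF' _ _)) // ler_wpM2r ?gn_ge0 // h // leq_maxl.
Qed.

(** [adjoint] is isometric, so the adjoints converge too, and the two pointwise limits are adjoint
    to each other. *)
Lemma opn_complete : seq_complete (@opn R A E F).
Proof.
move=> u cu; have [f uf] := pointwise_lim hE hF cu.
have cu' : seq_cauchy (@opn R A F E) (fun n => adjoint (u n)).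
  move=> e /cu[n0 h]; exists n0 => m n m0 nn0.
  by rewrite -adjointB // opn_adjoint h.
have [g ug] := pointwise_lim hF hE cu'.
have fg : is_adjoint f g.
  move=> x y; apply/subr0_eq/nm_eps0 => e e0.
  have gxy : 0 < 2 * (gn x * gn y + 1).
    by have := mulr_ge0 (gn_ge0 x) (gn_ge0 y); lra.
  have [n1 h1] := uf _ (divr_gt0 e0 gxy); have [n2 h2] := ug _ (divr_gt0 e0 gxy).
  pose n := maxn n1 n2.
  have := h1 n (leq_maxl _ _) x; have := h2 n (leq_maxr _ _) y.
  set d := e / _ => hg hf.
  rewrite (_ : _ - _ = rip x (adjoint (u n) y - g y) - rip (u n x - f x) y).
    rewrite (le_trans (nmB _ _)) //.
    rewrite (le_trans (lerD (hm_CS hE _ _) (hm_CS hF _ _))) //.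
    have := ler_wpM2l (gn_ge0 x) hg; have := ler_wpM2r (gn_ge0 y) hf.
    have : d * (2 * (gn x * gn y + 1)) = e by rewrite /d divfK // gt_eqF.
    have : 0 < d by rewrite divr_gt0.
    move: (gn x) (gn y) (gn _) (gn _) => a b c c' *; nra.
  by rewrite ripBl ripBr -adjointP opprB [RHS]addrC addrA subrK.
have Tadj : f \in @adjointable R A E F by apply/asboolP; exists g.
exists (Adjop Tadj) => e e0; have [n0 h] := uf e e0; exists n0 => n n0n.
by apply: opn_le => [|x]; [exact: ltW | exact: h].
Qed.

End OperatorComplete.

(* An alias of [multalg A] that carries the operator norm. *)
Definition mult (R : realType) (A : cstarType R) : Type := multalg A.

Section Mult.
Variables (R : realType) (A : cstarType R).
Local Notation hA := (hilbert_self A).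

HB.instance Definition _ := StarAlg.on (mult A).
HB.instance Definition _ := Lmodule_isBanach.Build R (mult A)
  (opnD hA hA) (opnZ hA hA) (opn_eq0 hA hA) (opn_complete hA hA).

Lemma nm_mult (m : mult A) : nm m = opn (m : multalg A).
Proof. by []. Qed.

End Mult.

(** * Multipliers of a C*-algebra *)

Section CompleteRange.
Variables (R : realType) (V W : zmodType) (NV : V -> R) (NW : W -> R).
Variable f : V -> W.
Hypotheses (cV : seq_complete NV) (fB : forall x y, f (x - y) = f x - f y)
  (fN : forall x, NW (f x) = NV x)
  (NWD : forall x y, NW (x + y) <= NW x + NW y) (NWN : forall x, NW (- x) = NW x)
  (NW0 : forall x, NW x <= 0 -> x = 0).

(** Used for A in M(A), X in M(X) and A in L(X): membership in these images is established by
    approximation. *)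
Lemma isometry_range_closed w :
  (forall e, 0 < e -> exists x, NW (w - f x) <= e) -> exists x, w = f x.
Proof.
move=> wf.
have wn n : exists x, NW (w - f x) <= third R n by apply/wf/third_gt0.
have [u uw] := choice wn.
have dist x y z : NW (x - z) <= NW (x - y) + NW (y - z).
  by rewrite (le_trans _ (NWD _ _)) // addrA subrK.
have distC x y : NW (x - y) = NW (y - x) by rewrite -opprB NWN.
have [e e0|x ux] := cV (u := u).
  have [n0 h] := third_arch (e := e / 2) ltac:(lra).
  exists n0 => m n /h hm /h hn; rewrite -fN fB (le_trans (dist _ w _)) // distC.
  have := uw m; have := uw n.
  by move: (NW _) (NW _) hm hn => p q; move: (third R m) (third R n) => r s; lra.
exists x; apply/subr0_eq/NW0/ler_addgt0Pr => e e0; rewrite add0r.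
have [n1 h1] := third_arch (e := e / 2) ltac:(lra).
have [n2 h2] := ux (e / 2) ltac:(lra).
have := h1 _ (leq_maxl n1 n2); have := h2 _ (leq_maxr n1 n2).
rewrite -fN fB; have := uw (maxn n1 n2).
have := dist w (f (u (maxn n1 n2))) (f x).
move: (NW _) (NW _) (NW _) => p q r; move: (third R _) => s; lra.
Qed.

End CompleteRange.

Section MultAlgebra.
Variables (R : realType) (A : cstarType R).
Local Notation hA := (hilbert_self A).
Implicit Types (m n : mult A) (a b : A).

Lemma mult_mulA m n p : m ** (n ** p) = m ** n ** p.
Proof. by apply: adjopP. Qed.

Lemma mult_mulDl m n p : (m + n) ** p = m ** p + n ** p.
Proof. by apply: adjopP. Qed.

Lemma mult_mulDr m n p : m ** (n + p) = m ** n + m ** p.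
Proof. by apply: adjopP => x; exact: (adj_add hA). Qed.

Lemma mult_mulZl (k : R[i]) m n : (k *: m) ** n = k *: (m ** n).
Proof. by apply: adjopP. Qed.

Lemma mult_mulZr (k : R[i]) m n : m ** (k *: n) = k *: (m ** n).
Proof. by apply: adjopP => x; exact: (adj_scale hA). Qed.

Lemma mult_starD m n : (m + n)^# = m^# + n^#. Proof. exact: (adjointD hA). Qed.
Lemma mult_starZ (k : R[i]) m : (k *: m)^# = Num.conj k *: m^#.
Proof. exact: (adjointZ hA). Qed.
Lemma mult_starK m : m^#^# = m. Proof. exact: (adjointK hA). Qed.
Lemma mult_starM m n : (m ** n)^# = n^# ** m^#.
Proof. exact: (adjoint_comp hA). Qed.

Lemma mult_mul_norm m n : `|m ** n| <= `|m| * `|n|.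
Proof. by rewrite !nmE -rmorphM /= lec_real; exact: (opn_comp hA hA hA). Qed.

Lemma mult_cstar_norm m : `|m^# ** m| = `|m| ^+ 2.
Proof.
by rewrite !nmE -rmorphXn /=; congr (_%:C); exact: (opn_star_self hA hA).
Qed.

HB.instance Definition _ := isCStarAlg.Build R (mult A)
  mult_mulA mult_mulDl mult_mulDr mult_mulZl mult_mulZr
  mult_starD mult_starZ mult_starK mult_starM mult_mul_norm mult_cstar_norm.

Lemma mult_one_subproof : (id : selfmod A -> selfmod A) \in
  @adjointable R A (selfmod A) (selfmod A).
Proof. by apply/asboolP; exists id. Qed.

Definition mult_one : mult A := Adjop mult_one_subproof.

Lemma mult_one_l m : mult_one ** m = m. Proof. by apply: adjopP. Qed.
Lemma mult_one_r m : m ** mult_one = m. Proof. by apply: adjopP. Qed.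

Definition iotaA a : mult A := iota_alg a.

Lemma iotaAE a b : (iotaA a : multalg A) b = a ** b. Proof. by []. Qed.

Lemma iotaAD a b : iotaA (a + b) = iotaA a + iotaA b. Proof. exact: raddfD. Qed.
Lemma iotaAB a b : iotaA (a - b) = iotaA a - iotaA b. Proof. exact: raddfB. Qed.
Lemma iotaAZ (k : R[i]) a : iotaA (k *: a) = k *: iotaA a.
Proof. exact: linearZ. Qed.
Lemma iotaA0 : iotaA 0 = 0. Proof. exact: raddf0. Qed.

Lemma iotaA_mul_l m a : m ** iotaA a = iotaA ((m : multalg A) a).
Proof. by apply: adjopP => b; exact: (adj_ract hA hA). Qed.

Lemma iotaAM a b : iotaA (a ** b) = iotaA a ** iotaA b.
Proof. by rewrite iotaA_mul_l. Qed.

Lemma iotaA_star a : iotaA a^# = (iotaA a)^#.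
Proof.
apply/esym/(adjoint_uniq hA) => x y.
by rewrite /rip /= astarM amulA.
Qed.

Lemma iotaA_mul_r m a : iotaA a ** m = iotaA (((m^# : mult A) : multalg A) (a^#))^#.
Proof. by rewrite iotaA_star -iotaA_mul_l cstarM cstarK -iotaA_star cstarK. Qed.

Lemma nm_iota a : nm (iotaA a) = nm a.
Proof.
apply/le_anti/andP; split.
  apply: opn_le => [|b]; first exact: nm_ge0.
  by rewrite !gn_self; exact: nm_amul.
have := opnP hA hA (iotaA a : multalg A) a^#.
rewrite !gn_self iotaAE nm_cstar' nm_star expr2 -nm_mult.
have [->|a0] := eqVneq (nm a) 0; first by rewrite nm_ge0.
by rewrite ler_pM2r // lt_neqAle eq_sym a0 nm_ge0.
Qed.

Lemma iotaA_inj : injective iotaA.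
Proof.
move=> a b ab; apply/subr0_eq/nm_eq0.
by rewrite -nm_iota iotaAB ab subrr nm0.
Qed.

Lemma iotaA_closed m :
  (forall e, 0 < e -> exists a, nm (m - iotaA a) <= e) -> exists a, m = iotaA a.
Proof.
apply: (@isometry_range_closed _ _ _ (@nm R A)) => //.
- exact: nm_complete.
- exact: iotaAB.
- exact: nm_iota.
- exact: nmD.
- exact: nmN.
- exact: nm_le0.
Qed.

(* The order of the C*-algebra: a selfadjoint [a] lies in the positive cone if
   and only if [|t - a| <= t] for some [t], where the norm is the one of left
   multiplication operators. *)
Definition pos_elt a :=
  a^# = a /\ exists2 t : R, 0 < t & forall b, nm (t%:C *: b - a ** b) <= t * nm b.

Lemma pos_eltP a : pos_elt a <->
  a^# = a /\ exists2 t : R, 0 <= t & nm (t%:C *: mult_one - iotaA a) <= t.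
Proof.
split=> -[as_ [t t0 ht]]; split=> //.
  exists t; first exact: ltW.
  apply: opn_le => [|b]; first exact: ltW.
  by rewrite !gn_self; exact: ht.
exists (t + 1) => [|b]; first by lra.
have := opnP hA hA (((t + 1)%:C *: mult_one - iotaA a : mult A) : multalg A) b.
rewrite !gn_self => /le_trans; apply; rewrite ler_wpM2r ?nm_ge0 //.
rewrite -nm_mult rmorphD /= scalerDl addrAC (le_trans (nmD _ _)) // lerD //.
by apply: nm_real_one => //; exact: mult_one_r.
Qed.

Lemma cstar_pos_sa a : cstar_pos a -> a^# = a.
Proof. by move=> [b ->]; rewrite cstarM cstarK. Qed.

Lemma pos_elt_mult a : pos_elt a ->
  exists2 t : R, 0 < t & nm (t%:C *: mult_one - iotaA a) <= t.
Proof.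
move=> [as_ [t t0 ht]]; exists t => //.
apply: opn_le => [|b]; first exact: ltW.
by rewrite !gn_self; exact: ht.
Qed.

(** For [a = b^# b] the hypothesis of [jordan_pos] reads [(b n)^# (b n) = - k^2], which by
    Kaplansky's argument forces [k = 0]. *)
Lemma cstar_pos_elt a : cstar_pos a -> pos_elt a.
Proof.
move=> pa; have as_ := cstar_pos_sa pa; apply/pos_eltP; split=> //.
have as' : (iotaA a)^# = iotaA a by rewrite -iotaA_star as_.
apply: (jordan_pos mult_one_l mult_one_r as') => n k ns ks nk.
have [b ab] := pa.
apply: (neg_square_eq0 mult_one_l mult_one_r ks (b := iotaA b ** n)).
by rewrite cstarM ns cmulA -(cmulA n) -iotaA_star -iotaAM -ab.
Qed.

(** [approx_unit] works in M(A), but its approximate unit [a v] lies in the ideal A. *)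
Lemma pos_elt_approx a (e : R) : pos_elt a -> 0 < e -> exists u,
  [/\ u^# = u, nm (mult_one - iotaA u) <= 1 &
      nm ((mult_one - iotaA u) ** iotaA a) <= e].
Proof.
move=> pa e0; have [t t0 ht] := pos_elt_mult pa.
have as_ : (iotaA a)^# = iotaA a by rewrite -iotaA_star pa.1.
have [v [vs va w1 wa]] := approx_unit mult_one_l mult_one_r t0 e0 as_ ht.
have [u uE] : exists u, iotaA a ** v = iotaA u by eexists; exact: iotaA_mul_r.
move: w1 wa; rewrite uE => w1 wa; exists u; split=> //.
by apply: iotaA_inj; rewrite iotaA_star -uE cstarM vs as_.
Qed.

(** The root [k] is taken in M(A). For an approximate unit [u] one has
    [|k - k u|^2 = |(1 - u) a (1 - u)|], so [k] is a limit of elements [k u] of the ideal A. *)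
Lemma pos_elt_sqrt a : pos_elt a -> exists2 b, b^# = b & a = b ** b.
Proof.
move=> pa; have [t t0 ht] := pos_elt_mult pa.
have as_ : (iotaA a)^# = iotaA a by rewrite -iotaA_star pa.1.
have [k [ks kk kc _]] := unital_sqrt mult_one_l mult_one_r t0 as_ ht.
have [|b kb] := @iotaA_closed k.
  move=> e e0; have [u [us w1 wa]] := pos_elt_approx pa (exprn_gt0 2 e0).
  have := iotaA_mul_l k u => ku.
  exists ((k : multalg A) u); rewrite -ku.
  rewrite -(@ler_pXn2r _ 2) ?nnegrE ?nm_ge0 ?(ltW e0) // -nm_cstar.
  have ws : (mult_one - iotaA u)^# = mult_one - iotaA u.
    by rewrite cstarD astarN (one_star mult_one_l) -iotaA_star us.
  rewrite (_ : k - _ = k ** (mult_one - iotaA u)); last first.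
    by rewrite cmulDr amulNr mult_one_r.
  rewrite cstarM ws ks cmulA -(cmulA _ k k) kk.
  apply: (le_trans (nm_amul _ _)).
  by rewrite -[e ^+ 2]mulr1 ler_pM ?nm_ge0.
exists b; apply: iotaA_inj; first by rewrite iotaA_star -kb ks.
by rewrite iotaAM -kk kb.
Qed.

Lemma pos_elt_cstar a : pos_elt a -> cstar_pos a.
Proof. by move=> /pos_elt_sqrt[b bs ->]; exists b; rewrite bs. Qed.

(** The root of [a^# a] replaces [a] by the selfadjoint element that [neg_square_eq0] requires. *)
Lemma neg_pos_eq0 a b : b^# ** b = - (a^# ** a) -> a = 0.
Proof.
have /cstar_pos_elt/pos_elt_sqrt[d ds dE] : cstar_pos (a^# ** a) by exists a.
rewrite dE => bd; apply: star_self_eq0; rewrite dE.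
suff -> : d = 0 by rewrite amul0l.
apply: iotaA_inj; rewrite iotaA0.
apply: (neg_square_eq0 mult_one_l mult_one_r (b := iotaA b)).
  by rewrite -iotaA_star ds.
by rewrite -iotaA_star -!iotaAM bd -sub0r iotaAB iotaA0 sub0r.
Qed.

(** The expression is [(1 - u) a (1 - u)] expanded, as A need not have a unit. For [a = <y, y>] it
    is the inner square of [y - y u], so that [y u] approximates [y]. *)
Lemma pos_elt_approx_sandwich a (e : R) : pos_elt a -> 0 < e -> exists2 u,
  u^# = u & nm (a - a ** u - u ** a + u ** a ** u) <= e.
Proof.
move=> pa e0; have [u [us u1 ue]] := pos_elt_approx pa e0; exists u => //.
rewrite -nm_iota iotaAD !iotaAB !iotaAM.
rewrite (_ : _ + _ = (mult_one - iotaA u) ** iotaA a ** (mult_one - iotaA u)).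
  by rewrite (le_trans (nm_amul _ _)) // -[e]mulr1 ler_pM ?nm_ge0.
by rewrite !ncE !(mult_one_l, mult_one_r); lmod R.
Qed.

End MultAlgebra.

(** * The action of multipliers on a full bimodule *)

Section ClosedSpan.
Variables (R : realType) (V : normedModType R[i]).

Definition near_pred (P : V -> Prop) x :=
  forall e : R, 0 < e -> exists2 y, P y & nm (x - y) <= e.

Lemma closed_span_ind (S : set V) (P : V -> Prop) :
  (forall s, S s -> P s) -> P 0 -> (forall x y, P x -> P y -> P (x + y)) ->
  (forall (k : R[i]) x, P x -> P (k *: x)) ->
  (forall x, near_pred P x -> P x) ->
  forall x, closed_span S x -> P x.
Proof.
move=> PS P0 PD PZ Pc x /closureP cx; apply: Pc => e /cx[y [n [c [s [Ss ->]]]] xy].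
exists (\sum_(i < n) c i *: s i) => //.
by apply: (big_ind P) => // i _; exact/PZ/PS.
Qed.

Lemma near_span (S : set V) x :
  (forall e : R, 0 < e -> exists2 y, S y & nm (x - y) <= e) -> closed_span S x.
Proof.
move=> h; apply/closureP => e /h[y Sy xy]; exists y => //.
by exists 1%N, (fun=> 1), (fun=> y); split=> //; rewrite big_ord1 scale1r.
Qed.

Lemma agree_closed (W : normedModType R[i]) (f g : V -> W) (K : R) : 0 <= K ->
  (forall x y, nm (f x - f y) <= K * nm (x - y)) ->
  (forall x y, nm (g x - g y) <= K * nm (x - y)) ->
  forall x, near_pred (fun x => f x = g x) x -> f x = g x.
Proof.
move=> K0 fK gK x xP; apply/subr0_eq/nm_eps0 => e e0.
have K1 : 0 < 2 * (K + 1) by lra.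
have [y fg xy] := xP _ (divr_gt0 e0 K1).
have := nm_dist (f y) (f x) (g x); rewrite {2}fg.
have := fK x y; have := gK y x; rewrite (nmC y).
have : e / (2 * (K + 1)) * (2 * (K + 1)) = e by rewrite divfK // gt_eqF.
move: xy (nm_ge0 (x - y)); move: (e / _) (nm _) (nm _) (nm _) (nm _) => a b c d f'.
by nra.
Qed.

(** Values at approximating points form a Cauchy sequence, and closedness of the graph identifies
    the limit. Partial operators given on a dense span become total this way. *)
Lemma domain_closed (W : completeNormedModType R[i]) (G : V -> W -> Prop) (K : R) :
  0 <= K ->
  (forall x y x' y', G x y -> G x' y' -> G (x - x') (y - y')) ->
  (forall x y, G x y -> nm y <= K * nm x) ->
  (forall x y, (forall e : R, 0 < e -> exists x' y',
     [/\ G x' y', nm (x - x') <= e & nm (y - y') <= e]) -> G x y) ->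
  forall x, near_pred (fun x => exists y, G x y) x -> exists y, G x y.
Proof.
move=> K0 GB GK Gc x xP.
have xn n : exists p, G p.1 p.2 /\ nm (x - p.1) <= third R n.
  by have [x' [y G'] xx'] := xP _ (third_gt0 R n); exists (x', y).
have [u uP] := choice xn.
have [e e0|y uy] := @nm_complete _ W (fun n => (u n).2).
  have K1 : 0 < 2 * (K + 1) by lra.
  have [n0 h] := third_arch (divr_gt0 e0 K1).
  exists n0 => m n /h hm /h hn.
  apply: (le_trans (GK _ _ (GB _ _ _ _ (uP m).1 (uP n).1))).
  have := nm_dist x (u m).1 (u n).1; rewrite (nmC (u m).1 x).
  have : e / (2 * (K + 1)) * (2 * (K + 1)) = e by rewrite divfK // gt_eqF.
  move: (uP m).2 (uP n).2 hm hn (nm_ge0 ((u m).1 - (u n).1)) K0.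
  by move: (third R m) (third R n) (e / _) (nm _) (nm _) (nm _) => *; nra.
exists y; apply: Gc => e e0.
have [n1 h1] := third_arch e0; have [n2 h2] := uy e e0.
exists (u (maxn n1 n2)).1, (u (maxn n1 n2)).2; split.
- exact: (uP _).1.
- by rewrite (le_trans (uP _).2) // h1 // leq_maxl.
- by rewrite nmC h2 // leq_maxr.
Qed.

End ClosedSpan.

(** * Isometry of the left action *)

Section LeftAction.
Variables (R : realType) (A : cstarType R) (X : hilbertBimodType A).
Implicit Types (x y z w : X) (a b c : A).
Local Notation hX := (hilbert_bimod X).

Lemma lip0l x : lip 0 x = 0 :> A.
Proof. by rewrite -(scale0r (0 : X)) lipZl scale0r. Qed.

(** Mirror image of [rip_lact]: the difference annihilates X from the left. *)
Lemma lip_ract x y a : lip (x *< a) y = lip x (y *< a^#).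
Proof.
have [r rE] : exists r, r = lip (x *< a) y - lip x (y *< a^#) by eexists.
have rz z : r >* z = 0.
  rewrite rE lactDl lactNl !lip_rip -ractA [rip (y *< _) z]ripC rip_ract.
  by rewrite cstarM cstarK -ripC subrr.
apply/subr0_eq; rewrite -rE -[r]cstarK; suff -> : r^# = 0 by rewrite astar0.
apply: star_self_eq0; rewrite cstarK {2}rE cstarD astarN -!lipC.
by rewrite cmulDr amulNr -!lip_lact !rz !lip0l subrr.
Qed.

Lemma lip_cauchy_schwarz x y : nm (lip x y) <= nm x * nm y.
Proof.
rewrite -(@ler_pXn2r _ 2) ?nnegrE ?mulr_ge0 ?nm_ge0 //.
rewrite -nm_cstar' -lipC -lip_lact lip_rip exprMn -[nm y ^+ 2]nm_rip.
have [b bE] := rip_pos y; rewrite bE ractA lip_ract nm_lip nm_cstar -exprMn.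
by rewrite ler_pXn2r ?nnegrE ?mulr_ge0 ?nm_ge0 // -(nm_star b) nm_ract.
Qed.

Lemma lact_eq0 x : (forall a, a >* x = 0) -> x = 0.
Proof.
move=> ax; apply/nm_eq0/eqP; rewrite -sqrf_eq0 -nm_lip.
suff -> : lip x x = 0 by rewrite nm0.
by apply: star_self_eq0; rewrite -lipC -lip_lact ax lip0l.
Qed.

Lemma lactop_subproof a : (fun x : X => a >* x) \in @adjointable R A X X.
Proof.
by apply/asboolP; exists (fun x : X => a^# >* x) => x y; rewrite rip_lact.
Qed.

Definition lactop a : adjop X X := Adjop (lactop_subproof a).

Lemma adjoint_lactop a : adjoint (lactop a) = lactop a^#.
Proof. by apply: (adjoint_uniq hX) => x y; exact: rip_lact. Qed.

Lemma lactopM a b : lactop (a ** b) = adjcomp (lactop a) (lactop b).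
Proof. by apply: adjopP => x; exact: lactA. Qed.

Lemma nm_adj (T : adjop X X) x : nm (T x) <= opn T * nm x.
Proof. by have := opnP hX hX T x; rewrite !gn_nm. Qed.

Lemma opn_lactop_le a : opn (lactop a) <= nm a.
Proof.
by apply: opn_le => [|x]; rewrite ?nm_ge0 // !gn_nm nm_lact.
Qed.

Hypothesis fullX : full_bimod X.

Fixpoint cpow h n : A := if n is n'.+1 then h ** cpow h n' else h.

(* [cpow h n] is h^(n+1).  If the left multiplication by [h] had norm less than
   1 = |h| then |h^n v| would tend to 0 for [v] in the span of the inner
   products, which is dense, hence also for [v := h]. *)
Lemma opn_lactop_sa h : h^# = h -> nm h <= opn (lactop h).
Proof.
move=> hs; rewrite leNgt; apply/negP => lt.
have h0 : 0 < nm h by apply: le_lt_trans lt; exact: opn_ge0 hX hX _.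
pose g := ((nm h)^-1)%:C *: h.
have gs : g^# = g by rewrite cstarZ conj_real hs.
have g1 : nm g = 1 by rewrite nmZr ger0_norm ?invr_ge0 ?nm_ge0 // mulVf ?gt_eqF.
pose r := opn (lactop g).
have r0 : 0 <= r by exact: opn_ge0 hX hX _.
have r1 : r < 1.
  have -> : r = (nm h)^-1 * opn (lactop h).
    have := opnZ hX hX ((nm h)^-1)%:C (lactop h).
    rewrite norm_real ger0_norm ?invr_ge0 ?nm_ge0 // => <-.
    congr opn; apply: adjopP => x.
    by rewrite /= lactZl.
  by rewrite ltr_pdivrMl // mulr1.
have powS n : cpow g n.+1 = cpow g n ** g.
  by elim: n => // n IHn; rewrite -[LHS]/(g ** cpow g n.+1) {1}IHn cmulA.
have powD m n : cpow g (m + n).+1 = cpow g m ** cpow g n.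
  by elim: m => //= m IHm; rewrite -cmulA -IHm.
have pows n : (cpow g n)^# = cpow g n.
  by elim: n => // n IHn; rewrite {1}powS cstarM gs IHn.
have pow1 n : nm (cpow g n) <= 1.
  elim: n => [|n IHn]; first by rewrite g1.
  by rewrite /= (le_trans (nm_amul _ _)) // g1 mul1r.
have powr n x : nm (cpow g n >* x) <= r ^+ n * nm x.
  elim: n => [|n IHn] /=.
    by rewrite expr0 (le_trans (nm_lact _ _)) // g1.
  rewrite lactA (le_trans (nm_adj (lactop g) _)) //.
  by rewrite exprS -mulrA ler_wpM2l.
(* Bernoulli's inequality for the powers of [1 / r = 1 + d]. *)
have rlim e : 0 < e -> exists n0, forall n, (n0 <= n)%N -> r ^+ n <= e.
  move=> e0; have [r00|rn0] := eqVneq r 0.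
    by exists 1%N => -[//|n] _; rewrite r00 expr0n /= ltW.
  have rp : 0 < r by rewrite lt_neqAle eq_sym rn0.
  pose d := r^-1 - 1; have d0 : 0 < d.
    by rewrite subr_gt0 -invr1 ltf_pV2 ?posrE.
  have bern n : 1 + n%:R * d <= r^-1 ^+ n.
    elim: n => [|n IHn]; first by rewrite mul0r addr0 expr0.
    rewrite exprSr -natr1; have -> : r^-1 = 1 + d by rewrite /d addrC subrK.
    rewrite -[X in X ^+ n](_ : r^-1 = _); last by rewrite /d addrC subrK.
    have n0 : 0 <= n%:R :> R by [].
    by move: IHn n0 d0; move: (r^-1 ^+ n) (n%:R) => p q; nra.
  exists (Num.truncn (e^-1 / d)).+1 => n n0n.
  rewrite -[r ^+ n]invrK -exprVn -[leRHS]invrK lef_pV2 ?posrE ?invr_gt0 //;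
    last first.
    by rewrite exprn_gt0 // invr_gt0.
  apply: le_trans (bern n); rewrite (@le_trans _ _ (n%:R * d)) //; last by lra.
  rewrite -ler_pdivrMr //; apply/ltW/(lt_le_trans (truncnS_gt _)).
  by rewrite ler_nat.
pose P v := forall e : R, 0 < e ->
  exists n0, forall n, (n0 <= n)%N -> nm (cpow g n ** v) <= e.
have PT v : P v.
  have [+ _] := fullX; move/seteqP=> [_ /(_ v I)]; apply: closed_span_ind => {v}.
  - move=> _ [x _ [y _ <-]] e e0.
    have xy : 0 < nm x * nm y + 1 by have := mulr_ge0 (nm_ge0 x) (nm_ge0 y); lra.
    have [n0 hn] := rlim _ (divr_gt0 e0 xy); exists n0 => n /hn le.
    rewrite -lip_lact (le_trans (lip_cauchy_schwarz _ _)) //.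
    have := ler_wpM2r (nm_ge0 y) (powr n x); move/le_trans; apply.
    rewrite -mulrA; have := ler_wpM2r (mulr_ge0 (nm_ge0 x) (nm_ge0 y)) le.
    move/le_trans; apply; rewrite mulrAC ler_pdivrMr // ler_wpM2l ?ltW //; lra.
  - by move=> e e0; exists 0%N => n _; rewrite amul0r nm0 ltW.
  - move=> x y Px Py e e0.
    have [n1 h1] := Px (e / 2) ltac:(lra); have [n2 h2] := Py (e / 2) ltac:(lra).
    exists (maxn n1 n2) => n; rewrite geq_max => /andP[/h1 ? /h2 ?].
    by rewrite cmulDr (le_trans (nmD _ _)) //; lra.
  - move=> k x Px e e0.
    have k0 : 0 <= complex.Re `|k| by rewrite -lec_real -normC_Re normr_ge0.
    have k1 : 0 < complex.Re `|k| + 1 by rewrite ltr_wpDl.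
    have [n0 hn] := Px _ (divr_gt0 e0 k1); exists n0 => n /hn le.
    rewrite cmulZr nmZ; apply: (le_trans (ler_wpM2l k0 le)).
    rewrite mulrA ler_pdivrMr // mulrC ler_wpM2l ?(ltW e0) //.
    by rewrite lerDl.
  - move=> x xP e e0; have [y Py xy] := xP (e / 2) ltac:(lra).
    have [n0 hn] := Py (e / 2) ltac:(lra); exists n0 => n /hn le.
    have := nm_dist (cpow g n ** y) (cpow g n ** x) 0; rewrite !subr0.
    have := nm_amul (cpow g n) (x - y); rewrite cmulDr amulNr.
    have := ler_wpM2r (nm_ge0 (x - y)) (pow1 n); rewrite mul1r; lra.
have [n0 hn] := PT g (2^-1) ltac:(by rewrite invr_gt0).
(* Selfadjointness gives [|g^(2j)| = |g^j|^2], so infinitely many powers have norm 1, although they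
   are eventually at most 1/2 by [PT]. As [cpow g n] is [g^(n+1)], doubling the exponent sends the
   index [n] to [2 n + 1]. *)
have pow2 k : exists2 n, (k <= n)%N & nm (cpow g n) = 1.
  elim: k => [|k [n kn n1]]; first by exists 0%N.
  exists (n + n).+1; first by rewrite ltnS (leq_trans kn) // leq_addr.
  by rewrite powD -{1}pows nm_cstar n1 expr1n.
have [[//|n] nn n1] := pow2 n0.+1.
by have := hn n nn; rewrite -powS n1; lra.
Qed.

Lemma opn_lactop a : opn (lactop a) = nm a.
Proof.
apply/le_anti; rewrite opn_lactop_le /=.
rewrite -(@ler_pXn2r _ 2) ?nnegrE ?nm_ge0 ?(opn_ge0 hX hX) // -nm_cstar.
apply: (le_trans (opn_lactop_sa _)); first by rewrite cstarM cstarK.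
by rewrite lactopM -adjoint_lactop (opn_star_self hX hX).
Qed.

Lemma lact_faithful a b : (forall x, a >* x = b >* x) -> a = b.
Proof.
move=> ab; apply/subr0_eq/nm_eq0; rewrite -opn_lactop.
rewrite (_ : lactop _ = 0) ?(opn0 hX hX) //; apply: adjopP => x.
by rewrite /= lactDl lactNl ab subrr.
Qed.

End LeftAction.
Arguments lactop {R A X} a.
Arguments opn_lactop_le {R A} X a.

(** * The isomorphism of M(A) with L(X) *)

Section Phibar.
Variables (R : realType) (A : cstarType R) (X : hilbertBimodType A).
Hypothesis fullX : full_bimod X.
Implicit Types (x y z w : X) (a b c : A) (m n : mult A).
Local Notation hA := (hilbert_self A).
Local Notation hX := (hilbert_bimod X).

Definition lmul m a : A := (m : multalg A) a.
Definition rmul a m : A := (lmul (m^#) (a^#))^#.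

Lemma iotaA_lmul m a : m ** iotaA a = iotaA (lmul m a).
Proof. exact: iotaA_mul_l. Qed.

Lemma iotaA_rmul a m : iotaA a ** m = iotaA (rmul a m).
Proof. exact: iotaA_mul_r. Qed.

Lemma nm_rmul a m : nm (rmul a m) <= nm a * nm m.
Proof. by rewrite -nm_iota -iotaA_rmul (le_trans (nm_amul _ _)) // nm_iota. Qed.

(* [w] is the image of [z] under the operator that extends [m] on X. *)
Definition mult_rel m z w := forall a, a >* w = rmul a m >* z.

Lemma mult_relB m z w z' w' :
  mult_rel m z w -> mult_rel m z' w' -> mult_rel m (z - z') (w - w').
Proof. by move=> h h' a; rewrite !lactDr !lactNr h h'. Qed.

(* For [p := <w,w>] one has [|p w|^2 = |p^3|]. *)
Lemma mult_rel_bound m z w : mult_rel m z w -> nm w <= nm m * nm z.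
Proof.
move=> h; pose p := lip w w.
have ps : p^# = p by rewrite /p -lipC.
have w0 := nm_ge0 w; have pw : nm p = nm w ^+ 2 by exact: nm_lip.
have le1 : nm (p >* w) <= nm w ^+ 2 * (nm m * nm z).
  rewrite h (le_trans (nm_lact _ _)) // mulrA ler_wpM2r ?nm_ge0 // -pw.
  exact: nm_rmul.
have le2 : nm w ^+ 6 <= nm (p >* w) ^+ 2.
  have : nm (p ** p ** p ** p) = nm p ^+ 4.
    have pps : (p ** p)^# = p ** p by rewrite cstarM ps.
    by rewrite -cmulA -{1}pps nm_cstar -{1}ps nm_cstar -exprM.
  have := nm_amul (p ** p ** p) p.
  rewrite -nm_lip lip_lact lip_lact_r -/p ps cmulA => le e; move: le; rewrite {}e.
  have [->|wn0] := eqVneq (nm w) 0; first by rewrite expr0n /= nm_ge0.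
  have p0 : 0 < nm p by rewrite pw exprn_gt0 // lt_neqAle eq_sym wn0.
  by rewrite exprSr ler_pM2r // pw -exprM.
have [->|wn0] := eqVneq (nm w) 0; first by rewrite mulr_ge0 ?nm_ge0.
have wp : 0 < nm w by rewrite lt_neqAle eq_sym wn0.
have : (nm w ^+ 3) ^+ 2 <= (nm w ^+ 2 * (nm m * nm z)) ^+ 2.
  rewrite -exprM (le_trans le2) // ler_pXn2r ?nnegrE ?nm_ge0 //.
  by rewrite !mulr_ge0 ?nm_ge0.
rewrite ler_pXn2r ?nnegrE ?mulr_ge0 ?exprn_ge0 ?nm_ge0 //.
by rewrite exprSr ler_pM2l // exprn_gt0.
Qed.

Lemma mult_rel_lact m b x : mult_rel m (b >* x) (lmul m b >* x).
Proof.
move=> a; rewrite -!lactA; congr (_ >* _); apply: iotaA_inj.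
by rewrite !iotaAM -iotaA_lmul -iotaA_rmul cmulA.
Qed.

Lemma lact_span x : closed_span [set a >* x | a in [set: A] & x in [set: X]] x.
Proof. by rewrite (lact_nondeg (s := X)). Qed.

(** [m (b x) = (m b) x] provides the values on a dense span; [mult_rel] is bounded and closed, so
    its domain is all of X. *)
Lemma mult_rel_ex m z : exists w, mult_rel m z w.
Proof.
move: z (@lact_span z); apply: closed_span_ind.
- by move=> _ [b _ [x _ <-]]; exists (lmul m b >* x); exact: mult_rel_lact.
- by exists 0 => a; rewrite !lact0r.
- move=> x y [w hw] [w' hw']; exists (w + w') => a.
  by rewrite !lactDr hw hw'.
- by move=> k x [w hw]; exists (k *: w) => a; rewrite !lactZr hw.
- apply: (@domain_closed R X X (mult_rel m) (nm m)) (nm_ge0 _) _ _ _.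
  + by move=> x y x' y'; exact: mult_relB.
  + by move=> x y; exact: mult_rel_bound.
  + move=> z w h a; apply/subr0_eq/nm_eps0 => e e0.
    have K0 : 0 < nm a + nm a * nm m + 1.
      by have := mulr_ge0 (nm_ge0 a) (nm_ge0 m); have := nm_ge0 a; lra.
    have [z' [w' [h' zz ww]]] := h _ (divr_gt0 e0 K0).
    rewrite (_ : _ - _ = a >* (w - w') - rmul a m >* (z - z')); last first.
      by rewrite !lactDr !lactNr h' opprB addrA subrK.
    rewrite (le_trans (nmB _ _)) //.
    have := nm_lact a (w - w'); have := nm_lact (rmul a m) (z - z').
    have := ler_wpM2r (nm_ge0 (z - z')) (nm_rmul a m).
    have := ler_wpM2l (nm_ge0 a) ww.
    have := ler_wpM2l (mulr_ge0 (nm_ge0 a) (nm_ge0 m)) zz.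
    have : e / (nm a + nm a * nm m + 1) * (nm a + nm a * nm m + 1) = e.
      by rewrite divfK // gt_eqF.
    have : 0 < e / (nm a + nm a * nm m + 1) by rewrite divr_gt0.
    by move: (e / _) (nm (a >* _)) (nm (rmul _ _ >* _)) => d p q; nra.
Qed.

Lemma mult_rel_uniq m z w w' : mult_rel m z w -> mult_rel m z w' -> w = w'.
Proof.
move=> h h'; apply/subr0_eq/lact_eq0 => a.
by rewrite lactDr lactNr h h' subrr.
Qed.

Definition mult_fun m z : X := sval (cid (mult_rel_ex m z)).

Lemma mult_funP m z : mult_rel m z (mult_fun m z).
Proof. by rewrite /mult_fun; case: cid. Qed.

Lemma mult_funB m z z' : mult_fun m (z - z') = mult_fun m z - mult_fun m z'.
Proof.
by apply: mult_rel_uniq (mult_funP _ _) _; apply: mult_relB; exact: mult_funP.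
Qed.

Lemma mult_funD m z z' : mult_fun m (z + z') = mult_fun m z + mult_fun m z'.
Proof.
by apply: mult_rel_uniq (mult_funP _ _) _ => a; rewrite !lactDr !mult_funP.
Qed.

Lemma nm_mult_fun m z : nm (mult_fun m z) <= nm m * nm z.
Proof. exact/mult_rel_bound/mult_funP. Qed.

Lemma mult_fun_adj m x y : rip (mult_fun m x) y = rip x (mult_fun m^# y).
Proof.
pose P y := rip (mult_fun m x) y = rip x (mult_fun m^# y).
move: y (@lact_span y); apply: (@closed_span_ind _ _ _ P); rewrite /P {P}.
- move=> _ [a _ [y _ <-]].
  rewrite (mult_rel_uniq (mult_funP _ _) (mult_rel_lact m^# a y)).
  rewrite -[in LHS](cstarK a) -rip_lact mult_funP rip_lact; congr (rip x (_ >* _)).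
  by rewrite /rmul !cstarK.
- by rewrite -(subrr 0) mult_funB !ripBr !subrr.
- by move=> y z hy hz; rewrite mult_funD !ripDr hy hz.
- move=> k y hy; rewrite ripZr hy -ripZr; congr (rip x _).
  by apply: mult_rel_uniq (mult_funP _ _) => a; rewrite !lactZr mult_funP.
- apply: (@agree_closed _ _ _ (fun y => rip (mult_fun m x) y)
    (fun y => rip x (mult_fun m^# y)) (nm (mult_fun m x) + nm x * nm m)).
  + by rewrite addr_ge0 ?mulr_ge0 ?nm_ge0.
  + move=> y z; rewrite -ripBr (le_trans (cauchy_schwarz _ _)) //.
    by rewrite ler_wpM2r ?nm_ge0 // lerDl mulr_ge0 ?nm_ge0.
  + move=> y z; rewrite -ripBr -mult_funB (le_trans (cauchy_schwarz _ _)) //.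
    apply: (le_trans (ler_wpM2l (nm_ge0 x) (nm_mult_fun _ _))).
    by rewrite mulrA ler_wpM2r ?nm_ge0 // nm_star lerDr nm_ge0.
Qed.

Lemma mult_op_subproof m : mult_fun m \in @adjointable R A X X.
Proof. by apply/asboolP; exists (mult_fun m^#) => x y; exact: mult_fun_adj. Qed.

Definition mult_op m : adjop X X := Adjop (mult_op_subproof m).

Lemma mult_opP m (T : adjop X X) : (forall x, mult_rel m x (T x)) -> mult_op m = T.
Proof. by move=> h; apply: adjopP => x; apply: mult_rel_uniq (mult_funP _ _) _. Qed.

(** The compact operators form an ideal of L(X): P after the action of [lip x y] is the action of
    [lip (P x) y]. Isometry of the left action carries this to limits. *)
Lemma lact_extend (P : adjop X X) a : exists b, lactop b = adjcomp P (lactop a).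
Proof.
pose G a b := lactop b = adjcomp P (lactop a) :> adjop X X.
have [+ _] := fullX; move/seteqP=> [_ /(_ a I)].
move: a; apply: (@closed_span_ind _ _ _ (fun a => exists b, G a b)).
- move=> _ [x _ [y _ <-]]; exists (lip (P x) y); apply: adjopP => z.
  by rewrite /= !lip_rip (adj_ract hX hX).
- exists 0; apply: adjopP => z; rewrite /= !lact0l (adj0 hX) //.
- move=> a a' [b hb] [b' hb']; exists (b + b'); apply: adjopP => z.
  move/(congr1 (fun T : adjop X X => T z)): hb; rewrite /= => hb.
  move/(congr1 (fun T : adjop X X => T z)): hb'; rewrite /= => hb'.
  by rewrite /= !lactDl (adj_add hX) hb hb'.
- move=> k a' [b hb]; exists (k *: b); apply: adjopP => z.
  move/(congr1 (fun T : adjop X X => T z)): hb; rewrite /= => hb.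
  by rewrite /= !lactZl (adj_scale hX) hb.
- have GE a' b' z : G a' b' -> b' >* z = P (a' >* z).
    by move/(congr1 (fun T : adjop X X => T z)).
  apply: (@domain_closed R A A G (opn P)) (opn_ge0 hX hX P) _ _ _.
  + move=> a' b' a2 b2 h h2; apply: adjopP => z.
    by rewrite /= !lactDl !lactNl (adj_sub hX) (GE _ _ _ h) (GE _ _ _ h2).
  + move=> a' b' h; rewrite -(opn_lactop fullX b') h.
    apply: (le_trans (opn_comp hX hX hX _ _)).
    by rewrite ler_wpM2l ?(opn_ge0 hX hX) // (opn_lactop_le X).
  + move=> a' b' h; apply: adjopP => z; apply/subr0_eq/nm_eps0 => e e0.
    have K0 : 0 < nm z + opn P * nm z + 1.
      have := mulr_ge0 (opn_ge0 hX hX P) (nm_ge0 z); have := nm_ge0 z; lra.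
    have [a2 [b2 [h2 aa bb]]] := h _ (divr_gt0 e0 K0).
    rewrite (_ : _ - _ = (b' - b2) >* z - P ((a' - a2) >* z)); last first.
      by rewrite /= !lactDl !lactNl (adj_sub hX) (GE _ _ _ h2) opprB addrA subrK.
    rewrite (le_trans (nmB _ _)) //.
    have := nm_lact (b' - b2) z; have := nm_adj P ((a' - a2) >* z).
    have := ler_wpM2l (opn_ge0 hX hX P) (nm_lact (a' - a2) z).
    have := ler_wpM2r (nm_ge0 z) bb.
    have := ler_wpM2r (mulr_ge0 (opn_ge0 hX hX P) (nm_ge0 z)) aa.
    have : e / (nm z + opn P * nm z + 1) * (nm z + opn P * nm z + 1) = e.
      by rewrite divfK // gt_eqF.
    have : 0 < e / (nm z + opn P * nm z + 1) by rewrite divr_gt0.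
    move: (e / _) => d; move: (nm (_ >* _)) (nm (P _)) (nm (_ >* _)) => p q r.
    by move: (opn P) (nm z) => s t; nra.
Qed.

(** P acts on A by sending [a] to the element that acts as P after [a]. The adjoint of P acts
    likewise, and faithfulness of the action makes the two maps adjoint, hence multipliers. *)
Lemma mult_op_surj (P : adjop X X) : exists m, mult_op m = P.
Proof.
have [f fP] := choice (lact_extend P).
have [g gP] := choice (lact_extend (adjoint P)).
have fE a x : f a >* x = P (a >* x).
  by have /(congr1 (fun T : adjop X X => T x)) := fP a.
have gE a x : g a >* x = adjoint P (a >* x).
  by have /(congr1 (fun T : adjop X X => T x)) := gP a.
have fg : @is_adjoint R A (selfmod A) (selfmod A) f g.
  move=> a b; have : (f a)^# ** b = a^# ** g b; last exact.
  apply: (lact_faithful fullX) => x; rewrite !lactA.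
  apply: (rip_injr hX) => y; rewrite -!rip_lact fE gE.
  by rewrite adjointP.
have fadj : f \in @adjointable R A (selfmod A) (selfmod A).
  by apply/asboolP; exists g.
pose m : mult A := Adjop fadj.
have gadj : g \in @adjointable R A (selfmod A) (selfmod A).
  by apply/asboolP; exists f => x y; rewrite ripC -fg -ripC.
have mg a : lmul (m^#) a = g a.
  rewrite /lmul (_ : m^# = Adjop gadj) //.
  exact: (adjoint_uniq hA (T := m) (S := Adjop gadj) fg).
exists m; apply: mult_opP => x a; apply: (rip_injr hX) => y.
by rewrite /rmul mg -rip_lact gE -[in LHS](cstarK a) -rip_lact rip_adj_r.
Qed.

End Phibar.

Section PhibarTheory.
Variables (R : realType) (A : cstarType R) (X : hilbertBimodType A).
Hypothesis fullX : full_bimod X.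
Implicit Types (x y z w : X) (a b c : A) (m n : mult A).
Local Notation hA := (hilbert_self A).
Local Notation hX := (hilbert_bimod X).

Lemma rmulDr a m n : rmul a (m + n) = rmul a m + rmul a n.
Proof. by apply: iotaA_inj; rewrite iotaAD -!iotaA_rmul cmulDr. Qed.

Lemma rmulZr a (k : R[i]) m : rmul a (k *: m) = k *: rmul a m.
Proof. by apply: iotaA_inj; rewrite iotaAZ -!iotaA_rmul cmulZr. Qed.

Lemma rmulM a m n : rmul a (m ** n) = rmul (rmul a m) n.
Proof. by apply: iotaA_inj; rewrite -!iotaA_rmul cmulA. Qed.

Lemma rmul_iota a b : rmul a (iotaA b) = a ** b.
Proof. by apply: iotaA_inj; rewrite -iotaA_rmul iotaAM. Qed.

Lemma mult_op_lact m a x : mult_op X m (a >* x) = lmul m a >* x.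
Proof. exact: mult_rel_uniq (mult_funP _ _) (mult_rel_lact _ _ _). Qed.

Lemma mult_op_inj : injective (mult_op X).
Proof.
move=> m n mn; apply: adjopP => a; apply: (lact_faithful fullX) => x.
by rewrite -[LHS]mult_op_lact mn mult_op_lact.
Qed.

Lemma mult_opM m n : mult_op X (m ** n) = adjcomp (mult_op X m) (mult_op X n).
Proof. by apply: mult_opP => x a; rewrite rmulM !mult_funP. Qed.

Lemma mult_op_star m : mult_op X m^# = adjoint (mult_op X m).
Proof. by apply/esym/(adjoint_uniq hX) => x y; exact: mult_fun_adj. Qed.

Lemma mult_op_iota a : mult_op X (iotaA a) = lactop a.
Proof. by apply: mult_opP => x b; rewrite rmul_iota lactA. Qed.

Lemma mult_opD m n : mult_op X (m + n) = mult_op X m + mult_op X n.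
Proof.
by apply: mult_opP => x a; rewrite rmulDr adjopD lactDl lactDr !mult_funP.
Qed.

Lemma mult_opZ (k : R[i]) m : mult_op X (k *: m) = k *: mult_op X m.
Proof.
by apply: mult_opP => x a; rewrite rmulZr adjopZ lactZl lactZr !mult_funP.
Qed.

Lemma mult_opB m n : mult_op X (m - n) = mult_op X m - mult_op X n.
Proof. by rewrite -scaleN1r mult_opD mult_opZ scaleN1r. Qed.

Lemma mult_op_phibar : is_phibar (X := X) (@mult_op R A X).
Proof.
split.
- by move=> k m n; rewrite mult_opD mult_opZ.
- exact: mult_opM.
- exact: mult_op_star.
- have [g gK] := choice (mult_op_surj fullX).
  by exists g => // m; apply: mult_op_inj; rewrite gK.
- by move=> a x; rewrite mult_op_iota.
Qed.

(** [phibar] is only chosen by [xget], but multiplicativity and the values on A determine it, since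
    [F a F m = F (a m)] with [a m] in A. *)
Lemma phibarE m : phibar X m = mult_op X m.
Proof.
have [_ FM _ _ Fi] : is_phibar (phibar X).
  by apply: (@xgetPex _ (fun=> 0)); exists (@mult_op R A X); exact: mult_op_phibar.
apply/esym/mult_opP => x a.
by rewrite -!Fi -[iota_alg (rmul a m)]/(iotaA _) -iotaA_rmul FM.
Qed.

Lemma phibar_invK (P : adjop X X) : mult_op X (phibar_inv P) = P.
Proof.
rewrite -phibarE; apply: (@xgetPex _ 0 [set m | phibar X m = P]).
by have [m mP] := mult_op_surj fullX P; exists m; rewrite /= phibarE.
Qed.

(** Left multiplication by [m] on A is seen on X through the isometric left action, as [m a] acts by
    [mult_op X m] after [a]. *)
Lemma opn_mult_op m : opn (mult_op X m) = nm m.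
Proof.
apply/le_anti/andP; split.
  by apply: opn_le => [|x]; rewrite ?nm_ge0 // !gn_nm nm_mult_fun.
apply: opn_le => [|a]; first exact: opn_ge0 hX hX _.
rewrite !gn_self -(opn_lactop fullX) -[leRHS]mulr1.
rewrite (_ : lactop _ = adjcomp (mult_op X m) (lactop (a : A))).
  rewrite mulr1 -[X in _ <= _ * X](opn_lactop fullX).
  exact: (opn_comp hX hX hX).
by apply: adjopP => x; rewrite adjcompE; exact/esym/mult_op_lact.
Qed.

End PhibarTheory.

(** * Products of M(X) with A, X and M(A) *)

Section MultiplierModule.
Variables (R : realType) (A : cstarType R) (X : hilbertBimodType A).
Hypothesis fullX : full_bimod X.
Implicit Types (x y z w : X) (a b c : A) (m n : mult A) (S T : multmod X).
Local Notation hA := (hilbert_self A).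
Local Notation hX := (hilbert_bimod X).
Local Notation iotaX := (@iota_mod R A X).

Lemma iotaX_B x y : iotaX (x - y) = iotaX x - iotaX y.
Proof. exact: raddfB. Qed.

Lemma iotaX_D x y : iotaX (x + y) = iotaX x + iotaX y.
Proof. exact: raddfD. Qed.

Lemma iotaX_Z (k : R[i]) x : iotaX (k *: x) = k *: iotaX x.
Proof. exact: linearZ. Qed.

Lemma adjoint_iotaX x y : adjoint (iotaX x) y = rip x y :> A.
Proof.
apply: (rip_injr hA) => z; rewrite -(adjointP (iotaX x)).
by rewrite [LHS]ripC rip_ract cstarM -ripC.
Qed.

Lemma adjcomp_iotaA T a : adjcomp T (iota_alg a) = iotaX (T a).
Proof. by apply: adjopP => b; exact: (adj_ract hX hA). Qed.

Lemma adjcomp_adj_iotaX T x : adjcomp (adjoint T) (iotaX x) = iota_alg (adjoint T x).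
Proof. by apply: adjopP => b; exact: (adj_ract hA hX). Qed.

Lemma opn_iotaX x : opn (iotaX x) = nm x.
Proof.
have : opn (iotaX x) ^+ 2 = nm x ^+ 2.
  rewrite -(opn_star_self hA hX) adjcomp_adj_iotaX -nm_rip -(adjoint_iotaX x x).
  exact: nm_iota.
by move/eqP; rewrite eqrXn2 ?nm_ge0 ?(opn_ge0 hA hX) // => /eqP.
Qed.

Lemma iotaX_closed T :
  (forall e, 0 < e -> exists x, opn (T - iotaX x) <= e) -> exists x, T = iotaX x.
Proof.
apply: (@isometry_range_closed _ _ _ (@nm R X)) => //.
- exact: nm_complete.
- exact: iotaX_B.
- exact: opn_iotaX.
- exact: (opnD hA hX).
- exact: (opnN hA hX).
- by move=> S S0; apply/(opn_eq0 hA hX)/le_anti; rewrite S0 (opn_ge0 hA hX).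
Qed.

Lemma ract_span x : closed_span [set x *< a | x in [set: X] & a in [set: A]] x.
Proof. by rewrite (ract_nondeg (s := X)). Qed.

(** Together with [lactop_mul] and [iotaX_adj] this makes the corona operations well defined: a
    product with a factor in X or A falls back into X or A. Here [(z a) m = z (a m)] with [a m] in
    A. *)
Lemma iotaX_mul_r x m : exists y, adjcomp (iotaX x) m = iotaX y.
Proof.
move: x (@ract_span x); apply: closed_span_ind.
- move=> _ [z _ [a _ <-]]; exists (z *< rmul a m); apply: adjopP => b.
  rewrite adjcompE /= -!ractA; congr (_ *< _); apply: iotaA_inj.
  by rewrite !iotaAM -iotaA_rmul -cmulA (iotaA_lmul m b).
- by exists 0; apply: adjopP => b; rewrite /= !ract0l.
- move=> x y [x' hx] [y' hy]; exists (x' + y').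
  by rewrite !iotaX_D -hx -hy; apply: adjopP.
- by move=> k x [x' hx]; exists (k *: x'); rewrite !iotaX_Z -hx; apply: adjopP.
- move=> x xP; apply: iotaX_closed => e e0.
  have m1 : 0 < nm m + 1 by have := nm_ge0 m; lra.
  have [y [y' hy] xy] := xP _ (divr_gt0 e0 m1); exists y'; rewrite -hy.
  rewrite (_ : _ - _ = adjcomp (iotaX (x - y)) m); last first.
    by rewrite iotaX_B; apply: adjopP.
  apply: (le_trans (opn_comp hA hA hX _ _)); rewrite opn_iotaX.
  apply: (le_trans (ler_wpM2r (opn_ge0 hA hA _) xy)).
  rewrite -mulrA ler_piMr ?(ltW e0) // mulrC ler_pdivrMr // mul1r.
  by rewrite -nm_mult lerDl.
Qed.

Lemma iotaX_mul_l m x : adjcomp (mult_op X m) (iotaX x) = iotaX (mult_op X m x).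
Proof. by apply: adjopP => b; exact: (adj_ract hX hX). Qed.

(** Fullness reduces to [a = lip x y], where [a T b = x <y, T b> = x <adjoint T y, b>]. *)
Lemma lactop_mul T a : exists y, adjcomp (lactop a) T = iotaX y.
Proof.
have [+ _] := fullX; move/seteqP=> [_ /(_ a I)].
move: a; apply: (@closed_span_ind _ _ _
  (fun a => exists y, adjcomp (lactop a) T = iotaX y)).
- move=> _ [x _ [y _ <-]]; exists (x *< (adjoint T y : A)^#); apply: adjopP => b.
  rewrite adjcompE /= lip_rip -ractA rip_adj_r; congr (_ *< _).
- by exists 0; apply: adjopP => b; rewrite /= lact0l ract0l.
- move=> a a' [x hx] [y hy]; exists (x + y); rewrite iotaX_D -hx -hy.
  by apply: adjopP => b; rewrite /= lactDl.
- move=> k a [x hx]; exists (k *: x); rewrite iotaX_Z -hx.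
  by apply: adjopP => b; rewrite /= lactZl.
- move=> a aP; apply: iotaX_closed => e e0.
  have T1 : 0 < opn T + 1 by have := opn_ge0 hA hX T; lra.
  have [b [y hy] ab] := aP _ (divr_gt0 e0 T1); exists y; rewrite -hy.
  rewrite (_ : _ - _ = adjcomp (lactop (a - b)) T); last first.
    by apply: adjopP => c; rewrite /= lactDl lactNl.
  apply: (le_trans (opn_comp hA hX hX _ _)).
  apply: (le_trans (ler_wpM2r (opn_ge0 hA hX _) (le_trans (opn_lactop_le X _) ab))).
  rewrite -mulrA ler_piMr ?(ltW e0) // mulrC ler_pdivrMr // mul1r.
  by rewrite lerDl.
Qed.

Lemma lactop_closed (P : adjop X X) :
  (forall e, 0 < e -> exists a, opn (P - lactop a) <= e) -> exists a, P = lactop a.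
Proof.
apply: (@isometry_range_closed _ _ _ (@nm R A)) => //.
- exact: nm_complete.
- by move=> a b; apply: adjopP => x; rewrite /= lactDl lactNl.
- exact: opn_lactop.
- exact: (opnD hX hX).
- exact: (opnN hX hX).
- by move=> S S0; apply/(opn_eq0 hX hX)/le_anti; rewrite S0 (opn_ge0 hX hX).
Qed.

(** For [x = z a] the operator sends [y] to [z <T a^#, y>], which is the action of
    [lip z (T a^#)]. *)
Lemma iotaX_adj x T : exists a, adjcomp (iotaX x) (adjoint T) = lactop a.
Proof.
move: x (@ract_span x); apply: closed_span_ind.
- move=> _ [z _ [a _ <-]]; exists (lip z (T a^#)); apply: adjopP => y.
  rewrite adjcompE /= lip_rip -ractA [rip _ y]ripC rip_adj_r.
  by rewrite {1}/rip /= cstarM !cstarK.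
- by exists 0; apply: adjopP => y; rewrite /= ract0l lact0l.
- move=> x y [a ha] [b hb]; exists (a + b); apply: adjopP => z.
  move/(congr1 (fun P : adjop X X => P z)): ha; rewrite /= => ha.
  move/(congr1 (fun P : adjop X X => P z)): hb; rewrite /= => hb.
  by rewrite /= ractDl lactDl ha hb.
- move=> k x [a ha]; exists (k *: a); apply: adjopP => z.
  move/(congr1 (fun P : adjop X X => P z)): ha; rewrite /= => ha.
  by rewrite /= ractZl lactZl ha.
- move=> x xP; apply: lactop_closed => e e0.
  have T1 : 0 < opn T + 1 by have := opn_ge0 hA hX T; lra.
  have [y [a ha] xy] := xP _ (divr_gt0 e0 T1); exists a; rewrite -ha.
  rewrite (_ : _ - _ = adjcomp (iotaX (x - y)) (adjoint T)); last first.
    by rewrite iotaX_B; apply: adjopP.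
  apply: (le_trans (opn_comp hX hA hX _ _)); rewrite opn_iotaX.
  apply: (le_trans (ler_wpM2r (opn_ge0 hX hA _) xy)).
  rewrite (opn_adjoint hA hX) -mulrA ler_piMr ?(ltW e0) //.
  by rewrite mulrC ler_pdivrMr // mul1r lerDl.
Qed.

End MultiplierModule.

(** * Lifts from the corona *)

Definition piA (R : realType) (A : cstarType R) : mult A -> corona_alg A :=
  coker_pi (@iota_alg R A).

Definition piX (R : realType) (A : cstarType R) (X : hilbertBimodType A) :
  multmod X -> corona_mod X := coker_pi (@iota_mod R A X).

Definition reprA (R : realType) (A : cstarType R) (p : corona_alg A) : mult A :=
  repr p.

Definition reprX (R : realType) (A : cstarType R) (X : hilbertBimodType A)
  (p : corona_mod X) : multmod X := repr (p : coker (@iota_mod R A X)).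

Section CoronaOperations.
Variables (R : realType) (A : cstarType R) (X : hilbertBimodType A).
Hypothesis fullX : full_bimod X.
Implicit Types (m n : mult A) (S T : multmod X).
Local Notation hA := (hilbert_self A).
Local Notation hX := (hilbert_bimod X).

Definition multmod_lip S T : mult A := phibar_inv (adjcomp S (adjoint T)).

Lemma piAP m n : piA m = piA n <-> exists a, m - n = iotaA a.
Proof.
rewrite /piA coker_piP; split=> [[a _ aE]|[a aE]]; first by exists a; rewrite -aE.
by exists a => //; rewrite [RHS]aE.
Qed.

Lemma piXP S T : piX S = piX T <-> exists x, S - T = iota_mod x.
Proof.
rewrite /piX coker_piP; split=> [[x _ xE]|[x xE]]; first by exists x; rewrite -xE.
by exists x.
Qed.

Lemma reprAK (p : corona_alg A) : piA (reprA p) = p.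
Proof. exact: coker_reprK. Qed.

Lemma reprXK (p : corona_mod X) : piX (reprX p) = p.
Proof. exact: coker_reprK. Qed.

(** Corona operations are computed on representatives chosen by [repr]. Through this and [repr_piX],
    the formulas from [piA_mul] to [piX_lip] allow arbitrary ones. *)
Lemma repr_piA m : exists a, reprA (piA m) = m + iotaA a.
Proof.
have /piAP[a aE] := reprAK (piA m).
by exists a; rewrite -aE addrC subrK.
Qed.

Lemma repr_piX T : exists x, reprX (piX T) = T + iota_mod x.
Proof.
have /piXP[x xE] := reprXK (piX T).
by exists x; rewrite -xE addrC subrK.
Qed.

Lemma corona_mulE (p q : corona_alg A) : p ** q = piA (reprA p ** reprA q).
Proof. by []. Qed.

Lemma corona_starE (p : corona_alg A) : p^# = piA (reprA p)^#.
Proof. by []. Qed.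

Lemma corona_ractE (s : corona_mod X) (p : corona_alg A) :
  s *< p = piX (adjcomp (reprX s) (reprA p)).
Proof. by []. Qed.

Lemma corona_lactE (s : corona_mod X) (p : corona_alg A) :
  p >* s = piX (adjcomp (phibar X (reprA p)) (reprX s)).
Proof. by []. Qed.

Lemma corona_ripE (s t : corona_mod X) :
  rip s t = piA (adjcomp (adjoint (reprX s)) (reprX t)).
Proof. by []. Qed.

Lemma corona_lipE (s t : corona_mod X) :
  lip s t = piA (multmod_lip (reprX s) (reprX t)).
Proof. by []. Qed.

Lemma piA_mul m n : piA m ** piA n = piA (m ** n).
Proof.
have [a aE] := repr_piA m; have [b bE] := repr_piA n.
rewrite corona_mulE aE bE; apply/piAP; exists (lmul m b + rmul a n + a ** b).
by rewrite !iotaAD iotaAM -iotaA_rmul -iotaA_lmul !ncE; lmod R.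
Qed.

Lemma piA_star m : (piA m)^# = piA m^#.
Proof.
have [a aE] := repr_piA m; rewrite corona_starE aE.
by apply/piAP; exists a^#; rewrite cstarD iotaA_star; lmod R.
Qed.

Lemma adjcompDl (E F G : rightInnerType A) (S S' : adjop F G) (T : adjop E F) :
  adjcomp (S + S') T = adjcomp S T + adjcomp S' T.
Proof. exact: adjopP. Qed.

Lemma adjcompDr (E F G : rightInnerType A) (S : adjop F G) (T T' : adjop E F) :
  hilbert_module G -> adjcomp S (T + T') = adjcomp S T + adjcomp S T'.
Proof. by move=> hG; apply: adjopP => x; exact: adj_add. Qed.

Lemma piX_ract T m : piX T *< piA m = piX (adjcomp T m).
Proof.
have [x xE] := repr_piX T; have [a aE] := repr_piA m.
have [y yE] := iotaX_mul_r x m.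
rewrite corona_ractE xE aE; apply/piXP.
exists (y + (T a + x *< a)).
rewrite !iotaX_D -yE -adjcomp_iotaA -(adjcomp_iotaA (iota_mod x) a).
rewrite adjcompDl !(adjcompDr _ _ _ hX); lmod R.
Qed.

Lemma piX_lact m T : piA m >* piX T = piX (adjcomp (phibar X m) T).
Proof.
have [x xE] := repr_piX T; have [a aE] := repr_piA m.
have [y yE] := lactop_mul fullX T a.
rewrite corona_lactE xE aE !(phibarE fullX); apply/piXP.
exists (y + mult_op X (m + iotaA a) x); rewrite !iotaX_D -yE -iotaX_mul_l.
by rewrite !mult_opD mult_op_iota !(adjcompDr _ _ _ hX) !adjcompDl; lmod R.
Qed.

Lemma piX_rip S T :
  rip (piX S) (piX T) = piA (adjcomp (adjoint S) T).
Proof.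
have [x xE] := repr_piX S; have [y yE] := repr_piX T.
rewrite corona_ripE xE yE; apply/piAP.
have eS : iotaA (adjoint (S + iota_mod x) y) =
    adjcomp (adjoint (S + iota_mod x)) (iota_mod y).
  by rewrite adjcomp_adj_iotaX.
have eT : iotaA (adjoint T x : A)^# = adjoint (adjcomp (adjoint T) (iota_mod x)).
  by rewrite iotaA_star adjcomp_adj_iotaX.
exists (adjoint (S + iota_mod x) y + (adjoint T x : A)^#).
rewrite iotaAD eS eT (adjoint_comp hA) (adjointK hX).
rewrite !(adjcompDr _ _ _ hA) (adjointD hA).
by rewrite !adjcompDl; lmod R.
Qed.

Lemma multmod_lip_op S T : mult_op X (multmod_lip S T) = adjcomp S (adjoint T).
Proof. exact: phibar_invK. Qed.

Lemma piX_lip S T :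
  lip (piX S) (piX T) = piA (multmod_lip S T).
Proof.
have [x xE] := repr_piX S; have [y yE] := repr_piX T.
rewrite corona_lipE xE yE; apply/piAP.
have [a aE] := iotaX_adj fullX x (T + iota_mod y).
have [b bE] := iotaX_adj fullX y S.
exists (a + b^#); apply: (mult_op_inj fullX).
rewrite mult_opB !multmod_lip_op mult_op_iota.
rewrite (_ : lactop (a + b^#) = lactop a + adjoint (lactop b)); last first.
  by rewrite adjoint_lactop; apply: adjopP => z; exact: lactDl.
rewrite -aE -bE (adjoint_comp hX) (adjointK hX).
by rewrite adjcompDl !(adjointD hA) !(adjcompDr _ _ _ hX); lmod R.
Qed.

End CoronaOperations.

(** * Norm bounds for lifts *)

Section Contraction.
Variables (R : realType) (A : cstarType R) (C : cstarType R).
Variable delta : {linear C -> corona_alg A}.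
Hypothesis delta_morph : star_morphism delta.
Implicit Types (m n u w : mult A) (a b : A) (c d : C).
Local Notation one := (mult_one A).

Definition lifts c m := delta c = piA m.

Lemma lifts_ex c : exists m, lifts c m.
Proof. by exists (reprA (delta c)); rewrite /lifts reprAK. Qed.

Lemma piAD m n : piA (m + n) = piA m + piA n. Proof. exact: raddfD. Qed.
Lemma piAN m : piA (- m) = - piA m. Proof. exact: raddfN. Qed.
Lemma piAZ (k : R[i]) m : piA (k *: m) = k *: piA m. Proof. exact: linearZ. Qed.

Lemma liftsD c d m n : lifts c m -> lifts d n -> lifts (c + d) (m + n).
Proof. by rewrite /lifts piAD => <- <-; exact: raddfD. Qed.

Lemma liftsN c m : lifts c m -> lifts (- c) (- m).
Proof. by rewrite /lifts piAN => <-; exact: raddfN. Qed.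

Lemma liftsB c d m n : lifts c m -> lifts d n -> lifts (c - d) (m - n).
Proof. by move=> hc /liftsN; exact: liftsD. Qed.

Lemma liftsZ (k : R[i]) c m : lifts c m -> lifts (k *: c) (k *: m).
Proof. by rewrite /lifts piAZ => <-; exact: linearZ. Qed.

Lemma liftsM c d m n : lifts c m -> lifts d n -> lifts (c ** d) (m ** n).
Proof. by rewrite /lifts (star_morphM delta_morph) -piA_mul => <- <-. Qed.

Lemma lifts_star c m : lifts c m -> lifts c^# m^#.
Proof. by rewrite /lifts (star_morph_star delta_morph) -piA_star => <-. Qed.

Lemma lifts0 m : lifts 0 m <-> exists a, m = iotaA a.
Proof.
have p0 : piA 0 = 0 :> corona_alg A by exact: raddf0.
have d0 : delta 0 = 0 by exact: raddf0.
rewrite /lifts d0 -p0; split=> [/esym/piAP[a]|[a ->]].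
  by rewrite subr0 => ->; exists a.
by apply/esym/piAP; exists a; rewrite subr0.
Qed.

(** [w] is [1 - u] for an approximate unit [u] of [a^2], and [|a w|^2 = |w a^2 w|]. Multiplication
    by [w] preserves classes modulo A and nearly kills [a]. *)
Lemma quasi_unit a (e : R) : a^# = a -> 0 < e -> exists w,
  [/\ w^# = w, nm w <= 1, exists b, one - w = iotaA b & nm (iotaA a ** w) <= e].
Proof.
move=> as_ e0.
have pa : pos_elt (a ** a) by apply: cstar_pos_elt; exists a; rewrite as_.
have [u [us u1 ue]] := pos_elt_approx pa (exprn_gt0 2 e0).
have ws : (one - iotaA u)^# = one - iotaA u.
  by rewrite cstarD astarN (one_star (@mult_one_l _ A)) -iotaA_star us.
exists (one - iotaA u); split=> //; first by exists u; rewrite opprB addrC subrK.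
rewrite -(@ler_pXn2r _ 2) ?nnegrE ?nm_ge0 ?(ltW e0) // -nm_cstar.
rewrite cstarM ws -iotaA_star as_ cmulA -(cmulA _ (iotaA a) (iotaA a)) -iotaAM.
rewrite (le_trans (nm_amul _ _)) // -[e ^+ 2]mulr1 ler_pM ?nm_ge0 //.
Qed.

(** For [w] nearly killing [a], [|u w|^2 = |w (1 + a) w| <= 1 + e], and [u w] agrees with [u] modulo
    A. *)
Lemma nm_quotient_le u a (e : R) : u^# ** u = one + iotaA a -> 0 < e ->
  exists b, nm (u - iotaA b) <= 1 + e.
Proof.
move=> uu e0; have as_ : a^# = a.
  apply: iotaA_inj; apply: (addrI one); rewrite -uu iotaA_star.
  rewrite -{1}(one_star (@mult_one_l _ A)) -cstarD -uu.
  by rewrite cstarM cstarK.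
have [w [ws w1 [b bE] we]] := quasi_unit as_ e0.
exists (lmul u b); rewrite -iotaA_lmul -bE cmulDr amulNr mult_one_r.
rewrite opprB addrC subrK.
rewrite -(@ler_pXn2r _ 2) ?nnegrE ?nm_ge0 ?addr_ge0 ?(ltW e0) // -nm_cstar.
rewrite cstarM ws cmulA -(cmulA w) uu cmulDr cmulDl mult_one_r.
rewrite (le_trans (nmD _ _)) // -(cmulA w).
have := nm_amul w w; have := nm_amul w (iotaA a ** w).
have := ler_pM (nm_ge0 w) (nm_ge0 w) w1 w1.
have := ler_pM (nm_ge0 w) (nm_ge0 _) w1 we.
by move: (nm w) (nm _) (nm _) (nm _) => *; nra.
Qed.

(* With [(1 - d)^2 = 1 - c^2], lifts [m] of [c] and [n] of [d] give an operator
   [u := m + i (1 - n)] that is unitary modulo A, hence at distance at most 1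
   from A, and [m] is the half sum of [u] and [u^#] modulo A. *)
Lemma lifts_sa_bound c m (e : R) : c^# = c -> nm c <= 1 -> lifts c m -> 0 < e ->
  exists a, nm (m - iotaA a) <= 1 + e.
Proof.
move=> cs c1 cm e0.
have c2s : (c ** c)^# = c ** c by rewrite cstarM cs.
have c21 : nm (c ** c) <= 1.
  by rewrite (le_trans (nm_amul _ _)) // mulr_ile1 ?nm_ge0.
have [d [ds _ dE dc]] := sqrt_fixpoint c2s c21.
have cd : c ** d = d ** c by apply: dc; rewrite cmulA.
have [n dn] := lifts_ex d.
pose u := m + 'i *: (one - n).
have us : u^# = m^# - 'i *: (one - n^#).
  rewrite cstarD cstarZ conj_i cstarD astarN (one_star (@mult_one_l _ A)).
  by rewrite scaleNr.
have cm' := lifts_star cm; have dn' := lifts_star dn.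
rewrite cs in cm'; rewrite ds in dn'.
(* Stated for any [k] with [k^2 = -1]: [k = i] gives [u^# u] and [k = - i] gives [u u^#]. *)
have prod (k : R[i]) p q r s : k * k = -1 ->
    (p - k *: (one - r)) ** (q + k *: (one - s)) - one =
    p ** q + k *: (p - p ** s) - k *: (q - r ** q) - r - s + r ** s.
  move=> kk; rewrite (_ : _ ** _ = p ** q + k *: (p - p ** s) - k *: (q - r ** q)
      - (k * k) *: (one - s - r + r ** s)).
    by rewrite kk; lmod R.
  by rewrite !(ncE, mult_one_l, mult_one_r); lmod R.
have lift_prod (k : R[i]) x1 x2 y1 y2 m1 m2 n1 n2 :
    lifts x1 m1 -> lifts x2 m2 -> lifts y1 n1 -> lifts y2 n2 ->
    lifts (x1 ** x2 + k *: (x1 - x1 ** y2) - k *: (x2 - y1 ** x2) - y1 - y2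
           + y1 ** y2)
      (m1 ** m2 + k *: (m1 - m1 ** n2) - k *: (m2 - n1 ** m2) - n1 - n2
       + n1 ** n2).
  move=> h1 h2 g1 g2; have := liftsM h1 h2.
  have := liftsZ k (liftsB h1 (liftsM h1 g2)).
  have := liftsZ k (liftsB h2 (liftsM g1 h2)).
  move=> H1 H2 H3; apply: liftsD (liftsM g1 g2).
  by apply: liftsB g2; apply: liftsB g1; apply: liftsB H1; exact: liftsD.
(* C may lack a unit, so [(1 - d)^2 = 1 - c^2] enters as [2 d - d^2 = c^2]; the unit of M(A) has
   been subtracted in [prod]. *)
have zero (k : R[i]) : 0 = c ** c + k *: (c - c ** d) - k *: (c - d ** c) - d - d
    + d ** d by rewrite -dE cd; lmod R.
have [a aE] : exists a, u^# ** u - one = iotaA a.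
  apply/lifts0; rewrite us prod ?mul_ii // (zero 'i).
  exact: lift_prod.
have [a' aE'] : exists a, u ** u^# - one = iotaA a.
  apply/lifts0; rewrite us (_ : u = m - (- 'i) *: (one - n)); last first.
    by rewrite /u; lmod R.
  rewrite (_ : m^# - _ = m^# + (- 'i) *: (one - n^#)); last by lmod R.
  by rewrite prod ?mulrNN ?mul_ii // (zero (- 'i)); exact: lift_prod.
have uu : u^# ** u = one + iotaA a by rewrite -aE addrC subrK.
have uu' : (u^#)^# ** u^# = one + iotaA a' by rewrite -aE' cstarK addrC subrK.
have [b bP] := nm_quotient_le uu e0.
have [b' bP'] := nm_quotient_le uu' e0.
have [x xE] : exists x, m - m^# = iotaA x.
  by apply/lifts0; rewrite -(subrr c); exact: liftsB.
have [y yE] : exists y, n^# - n = iotaA y.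
  by apply/lifts0; rewrite -(subrr d); exact: liftsB.
(* The terms [x] and [y] correct for [m] and [n] being selfadjoint only modulo A:
   [u + u^# = 2 m - x + i y]. *)
exists ((2^-1)%:C *: (b + b' + x - 'i *: y)).
rewrite iotaAZ iotaAB !iotaAD iotaAZ -xE -yE.
rewrite (_ : _ - _ = (2^-1)%:C *: ((u - iotaA b) + (u^# - iotaA b'))); last first.
  by rewrite fmorphV rmorph_nat us /u; lmod_goals (R[i]) (mult A); field.
rewrite nmZr ger0_norm ?invr_ge0 //.
by have := nmD (u - iotaA b) (u^# - iotaA b'); lra.
Qed.

(** The selfadjoint case applies to [c^# c / s^2] with [s = |c| + e / 2], and a quasi-unit [w] for
    the resulting element of A gives [|m w|^2 <= s^2 + s e + (e / 2)^2 = (|c| + e)^2]. *)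
Lemma lifts_bound c m (e : R) : lifts c m -> 0 < e ->
  exists a, nm (m - iotaA a) <= nm c + e.
Proof.
move=> cm e0; pose s := nm c + e / 2.
have s0 : 0 < s by have := nm_ge0 c; rewrite /s; lra.
have s2 : 0 < s ^+ 2 by rewrite exprn_gt0.
pose k : R[i] := ((s ^+ 2)^-1)%:C.
have kc : (k *: (c^# ** c))^# = k *: (c^# ** c).
  by rewrite cstarZ conj_real cstarM cstarK.
have kc1 : nm (k *: (c^# ** c)) <= 1.
  rewrite nmZr ger0_norm ?invr_ge0 ?(ltW s2) // ler_pdivrMl // mulr1 nm_cstar.
  by rewrite ler_pXn2r ?nnegrE ?nm_ge0 ?(ltW s0) // /s; lra.
have kcm := liftsZ k (liftsM (lifts_star cm) cm).
have [a ha] := lifts_sa_bound kc kc1 kcm (divr_gt0 e0 s0).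
(* [quasi_unit] needs a selfadjoint element; averaging with the adjoint does not spoil the distance
   to [m^# m]. *)
pose a1 := (s ^+ 2)%:C *: a; pose a2 := (2^-1)%:C *: (a1 + a1^#).
have kk : (s ^+ 2)%:C * k = 1.
  by rewrite -rmorphM /= divff // gt_eqF.
have h1 : nm (m^# ** m - iotaA a1) <= s ^+ 2 + s * e.
  rewrite /a1 iotaAZ -[m^# ** m]scale1r -kk -scalerA -scalerBr.
  rewrite nmZr ger0_norm ?(ltW s2) //; apply: (le_trans (ler_wpM2l (ltW s2) ha)).
  rewrite mulrDr mulr1 lerD2l expr2 -mulrA (mulrCA s e) mulfV ?gt_eqF //.
  by rewrite mulr1 mulrC.
have h2 : nm (m^# ** m - iotaA a2) <= s ^+ 2 + s * e.
  rewrite (_ : _ - _ = (2^-1)%:C *: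
      ((m^# ** m - iotaA a1) + (m^# ** m - iotaA a1)^#)); last first.
    rewrite /a2 iotaAZ iotaAD cstarD astarN cstarM cstarK -iotaA_star.
    by rewrite fmorphV rmorph_nat; lmod_goals (R[i]) (mult A); field.
  rewrite nmZr ger0_norm ?invr_ge0 //.
  have := nmD (m^# ** m - iotaA a1) (m^# ** m - iotaA a1)^#; rewrite nm_star.
  lra.
have a2s : a2^# = a2 by rewrite cstarZ conj_real cstarD cstarK addrC.
have e2 : 0 < (e / 2) ^+ 2 by rewrite exprn_gt0 // divr_gt0.
have [w [ws w1 [b bE] we]] := quasi_unit a2s e2.
exists (lmul m b); rewrite -iotaA_lmul -bE cmulDr amulNr mult_one_r.
rewrite opprB addrC subrK.
have c0 := nm_ge0 c.
rewrite -(@ler_pXn2r _ 2) ?nnegrE ?nm_ge0 ?addr_ge0 ?(ltW e0) // -nm_cstar.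
rewrite cstarM ws cmulA -(cmulA w) -(subrK (iotaA a2) (m^# ** m)).
rewrite -cmulA cmulDl cmulDr (le_trans (nmD _ _)) //.
have bound p q : nm p <= q -> nm (w ** p) <= q.
  move=> pq; rewrite (le_trans (nm_amul _ _)) // (le_trans _ pq) //.
  by rewrite ler_piMl ?nm_ge0.
have h3 : nm ((m^# ** m - iotaA a2) ** w) <= s ^+ 2 + s * e.
  rewrite (le_trans (nm_amul _ _)) // (le_trans _ h2) //.
  by rewrite ler_piMr ?nm_ge0.
have := lerD (bound _ _ h3) (bound _ _ we); move/le_trans; apply.
by rewrite /s; move: (nm c) => t; nra.
Qed.

(** For a lift [m0] of [c], the element [m - m0] is a limit of elements [n - m0] lifting [d - c],
    which are close to A by [lifts_bound]; and A is closed. *)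
Lemma lifts_closed c m :
  (forall e : R, 0 < e -> exists d n,
     [/\ lifts d n, nm (c - d) <= e & nm (m - n) <= e]) -> lifts c m.
Proof.
move=> h; have [m0 cm0] := lifts_ex c.
have [|a aE] := @iotaA_closed _ _ (m - m0).
  move=> e e0; have [d [n [dn cd mn]]] := h (e / 3) ltac:(lra).
  have [a ha] := lifts_bound (liftsB dn cm0) (e := e / 3) ltac:(lra).
  exists a; rewrite (_ : _ - iotaA a = (m - n) + (n - m0 - iotaA a)).
    apply: (le_trans (nmD _ _)); rewrite nmC in cd.
    by move: (nm (m - n)) (nm (d - c)) (nm _) mn cd ha => p q r; lra.
  by rewrite !addrA subrK.
have := liftsD cm0 ((lifts0 _).2 (ex_intro _ a erefl)); rewrite -aE addr0.
by rewrite addrC subrK.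
Qed.

End Contraction.

(** * Positivity of the inner products of M(X) *)

Section ModulePositivity.
Variables (R : realType) (A : cstarType R) (X : hilbertBimodType A).
Hypothesis fullX : full_bimod X.
Implicit Types (x y : X) (m n k : mult A) (T : multmod X).
Local Notation hA := (hilbert_self A).
Local Notation hX := (hilbert_bimod X).

Definition multmod_rip T T' : mult A := adjcomp (adjoint T) T'.

Lemma multmod_rip_sa T : (multmod_rip T T)^# = multmod_rip T T.
Proof. by rewrite [LHS](adjoint_comp hA) (adjointK hX). Qed.

Lemma multmod_lip_star S T : (multmod_lip S T)^# = multmod_lip T S.
Proof.
apply: (mult_op_inj fullX).
by rewrite mult_op_star !multmod_lip_op // (adjoint_comp hX) (adjointK hX).
Qed.

Lemma mult_rip_sa n (a b : selfmod A) : n^# = n ->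
  rip ((n : multalg A) a) b = rip a ((n : multalg A) b).
Proof. by move=> ns; rewrite -{2}ns; exact: (adjointP (n : multalg A)). Qed.

(** If [n T^# T n = - k^2], evaluation at [a] gives [<T n a, T n a> = - (k a)^# (k a)]. Inner
    squares in X are positive, so [k a = 0]. *)
Lemma multmod_rip_pos T :
  exists2 t : R, 0 <= t & nm (t%:C *: mult_one A - multmod_rip T T) <= t.
Proof.
apply: (jordan_pos (@mult_one_l _ A) (@mult_one_r _ A) (multmod_rip_sa T)).
move=> n k ns ks nk; apply: adjopP => a.
have [b bE] := rip_pos (T ((n : multalg A) a)).
apply: (@neg_pos_eq0 _ A _ b); rewrite -bE (adjointP T).
rewrite -[adjoint T _]/((multmod_rip T T : multalg A) ((n : multalg A) a)).
rewrite mult_rip_sa // -[X in rip a X]/((n ** (multmod_rip T T ** n) : multalg A) a).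
rewrite cmulA nk -[X in rip a X]/(- ((k : multalg A) ((k : multalg A) a))).
by rewrite ripNr -mult_rip_sa.
Qed.

(** The same computation, through [mult_op] on vectors of X: [<T^# n x, T^# n x> = - <k x, k x>]. *)
Lemma multmod_lip_pos T :
  exists2 t : R, 0 <= t & nm (t%:C *: mult_one A - multmod_lip T T) <= t.
Proof.
apply: (jordan_pos (@mult_one_l _ A) (@mult_one_r _ A) (multmod_lip_star T T)).
move=> n k ns ks nk; apply: (mult_op_inj fullX); apply: adjopP => x.
have -> : mult_op X 0 x = 0 by rewrite -(subrr 0) mult_opB subrr.
have Ns : adjoint (mult_op X n) = mult_op X n by rewrite -mult_op_star ns.
have Ks : adjoint (mult_op X k) = mult_op X k by rewrite -mult_op_star ks.
have [b bE] := rip_pos (mult_op X k x).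
have aE : rip (adjoint T (mult_op X n x)) (adjoint T (mult_op X n x)) =
    - rip (mult_op X k x) (mult_op X k x).
  rewrite -(adjointP T) (rip_adj_r (mult_op X n)) (rip_adj_r (mult_op X k)) Ns Ks.
  rewrite -ripNl; congr (rip _ x).
  move/(congr1 (fun m => mult_op X m x)): nk.
  rewrite !mult_opM multmod_lip_op // => nk.
  rewrite -[LHS]/(adjcomp (adjcomp (mult_op X n) (adjcomp T (adjoint T)))
    (mult_op X n) x).
  by rewrite nk -sub0r mult_opB mult_opM -[0 in LHS](subrr 0) mult_opB subrr sub0r.
have b0 : b = 0.
  apply: (@neg_pos_eq0 _ A _ (adjoint T (mult_op X n x))).
  by rewrite -bE -aE.
apply/(hm_def hX); rewrite /gn bE b0 amul0r nm0 sqrtr0 //.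
Qed.

Lemma nm_multmod_rip T : nm (multmod_rip T T) = opn T ^+ 2.
Proof. exact: (opn_star_self hA hX). Qed.

Lemma nm_multmod_lip T : nm (multmod_lip T T) = opn T ^+ 2.
Proof.
rewrite -(opn_mult_op fullX) multmod_lip_op // -(opn_adjoint hA hX).
rewrite -[X in adjcomp X (adjoint T)](adjointK hX).
exact: (opn_star_self hX hA).
Qed.

(** The two components of the pullback need a common constant [t]. *)
Lemma pos_elt_of_bound (U : cstarType R) (h : U) (s t : R) b :
  s <= t -> nm (s%:C *: b - h ** b) <= s * nm b ->
  nm (t%:C *: b - h ** b) <= t * nm b.
Proof.
move=> st hs; rewrite (_ : _ - _ = (t - s)%:C *: b + (s%:C *: b - h ** b)).
  rewrite (le_trans (nmD _ _)) // nmZr ger0_norm ?subr_ge0 //.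
  by rewrite -[leRHS](subrK (s * nm b)) -mulrBl lerD2l.
by rewrite rmorphB /= scalerBl addrA subrK.
Qed.

End ModulePositivity.

(** * The pullback extension *)

Section PullbackAlgebra.
Variables (R : realType) (A : cstarType R) (C : cstarType R).
Variable delta : {linear C -> corona_alg A}.

Definition pullalg_pred : {pred C * mult A} := fun p => `[< lifts delta p.1 p.2 >].

(* The proof [h] is a parameter so that the algebra structures below can be
   inferred from the type. *)
Record pullalg (h : star_morphism delta) :=
  Pullalg { pullalg_val :> C * mult A; _ : pullalg_val \in pullalg_pred }.

Lemma pullalg_submod : submod_closed pullalg_pred.
Proof.
split=> [|k x y]; first by apply/asboolP; apply/lifts0; exists 0; rewrite iotaA0.
move=> /asboolP hx /asboolP hy; apply/asboolP.
exact: liftsD (liftsZ k hx) hy.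
Qed.

HB.instance Definition _ :=
  GRing.isSubmodClosed.Build R[i] (C * mult A)%type pullalg_pred pullalg_submod.

Variable h : star_morphism delta.
Local Notation B := (pullalg h).

HB.instance Definition _ := [isSub for @pullalg_val h].
HB.instance Definition _ := [Choice of B by <:].
HB.instance Definition _ := [SubChoice_isSubLmodule of B by <:].

Implicit Types p q r : B.

Lemma pullalgP p : lifts delta p.1 p.2.
Proof. by case: p => v /= /asboolP. Qed.

Lemma pullalg_eq p q : p.1 = q.1 -> p.2 = q.2 -> p = q.
Proof.
move=> e1 e2; apply: val_inj.
by rewrite /= [LHS]surjective_pairing e1 e2 -surjective_pairing.
Qed.

Lemma pull_subproof c m : lifts delta c m -> (c, m) \in pullalg_pred.
Proof. by move=> cm; apply/asboolP. Qed.

Definition pull c m (cm : lifts delta c m) : B := Pullalg h (pull_subproof cm).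

Definition pull_mul p q : B := pull (liftsM h (pullalgP p) (pullalgP q)).
Definition pull_star p : B := pull (lifts_star h (pullalgP p)).

HB.instance Definition _ := hasMulStar.Build R B pull_mul pull_star.

Definition pull_nm p : R := Num.max (nm p.1) (nm p.2).

Lemma pull_nmD p q : pull_nm (p + q) <= pull_nm p + pull_nm q.
Proof.
rewrite ge_max; apply/andP; split.
  by rewrite (le_trans (nmD _ _)) // lerD // le_max lexx.
by rewrite (le_trans (nmD _ _)) // lerD // le_max lexx orbT.
Qed.

Lemma pull_nmZ (k : R[i]) p : pull_nm (k *: p) = complex.Re `|k| * pull_nm p.
Proof.
by rewrite /pull_nm !nmZ maxr_pMr // -lec_real -normC_Re normr_ge0.
Qed.

Lemma pull_nm_eq0 p : pull_nm p = 0 -> p = 0.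
Proof.
move=> p0; apply: pullalg_eq; apply: nm_le0; rewrite -p0 le_max lexx //.
by rewrite orbT.
Qed.

Lemma pull_nm_complete : seq_complete pull_nm.
Proof.
move=> u cu.
have [|c uc] := @nm_complete _ C (fun n => (u n).1).
  move=> e /cu[n0 hn]; exists n0 => m n m0 nn0; have := hn m n m0 nn0.
  by rewrite ge_max => /andP[].
have [|m um] := @nm_complete _ (mult A) (fun n => (u n).2).
  move=> e /cu[n0 hn]; exists n0 => k n k0 nn0; have := hn k n k0 nn0.
  by rewrite ge_max => /andP[].
have cm : lifts delta c m.
  apply: (lifts_closed h) => e e0; have [n1 h1] := uc e e0; have [n2 h2] := um e e0.
  exists (u (maxn n1 n2)).1, (u (maxn n1 n2)).2; split; first exact: pullalgP.
    by rewrite nmC h1 // leq_maxl.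
  by rewrite nmC h2 // leq_maxr.
exists (pull cm) => e e0; have [n1 h1] := uc e e0; have [n2 h2] := um e e0.
exists (maxn n1 n2) => n; rewrite geq_max => /andP[/h1 hc /h2 hm].
by rewrite ge_max hc hm.
Qed.

HB.instance Definition _ := Lmodule_isBanach.Build R B
  pull_nmD pull_nmZ pull_nm_eq0 pull_nm_complete.

Lemma pull_nmE p : nm p = Num.max (nm p.1) (nm p.2). Proof. by []. Qed.

Lemma pull_mulA p q r : p ** (q ** r) = p ** q ** r.
Proof. by apply: pullalg_eq; exact: cmulA. Qed.
Lemma pull_mulDl p q r : (p + q) ** r = p ** r + q ** r.
Proof. by apply: pullalg_eq; exact: cmulDl. Qed.
Lemma pull_mulDr p q r : p ** (q + r) = p ** q + p ** r.
Proof. by apply: pullalg_eq; exact: cmulDr. Qed.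
Lemma pull_mulZl (k : R[i]) p q : (k *: p) ** q = k *: (p ** q).
Proof. by apply: pullalg_eq; exact: cmulZl. Qed.
Lemma pull_mulZr (k : R[i]) p q : p ** (k *: q) = k *: (p ** q).
Proof. by apply: pullalg_eq; exact: cmulZr. Qed.
Lemma pull_starD p q : (p + q)^# = p^# + q^#.
Proof. by apply: pullalg_eq; exact: cstarD. Qed.
Lemma pull_starZ (k : R[i]) p : (k *: p)^# = Num.conj k *: p^#.
Proof. by apply: pullalg_eq; exact: cstarZ. Qed.
Lemma pull_starK p : p^#^# = p.
Proof. by apply: pullalg_eq; exact: cstarK. Qed.
Lemma pull_starM p q : (p ** q)^# = q^# ** p^#.
Proof. by apply: pullalg_eq; exact: cstarM. Qed.

Lemma pull_mul_norm p q : `|p ** q| <= `|p| * `|q|.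
Proof.
rewrite !nmE -rmorphM /= lec_real !pull_nmE ge_max.
rewrite !(le_trans (nm_amul _ _)) // ler_pM ?nm_ge0 // le_max lexx ?orbT //.
Qed.

Lemma pull_cstar_norm p : `|p^# ** p| = `|p| ^+ 2.
Proof.
rewrite !nmE -rmorphXn /=; congr (_%:C); rewrite !pull_nmE.
rewrite -[(p^# ** p).1]/((p.1)^# ** p.1) -[(p^# ** p).2]/((p.2)^# ** p.2).
rewrite !nm_cstar; have := nm_ge0 p.1; have := nm_ge0 p.2.
move: (nm p.1) (nm p.2) => s t t0 s0.
by case: (leP s t) => st; case: leP => // le; apply/le_anti; rewrite ?(ltW le) ?le
  ler_pXn2r ?nnegrE // ?(ltW st) ?st.
Qed.

HB.instance Definition _ := isCStarAlg.Build R B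
  pull_mulA pull_mulDl pull_mulDr pull_mulZl pull_mulZr
  pull_starD pull_starZ pull_starK pull_starM pull_mul_norm pull_cstar_norm.

End PullbackAlgebra.

Section MultmodRip.
Variables (R : realType) (A : cstarType R) (X : hilbertBimodType A).
Local Notation hA := (hilbert_self A).
Local Notation hX := (hilbert_bimod X).

Lemma adjcompZl (E F G : rightInnerType A) (k : R[i]) (S : adjop F G) (T : adjop E F) :
  adjcomp (k *: S) T = k *: adjcomp S T.
Proof. exact: adjopP. Qed.

Lemma adjcompZr (E F G : rightInnerType A) (k : R[i]) (S : adjop F G) (T : adjop E F) :
  hilbert_module G -> adjcomp S (k *: T) = k *: adjcomp S T.
Proof. by move=> hG; apply: adjopP => x; exact: adj_scale. Qed.

Lemma adjcompNl (E F G : rightInnerType A) (S : adjop F G) (T : adjop E F) :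
  adjcomp (- S) T = - adjcomp S T.
Proof. exact: adjopP. Qed.

Lemma adjcompNr (E F G : rightInnerType A) (S : adjop F G) (T : adjop E F) :
  hilbert_module G -> adjcomp S (- T) = - adjcomp S T.
Proof. by move=> hG; apply: adjopP => x; exact: adj_opp. Qed.

Lemma multmod_rip_sub (S T : multmod X) :
  multmod_rip S S - multmod_rip T T =
  multmod_rip (S - T) S + multmod_rip T (S - T).
Proof.
rewrite /multmod_rip (adjointB hA) (adjcompDr _ _ _ hA) (adjcompNr _ _ hA).
by rewrite adjcompDl adjcompNl; lmod R.
Qed.

(* [T] is the limit of its products with quasi-units of A. *)
Lemma iotaX_of_rip (T : multmod X) a : multmod_rip T T = iotaA a ->
  exists x, T = iota_mod x.
Proof.
move=> TT; have as_ : a^# = a.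
  by apply: iotaA_inj; rewrite iotaA_star -TT multmod_rip_sa.
apply: iotaX_closed => e e0.
have [w [ws w1 [b bE] we]] := quasi_unit as_ (exprn_gt0 2 e0).
exists (T b); rewrite -adjcomp_iotaA.
have -> : T - adjcomp T (iota_alg b) = adjcomp T w.
  rewrite -[iota_alg b]/(iotaA b) -bE (adjcompDr _ _ _ hX).
  rewrite (adjcompNr _ _ hX) opprD opprK addrA.
  by rewrite (_ : adjcomp T (mult_one A) = T) ?subrr ?add0r //; apply: adjopP.
rewrite -(@ler_pXn2r _ 2) ?nnegrE ?(opn_ge0 hA hX) ?(ltW e0) //.
rewrite -(opn_star_self hA hX) (adjoint_comp hA).
have -> : adjcomp (adjcomp (adjoint w) (adjoint T)) (adjcomp T w) =
    w ** (iotaA a ** w) :> mult A.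
  rewrite -TT; apply: adjopP => c; rewrite -[X in X ** _]ws; exact: erefl.
rewrite -nm_mult (le_trans (nm_amul _ _)) // -[e ^+ 2]mul1r ler_pM ?nm_ge0 //.
Qed.

End MultmodRip.

(** * The pullback module *)

Section PullbackModule.
Variables (R : realType) (A : cstarType R) (X : hilbertBimodType A).
Variables (C : cstarType R) (Z : hilbertBimodType C).
Variables (deltaZ : {linear Z -> corona_mod X}) (delta : {linear C -> corona_alg A}).
Local Notation hA := (hilbert_self A).
Local Notation hX := (hilbert_bimod X).

Definition mod_lifts (z : Z) (T : multmod X) := deltaZ z = piX T.

Definition pullmod_pred : {pred Z * multmod X} := fun p => `[< mod_lifts p.1 p.2 >].

Record pullmod (fullX : full_bimod X) (h : bimod_morphism deltaZ delta) :=
  Pullmod { pullmod_val :> Z * multmod X; _ : pullmod_val \in pullmod_pred }.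

Lemma piXD (S T : multmod X) : piX (S + T) = piX S + piX T.
Proof. exact: raddfD. Qed.
Lemma piXZ (k : R[i]) (T : multmod X) : piX (k *: T) = k *: piX T.
Proof. exact: linearZ. Qed.

Lemma mod_lifts0 (T : multmod X) : mod_lifts 0 T <-> exists x, T = iota_mod x.
Proof.
have p0 : piX 0 = 0 :> corona_mod X by exact: raddf0.
have d0 : deltaZ 0 = 0 by exact: raddf0.
rewrite /mod_lifts d0 -p0; split=> [/esym/piXP[x]|[x ->]].
  by rewrite subr0 => ->; exists x.
by apply/esym/piXP; exists x; rewrite subr0.
Qed.

Lemma mod_lifts_ex z : exists T, mod_lifts z T.
Proof. by exists (reprX (deltaZ z)); rewrite /mod_lifts reprXK. Qed.

Lemma mod_liftsD z z' S T :
  mod_lifts z S -> mod_lifts z' T -> mod_lifts (z + z') (S + T).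
Proof. by rewrite /mod_lifts piXD => <- <-; exact: raddfD. Qed.

Lemma mod_liftsZ (k : R[i]) z T : mod_lifts z T -> mod_lifts (k *: z) (k *: T).
Proof. by rewrite /mod_lifts piXZ => <-; exact: linearZ. Qed.

Lemma mod_liftsB z z' S T :
  mod_lifts z S -> mod_lifts z' T -> mod_lifts (z - z') (S - T).
Proof.
move=> hS /(mod_liftsZ (-1)); rewrite !scaleN1r; exact: mod_liftsD.
Qed.

Lemma pullmod_submod : submod_closed pullmod_pred.
Proof.
split=> [|k x y].
  by apply/asboolP/mod_lifts0; exists 0; apply: adjopP => b; rewrite /= ract0l.
move=> /asboolP hx /asboolP hy; apply/asboolP.
exact: mod_liftsD (mod_liftsZ k hx) hy.
Qed.

HB.instance Definition _ :=
  GRing.isSubmodClosed.Build R[i] (Z * multmod X)%type pullmod_pred pullmod_submod.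

Variables (fullX : full_bimod X) (h : bimod_morphism deltaZ delta).
Local Notation hC := (bimod_morph_star h).
Local Notation B := (pullalg hC).
Local Notation Y := (pullmod fullX h).

HB.instance Definition _ := [isSub for @pullmod_val fullX h].
HB.instance Definition _ := [Choice of Y by <:].
HB.instance Definition _ := [SubChoice_isSubLmodule of Y by <:].

Implicit Types (p q : B) (x y : Y).

Lemma pullmodP y : mod_lifts y.1 y.2.
Proof. by case: y => v /= /asboolP. Qed.

Lemma pullmod_eq x y : x.1 = y.1 -> x.2 = y.2 -> x = y.
Proof.
move=> e1 e2; apply: val_inj.
by rewrite /= [LHS]surjective_pairing e1 e2 -surjective_pairing.
Qed.

Lemma mpull_subproof z T : mod_lifts z T -> (z, T) \in pullmod_pred.
Proof. by move=> zT; apply/asboolP. Qed.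

Definition mpull z T (zT : mod_lifts z T) : Y := Pullmod fullX h (mpull_subproof zT).

Lemma mod_lifts_lact c m z T : lifts delta c m -> mod_lifts z T ->
  mod_lifts (c >* z) (adjcomp (mult_op X m) T).
Proof.
rewrite /lifts /mod_lifts (bimod_morph_lact h) => -> ->.
by rewrite piX_lact // phibarE.
Qed.

Lemma mod_lifts_ract c m z T : lifts delta c m -> mod_lifts z T ->
  mod_lifts (z *< c) (adjcomp T m).
Proof.
by rewrite /lifts /mod_lifts (bimod_morph_ract h) => -> ->; rewrite piX_ract.
Qed.

Lemma mod_lifts_rip z z' T T' : mod_lifts z T -> mod_lifts z' T' ->
  lifts delta (rip z z') (multmod_rip T T').
Proof.
by rewrite /lifts /mod_lifts (bimod_morph_rip h) => -> ->; rewrite piX_rip.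
Qed.

Lemma mod_lifts_lip z z' T T' : mod_lifts z T -> mod_lifts z' T' ->
  lifts delta (lip z z') (multmod_lip T T').
Proof.
by rewrite /lifts /mod_lifts (bimod_morph_lip h) => -> ->; rewrite piX_lip.
Qed.

Definition mpull_lact p y : Y := mpull (mod_lifts_lact (pullalgP p) (pullmodP y)).
Definition mpull_ract y p : Y := mpull (mod_lifts_ract (pullalgP p) (pullmodP y)).
Definition mpull_rip x y : B := pull hC (mod_lifts_rip (pullmodP x) (pullmodP y)).
Definition mpull_lip x y : B := pull hC (mod_lifts_lip (pullmodP x) (pullmodP y)).

HB.instance Definition _ := hasBimodOps.Build R B Y
  mpull_lact mpull_ract mpull_lip mpull_rip.

Lemma mpull_ripDr x y z : rip x (y + z) = rip x y + rip x z :> B.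
Proof.
by apply: pullalg_eq; [exact: ripDr | exact: (adjcompDr _ _ _ hA)].
Qed.

Lemma mpull_ripZr (k : R[i]) x y : rip x (k *: y) = k *: rip x y :> B.
Proof.
by apply: pullalg_eq; [exact: ripZr | exact: (adjcompZr _ _ _ hA)].
Qed.

Lemma mpull_ripC x y : rip y x = (rip x y)^# :> B.
Proof.
apply: pullalg_eq; first exact: ripC.
by apply/esym; rewrite [LHS](adjoint_comp hA) (adjointK hX).
Qed.

HB.instance Definition _ := isRightInner.Build R B Y
  mpull_ripDr mpull_ripZr mpull_ripC.

Definition mpull_nm y : R := Num.max (nm y.1) (opn y.2).

Lemma mpull_nmD x y : mpull_nm (x + y) <= mpull_nm x + mpull_nm y.
Proof.
rewrite ge_max; apply/andP; split.
  by rewrite (le_trans (nmD _ _)) // lerD // le_max lexx.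
by rewrite (le_trans (opnD hA hX _ _)) // lerD // le_max lexx orbT.
Qed.

Lemma mpull_nmZ (k : R[i]) y : mpull_nm (k *: y) = complex.Re `|k| * mpull_nm y.
Proof.
by rewrite /mpull_nm nmZ (opnZ hA hX) maxr_pMr // -lec_real -normC_Re normr_ge0.
Qed.

Lemma mpull_nm_eq0 y : mpull_nm y = 0 -> y = 0.
Proof.
move=> y0; apply: pullmod_eq; first by apply: nm_le0; rewrite -y0 le_max lexx.
apply: (opn_eq0 hA hX); apply/le_anti; rewrite (opn_ge0 hA hX) andbT.
by rewrite -y0 le_max lexx orbT.
Qed.

(** For a lift S of [z], closedness of the graph of [delta] makes the inner square of [T - S] a lift
    of 0, hence an element of A, and [iotaX_of_rip] puts [T - S] in X. *)
Lemma mod_lifts_closed z T :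
  (forall e : R, 0 < e -> exists z' T',
     [/\ mod_lifts z' T', nm (z - z') <= e & opn (T - T') <= e]) -> mod_lifts z T.
Proof.
move=> hz; have [S zS] := mod_lifts_ex z.
suff [v vE] : exists v, T - S = iota_mod v.
  have := mod_liftsD zS ((mod_lifts0 _).2 (ex_intro _ v vE)).
  by rewrite addr0 addrC subrK.
suff /lifts0[a aE] : lifts delta 0 (multmod_rip (T - S) (T - S)).
  exact: iotaX_of_rip aE.
apply: (lifts_closed hC) => e e0.
pose K := 2 * opn (T - S) + 1.
have K0 : 0 < K by rewrite /K; have := opn_ge0 hA hX (T - S); lra.
(* With [D = T - S] and [D' = T' - S], [d <= 1] gives [d^2 <= d] and [|D'| <= |D| + 1]; the error in
   the inner square is at most [d (2 |D| + 1) = d K]. *)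
pose d := Num.min 1 (e / (K + 1)).
have d0 : 0 < d by rewrite lt_min ltr01 divr_gt0 //; lra.
have d1 : d <= 1 by rewrite ge_min lexx.
have dK : d * (K + 1) <= e.
  by rewrite -ler_pdivlMr ?ge_min ?lexx ?orbT //; lra.
have [z' [T' [h' zz TT]]] := hz d d0.
have hd := mod_liftsB h' zS.
exists (rip (z' - z) (z' - z)), (multmod_rip (T' - S) (T' - S)); split.
- exact: mod_lifts_rip.
- rewrite sub0r nmN nm_rip nmC; have := nm_ge0 (z - z').
  by move: (nm _) zz => t tz t0; nra.
- have DD : (T - S) - (T' - S) = T - T' by rewrite opprB addrA subrK.
  move: (T - S) (T' - S) DD @K K0 @d d0 d1 dK zz TT hd.
  move=> D D' DD K K0 d d0 d1 dK _ TT _.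
  rewrite multmod_rip_sub.
  rewrite DD (le_trans (nmD _ _)) //.
  have b1 : nm (multmod_rip (T - T') D) <= d * opn D.
    rewrite nm_mult (le_trans (opn_comp hA hX hA _ _)) // (opn_adjoint hA hX).
    by rewrite ler_wpM2r ?(opn_ge0 hA hX).
  have b2 : nm (multmod_rip D' (T - T')) <= opn D' * d.
    rewrite nm_mult (le_trans (opn_comp hA hX hA _ _)) // (opn_adjoint hA hX).
    by rewrite ler_wpM2l ?(opn_ge0 hA hX).
  have D'D : opn D' <= opn D + d.
    have := opnD hA hX D (- (T - T')); rewrite (opnN hA hX) -{1}DD subKr.
    by move/le_trans; apply; rewrite lerD2l.
  move: b1 b2 D'D (opn_ge0 hA hX D) (opn_ge0 hA hX D') dK; rewrite /K.
  by move: (nm _) (nm _) (opn D) (opn D') => r s t u; nra.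
Qed.

Lemma mpull_nm_complete : seq_complete mpull_nm.
Proof.
move=> u cu.
have [|z uz] := @nm_complete _ Z (fun n => (u n).1).
  move=> e /cu[n0 hn]; exists n0 => m n m0 nn0; have := hn m n m0 nn0.
  by rewrite ge_max => /andP[].
have [|T uT] := opn_complete hA hX (u := fun n => (u n).2).
  move=> e /cu[n0 hn]; exists n0 => k n k0 nn0; have := hn k n k0 nn0.
  by rewrite ge_max => /andP[].
have zT : mod_lifts z T.
  apply: mod_lifts_closed => e e0.
  have [n1 h1] := uz e e0; have [n2 h2] := uT e e0.
  exists (u (maxn n1 n2)).1, (u (maxn n1 n2)).2; split; first exact: pullmodP.
    by rewrite nmC h1 // leq_maxl.
  by rewrite -opprB (opnN hA hX) h2 // leq_maxr.
exists (mpull zT) => e e0; have [n1 h1] := uz e e0; have [n2 h2] := uT e e0.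
exists (maxn n1 n2) => n; rewrite geq_max => /andP[/h1 hc /h2 hm].
by rewrite ge_max hc hm.
Qed.

HB.instance Definition _ := Lmodule_isBanach.Build R Y
  mpull_nmD mpull_nmZ mpull_nm_eq0 mpull_nm_complete.

End PullbackModule.

Section MultmodLip.
Variables (R : realType) (A : cstarType R) (X : hilbertBimodType A).
Hypothesis fullX : full_bimod X.
Local Notation hA := (hilbert_self A).
Local Notation hX := (hilbert_bimod X).
Implicit Types (S T U : multmod X) (m : mult A).

Lemma multmod_lipDl S T U :
  multmod_lip (S + T) U = multmod_lip S U + multmod_lip T U.
Proof.
apply: (mult_op_inj fullX); rewrite mult_opD !multmod_lip_op //.
exact: adjcompDl.
Qed.

Lemma multmod_lipZl (k : R[i]) S T : multmod_lip (k *: S) T = k *: multmod_lip S T.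
Proof.
apply: (mult_op_inj fullX); rewrite mult_opZ !multmod_lip_op //.
exact: adjcompZl.
Qed.

Lemma multmod_lip_lact m S T :
  multmod_lip (adjcomp (mult_op X m) S) T = m ** multmod_lip S T.
Proof.
by apply: (mult_op_inj fullX); rewrite mult_opM !multmod_lip_op //; exact: adjopP.
Qed.

Lemma multmod_lip_rip S T U :
  adjcomp (mult_op X (multmod_lip S T)) U = adjcomp S (multmod_rip T U).
Proof. by rewrite multmod_lip_op //; exact: adjopP. Qed.

End MultmodLip.

(** The module axiom is a hypothesis because the formula serves Y before Y is known to be a Hilbert
    bimodule, as well as X. *)
Lemma rip_sub_ract (R : realType) (A : cstarType R) (E : rightInnerType A) :
  (forall (x y : E) (a : A), rip x (y *< a) = rip x y ** a) ->
  forall (y : E) (u : A), u^# = u -> rip (y - y *< u) (y - y *< u) =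
    rip y y - rip y y ** u - u ** rip y y + u ** rip y y ** u.
Proof.
move=> ripM y u us; rewrite ripBr !ripBl !ripM.
have -> : rip (y *< u) y = u ** rip y y by rewrite ripC ripM cstarM us -ripC.
by lmod R.
Qed.

Lemma lip_sub_lact (R : realType) (A : cstarType R) (E : bimodOpsType A) :
  (forall x y z : E, lip (x + y) z = lip x z + lip y z) ->
  (forall (k : R[i]) (x y : E), lip (k *: x) y = k *: lip x y) ->
  (forall x y : E, lip y x = (lip x y)^#) ->
  (forall (a : A) (x y : E), lip (a >* x) y = a ** lip x y) ->
  forall (y : E) (u : A), u^# = u -> lip (y - u >* y) (y - u >* y) =
    lip y y - lip y y ** u - u ** lip y y + u ** lip y y ** u.
Proof.
move=> lipD lipZ lip_sym lipM y u us.
have lipB (a b c : E) : lip (a - b) c = lip a c - lip b c.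
  by rewrite -[- b]scaleN1r lipD lipZ scaleN1r.
have lipBr (a b c : E) : lip c (a - b) = lip c a - lip c b.
  by rewrite lip_sym lipB astarD astarN -!lip_sym.
have lipMr (x : E) : lip x (u >* y) = lip x y ** u.
  by rewrite lip_sym lipM astarM us -lip_sym.
by rewrite lipBr !lipB !lipMr !lipM; lmod R.
Qed.

(** * Hilbert bimodule axioms for the pullback *)

Section PullbackBimodule.
Variables (R : realType) (A : cstarType R) (X : hilbertBimodType A).
Variables (C : cstarType R) (Z : hilbertBimodType C).
Variables (deltaZ : {linear Z -> corona_mod X}) (delta : {linear C -> corona_alg A}).
Variables (fullX : full_bimod X) (h : bimod_morphism deltaZ delta).
Local Notation hA := (hilbert_self A).
Local Notation hX := (hilbert_bimod X).
Local Notation B := (pullalg (bimod_morph_star h)).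
Local Notation Y := (pullmod fullX h).
Implicit Types (p q : B) (x y z : Y).
Local Notation ractY := (@ract R B Y).
Local Notation lactY := (@lact R B Y).
Local Notation ripY := (@rip R B Y).
Local Notation lipY := (@lip R B Y).

Lemma mpull_nmE y : nm y = Num.max (nm y.1) (opn y.2). Proof. by []. Qed.

Lemma mpull_ractDl x y p : ractY (x + y) p = ractY x p + ractY y p.
Proof. by apply: pullmod_eq; [exact: ractDl | exact: adjcompDl]. Qed.

Lemma mpull_ractDr x p q : ractY x (p + q) = ractY x p + ractY x q.
Proof. by apply: pullmod_eq; [exact: ractDr | exact: (adjcompDr _ _ _ hX)]. Qed.

Lemma mpull_ractZl (k : R[i]) x p : ractY (k *: x) p = k *: ractY x p.
Proof. by apply: pullmod_eq; [exact: ractZl | exact: adjcompZl]. Qed.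

Lemma mpull_ractZr (k : R[i]) x p : ractY x (k *: p) = k *: ractY x p.
Proof. by apply: pullmod_eq; [exact: ractZr | exact: (adjcompZr _ _ _ hX)]. Qed.

Lemma mpull_ractA x p q : ractY x (p ** q) = ractY (ractY x p) q.
Proof. by apply: pullmod_eq; [exact: ractA | exact: adjopP]. Qed.

Lemma mpull_rip_ract x y p : ripY x (ractY y p) = ripY x y ** p.
Proof. by apply: pullalg_eq; [exact: rip_ract | exact: adjopP]. Qed.

Lemma mpull_lactDl p q x : lactY (p + q) x = lactY p x + lactY q x.
Proof.
apply: pullmod_eq; first exact: lactDl.
rewrite -[LHS]/(adjcomp (mult_op X (p.2 + q.2)) x.2) mult_opD; exact: adjcompDl.
Qed.

Lemma mpull_lactDr p x y : lactY p (x + y) = lactY p x + lactY p y.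
Proof. by apply: pullmod_eq; [exact: lactDr | exact: (adjcompDr _ _ _ hX)]. Qed.

Lemma mpull_lactZl (k : R[i]) p x : lactY (k *: p) x = k *: lactY p x.
Proof.
apply: pullmod_eq; first exact: lactZl.
rewrite -[LHS]/(adjcomp (mult_op X (k *: p.2)) x.2) mult_opZ; exact: adjcompZl.
Qed.

Lemma mpull_lactZr (k : R[i]) p x : lactY p (k *: x) = k *: lactY p x.
Proof. by apply: pullmod_eq; [exact: lactZr | exact: (adjcompZr _ _ _ hX)]. Qed.

Lemma mpull_lactA p q x : lactY (p ** q) x = lactY p (lactY q x).
Proof.
apply: pullmod_eq; first exact: lactA.
rewrite -[LHS]/(adjcomp (mult_op X (p.2 ** q.2)) x.2) mult_opM; exact: adjopP.
Qed.

Lemma mpull_lipDl x y z : lipY (x + y) z = lipY x z + lipY y z.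
Proof. by apply: pullalg_eq; [exact: lipDl | exact: multmod_lipDl]. Qed.

Lemma mpull_lipZl (k : R[i]) x y : lipY (k *: x) y = k *: lipY x y.
Proof. by apply: pullalg_eq; [exact: lipZl | exact: multmod_lipZl]. Qed.

Lemma mpull_lipC x y : lipY y x = (lipY x y)^#.
Proof.
apply: pullalg_eq; first exact: lipC.
exact/esym/multmod_lip_star.
Qed.

Lemma mpull_lip_lact p x y : lipY (lactY p x) y = p ** lipY x y.
Proof. by apply: pullalg_eq; [exact: lip_lact | exact: multmod_lip_lact]. Qed.

Lemma mpull_lip_rip x y z : lactY (lipY x y) z = ractY x (ripY y z).
Proof. by apply: pullmod_eq; [exact: lip_rip | exact: multmod_lip_rip]. Qed.

Lemma sqr_max (s t : R) : 0 <= s -> 0 <= t ->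
  Num.max s t ^+ 2 = Num.max (s ^+ 2) (t ^+ 2).
Proof.
move=> s0 t0; case: (leP s t) => st; case: leP => // le; apply/le_anti;
by rewrite ?(ltW le) ?le ler_pXn2r ?nnegrE // ?(ltW st) ?st.
Qed.

Lemma mpull_nm_rip y : nm (ripY y y) = nm y ^+ 2.
Proof.
rewrite mpull_nmE sqr_max ?nm_ge0 ?(opn_ge0 hA hX) // pull_nmE.
by congr Num.max; [exact: nm_rip | exact: nm_multmod_rip].
Qed.

Lemma mpull_nm_lip y : nm (lipY y y) = nm y ^+ 2.
Proof.
rewrite mpull_nmE sqr_max ?nm_ge0 ?(opn_ge0 hA hX) // pull_nmE.
by congr Num.max; [exact: nm_lip | exact: nm_multmod_lip].
Qed.

(** The norm of B is a maximum over the components, so the inequality defining [pos_elt] is checked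
    componentwise with the common constant [s + t]. *)
Lemma pull_pos p : cstar_pos p.1 ->
  (exists2 t : R, 0 <= t & nm (t%:C *: mult_one A - p.2) <= t) ->
  p^# = p -> pos_elt p.
Proof.
move=> /cstar_pos_elt[_ [s s0 hs]] [t t0 ht] ps; split=> //.
exists (s + t) => [|q]; first by rewrite ltr_wpDr.
rewrite !pull_nmE maxr_pMr ?addr_ge0 ?(ltW s0) //.
have h1 : nm ((s + t)%:C *: q.1 - p.1 ** q.1) <= (s + t) * nm q.1.
  by apply: pos_elt_of_bound (hs _); rewrite lerDl.
have h2 : nm ((s + t)%:C *: q.2 - p.2 ** q.2) <= (s + t) * nm q.2.
  apply: (@pos_elt_of_bound _ _ _ t); first by rewrite lerDr ltW.
  rewrite (_ : _ - _ = (t%:C *: mult_one A - p.2) ** q.2); last first.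
    by rewrite cmulDl amulNl cmulZl mult_one_l.
  by rewrite (le_trans (nm_amul _ _)) // ler_wpM2r ?nm_ge0.
rewrite -[((s + t)%:C *: q - p ** q).1]/((s + t)%:C *: q.1 - p.1 ** q.1).
rewrite -[((s + t)%:C *: q - p ** q).2]/((s + t)%:C *: q.2 - p.2 ** q.2).
by rewrite ge_max !le_max h1 h2 orbT.
Qed.

Lemma mpull_rip_pos_elt y : pos_elt (ripY y y).
Proof.
apply: pull_pos; [exact: rip_pos | exact: multmod_rip_pos | exact/esym/mpull_ripC].
Qed.

Lemma mpull_lip_pos_elt y : pos_elt (lipY y y).
Proof.
apply: pull_pos; [exact: lip_pos | exact: multmod_lip_pos | exact/esym/mpull_lipC].
Qed.

Lemma mpull_rip_pos y : cstar_pos (ripY y y).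
Proof. exact/pos_elt_cstar/mpull_rip_pos_elt. Qed.

Lemma mpull_lip_pos y : cstar_pos (lipY y y).
Proof. exact/pos_elt_cstar/mpull_lip_pos_elt. Qed.

Lemma sqrtC_of_sqr (s t : R) : 0 <= s -> t = s ^+ 2 -> s%:C = sqrtC (t%:C : R[i]).
Proof. by move=> s0 ->; rewrite rmorphXn /= sqrCK // -realC0 lec_real. Qed.

Lemma mpull_rip_norm y : `|y| = sqrtC `|ripY y y|.
Proof. by rewrite !nmE; apply: sqrtC_of_sqr (nm_ge0 _) (mpull_nm_rip y). Qed.

Lemma mpull_lip_norm y : `|y| = sqrtC `|lipY y y|.
Proof. by rewrite !nmE; apply: sqrtC_of_sqr (nm_ge0 _) (mpull_nm_lip y). Qed.

Lemma mpull_ract_nondeg :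
  closed_span [set ractY x p | x in [set: Y] & p in [set: B]] = setT.
Proof.
apply/seteqP; split=> // y _; apply: near_span => e e0.
have [u us ue] := pos_elt_approx_sandwich (mpull_rip_pos_elt y) (exprn_gt0 2 e0).
exists (ractY y u); first by exists y => //; exists u.
rewrite -(@ler_pXn2r _ 2) ?nnegrE ?nm_ge0 ?(ltW e0) // -mpull_nm_rip.
by rewrite (rip_sub_ract mpull_rip_ract).
Qed.

Lemma mpull_lact_nondeg :
  closed_span [set lactY p x | p in [set: B] & x in [set: Y]] = setT.
Proof.
apply/seteqP; split=> // y _; apply: near_span => e e0.
have [u us ue] := pos_elt_approx_sandwich (mpull_lip_pos_elt y) (exprn_gt0 2 e0).
exists (lactY u y); first by exists u => //; exists y.
rewrite -(@ler_pXn2r _ 2) ?nnegrE ?nm_ge0 ?(ltW e0) // -mpull_nm_lip.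
by rewrite (lip_sub_lact mpull_lipDl mpull_lipZl mpull_lipC mpull_lip_lact).
Qed.

HB.instance Definition _ := isHilbertBimod.Build R B Y
  mpull_ractDl mpull_ractDr mpull_ractZl mpull_ractZr mpull_ractA
  mpull_ract_nondeg mpull_rip_ract mpull_rip_pos mpull_rip_norm
  mpull_lactDl mpull_lactDr mpull_lactZl mpull_lactZr mpull_lactA
  mpull_lact_nondeg mpull_lipDl mpull_lipZl mpull_lipC mpull_lip_lact
  mpull_lip_pos mpull_lip_norm mpull_lip_rip.

End PullbackBimodule.

Section Approximation.
Variables (R : realType) (A : cstarType R) (X : hilbertBimodType A).
Implicit Types (x y : X) (a u : A).

Lemma ract_approx x (e : R) : 0 < e -> exists u : A, nm (x - x *< u) <= e.
Proof.
move=> e0; have [u us ue] :=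
  pos_elt_approx_sandwich (cstar_pos_elt (rip_pos x)) (exprn_gt0 2 e0).
exists u; rewrite -(@ler_pXn2r _ 2) ?nnegrE ?nm_ge0 ?(ltW e0) // -nm_rip.
by rewrite (rip_sub_ract (@rip_ract _ _ X)).
Qed.

Lemma lact_approx x (e : R) : 0 < e -> exists u : A, nm (x - u >* x) <= e.
Proof.
move=> e0; have [u us ue] :=
  pos_elt_approx_sandwich (cstar_pos_elt (lip_pos x)) (exprn_gt0 2 e0).
exists u; rewrite -(@ler_pXn2r _ 2) ?nnegrE ?nm_ge0 ?(ltW e0) // -nm_lip.
by rewrite (lip_sub_lact (@lipDl _ _ X) (@lipZl _ _ X) (@lipC _ _ X)
  (@lip_lact _ _ X)).
Qed.

End Approximation.

(** * The copy of (X, A) in the pullback: ideal and invariance *)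

Section PullbackExtension.
Variables (R : realType) (A : cstarType R) (X : hilbertBimodType A).
Variables (C : cstarType R) (Z : hilbertBimodType C).
Variables (deltaZ : {linear Z -> corona_mod X}) (delta : {linear C -> corona_alg A}).
Variables (fullX : full_bimod X) (h : bimod_morphism deltaZ delta).
Local Notation hA := (hilbert_self A).
Local Notation hX := (hilbert_bimod X).
Local Notation B := (pullalg (bimod_morph_star h)).
Local Notation Y := (pullmod fullX h).
Local Notation ractY := (@ract R B Y).
Local Notation lactY := (@lact R B Y).
Local Notation ripY := (@rip R B Y).
Local Notation lipY := (@lip R B Y).
Implicit Types (a b : A) (x : X) (p q : B) (y z : Y).

Lemma lifts_iota a : lifts delta 0 (iotaA a).
Proof. by apply/lifts0; exists a. Qed.

Lemma mod_lifts_iota x : mod_lifts deltaZ 0 (iota_mod x).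
Proof. by apply/mod_lifts0; exists x. Qed.

Definition psiA a : B := pull (bimod_morph_star h) (lifts_iota a).
Definition psiX x : Y := mpull fullX h (mod_lifts_iota x).

Lemma psiA_linear : linear psiA.
Proof.
move=> k a b; apply: pullalg_eq.
  by rewrite -[RHS]/(k *: (0 : C) + 0) scaler0 addr0.
by rewrite -[LHS]/(iotaA (k *: a + b)) iotaAD iotaAZ.
Qed.

Lemma psiX_linear : linear psiX.
Proof.
move=> k x x'; apply: pullmod_eq.
  by rewrite -[RHS]/(k *: (0 : Z) + 0) scaler0 addr0.
by rewrite -[LHS]/(iota_mod (k *: x + x')) iotaX_D iotaX_Z.
Qed.

HB.instance Definition _ := GRing.isLinear.Build R[i] A B _ psiA psiA_linear.
HB.instance Definition _ := GRing.isLinear.Build R[i] X Y _ psiX psiX_linear.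

Lemma psiA_star_morphism : star_morphism (psiA : {linear A -> B}).
Proof.
split=> [a b|a]; apply: pullalg_eq.
- by rewrite -[RHS]/((0 : C) ** 0) amul0l.
- exact: iotaAM.
- by rewrite -[RHS]/((0 : C)^#) astar0.
- exact: iotaA_star.
Qed.

Lemma psi_morphism :
  bimod_morphism (psiX : {linear X -> Y}) (psiA : {linear A -> B}).
Proof.
split.
- exact: psiA_star_morphism.
- move=> x a; apply: pullmod_eq; first by rewrite -[RHS]/((0 : Z) *< (0 : C)) ract0l.
  by rewrite -[RHS]/(adjcomp (iota_mod x) (iota_alg a)) adjcomp_iotaA.
- move=> a x; apply: pullmod_eq; first by rewrite -[RHS]/((0 : C) >* (0 : Z)) lact0l.
  rewrite -[RHS]/(adjcomp (mult_op X (iotaA a)) (iota_mod x)).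
  by rewrite iotaX_mul_l mult_op_iota.
- move=> x y; apply: pullalg_eq; first by rewrite -[RHS]/(rip (0 : Z) (0 : Z)) rip0r.
  rewrite -[RHS]/(adjcomp (adjoint (iota_mod x)) (iota_mod y) : mult A).
  by rewrite adjcomp_adj_iotaX -(adjoint_iotaX x y).
- move=> x y; apply: pullalg_eq; first by rewrite -[RHS]/(lip (0 : Z) (0 : Z)) lip0l.
  rewrite -[RHS]/(multmod_lip (iota_mod x) (iota_mod y)).
  apply: (mult_op_inj fullX); rewrite multmod_lip_op // mult_op_iota.
  apply: adjopP => z; rewrite -[LHS]/(lip x y >* z) lip_rip.
  by rewrite -[RHS]/(x *< (adjoint (iota_mod y) z : A)) adjoint_iotaX.
Qed.

Lemma psiA_inj : injective psiA.
Proof.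
by move=> a b ab; apply: iotaA_inj; have /(congr1 (fun p : B => p.2)) := ab.
Qed.

(** Closedness, the ideal property and the identification of the quotient with C are all read off
    from the first component. *)
Lemma range_psiA p : range psiA p <-> p.1 = 0.
Proof.
split=> [[a _ <-]//|p0]; have := pullalgP p; rewrite p0 => /lifts0[a aE].
by exists a => //; apply: pullalg_eq.
Qed.

Lemma range_psiX y : range psiX y <-> y.1 = 0.
Proof.
split=> [[x _ <-]//|y0]; have := pullmodP y; rewrite y0 => /mod_lifts0[x xE].
by exists x => //; apply: pullmod_eq.
Qed.

Lemma nm_fst_le p : nm p.1 <= nm p.
Proof. by rewrite [leRHS]pull_nmE le_max lexx. Qed.

Lemma nm_mfst_le y : nm y.1 <= nm y.
Proof. by rewrite [leRHS]mpull_nmE le_max lexx. Qed.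

Lemma psiA_ideal : closed_ideal (range psiA).
Proof.
split.
- apply: closed_nm => p hp; apply/range_psiA/nm_eps0 => e /hp[q /range_psiA q0 pq].
  by rewrite (le_trans _ pq) // -[p.1]subr0 -q0; exact: (nm_fst_le (p - q)).
- exact/range_psiA.
- move=> p q /range_psiA p0 /range_psiA q0; apply/range_psiA.
  by rewrite -[LHS]/(p.1 + q.1) p0 q0 addr0.
- move=> k p /range_psiA p0; apply/range_psiA.
  by rewrite -[LHS]/(k *: p.1) p0 scaler0.
- move=> q p /range_psiA p0; apply/range_psiA.
  by rewrite -[LHS]/(q.1 ** p.1) p0 amul0r.
- move=> p q /range_psiA p0; apply/range_psiA.
  by rewrite -[LHS]/(p.1 ** q.1) p0 amul0l.
Qed.

Lemma nm_psiX x : nm (psiX x) = nm x.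
Proof.
rewrite mpull_nmE -[(psiX x).1]/(0 : Z) -[(psiX x).2]/(iota_mod x).
by rewrite nm0 opn_iotaX max_r // nm_ge0.
Qed.

Lemma closed_span_fst0 (S : set Y) : (forall s, S s -> s.1 = 0) ->
  forall y, closed_span S y -> y.1 = 0.
Proof.
move=> S0; apply: closed_span_ind => //.
- by move=> y z y0 z0; rewrite -[LHS]/(y.1 + z.1) y0 z0 addr0.
- by move=> k y y0; rewrite -[LHS]/(k *: y.1) y0 scaler0.
- move=> y hy; apply/nm_eps0 => e /hy[z z0 yz].
  by rewrite (le_trans _ yz) // -[y.1]subr0 -z0; exact: (nm_mfst_le (y - z)).
Qed.

(** Both closed spans equal the copy of X: products with A have first component 0, and each [x] is
    approximated by [x u] and by [u x] with [u] in A. *)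
Lemma psi_invariant : bimod_invariant Y (range psiA).
Proof.
have sX (S : set Y) : (forall s, S s -> s.1 = 0) ->
    (forall x (e : R), 0 < e -> exists2 x', S (psiX x') & nm (x - x') <= e) ->
    closed_span S = range psiX.
  move=> S0 SX; apply/seteqP; split=> [y hy|_ [x _ <-]].
    by apply/range_psiX; exact: (closed_span_fst0 S0 hy).
  apply: near_span => e /(SX x)[x' Sx' xx']; exists (psiX x') => //.
  by rewrite -(raddfB psiX) nm_psiX.
rewrite /bimod_invariant !sX //.
- move=> _ [y _ [p /range_psiA p0 <-]].
  by rewrite -[LHS]/(y.1 *< p.1) p0 ract0r.
- move=> x e /(ract_approx x)[u ux]; exists (x *< u) => //.
  exists (psiX x) => //; exists (psiA u); first by exists u.
  by rewrite (bimod_morph_ract psi_morphism).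
- move=> _ [p /range_psiA p0 [y _ <-]].
  by rewrite -[LHS]/(p.1 >* y.1) p0 lact0l.
- move=> x e /(lact_approx x)[u ux]; exists (u >* x) => //.
  exists (psiA u); first by exists u.
  by exists (psiX x); rewrite // (bimod_morph_lact psi_morphism).
Qed.

Definition pull_extension : extension X :=
  @Extension R A X B Y psiA psiX psi_morphism psiA_inj psiA_ideal psi_invariant.

End PullbackExtension.

(** * The Busby morphism and essentiality *)

Section PullbackBusby.
Variables (R : realType) (A : cstarType R) (X : hilbertBimodType A).
Variables (C : cstarType R) (Z : hilbertBimodType C).
Variables (deltaZ : {linear Z -> corona_mod X}) (delta : {linear C -> corona_alg A}).
Variables (fullX : full_bimod X) (h : bimod_morphism deltaZ delta).
Local Notation B := (pullalg (bimod_morph_star h)).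
Local Notation Y := (pullmod fullX h).
Local Notation E := (pull_extension fullX h).
Local Notation psiA := (psiA h : {linear A -> B}).
Local Notation psiX := (psiX fullX h : {linear X -> Y}).
Implicit Types (p q : B) (y z : Y).

(** Representatives differ by elements with first component 0, so the one chosen by [repr] serves
    for all. *)
Definition alphaC (s : coker psiA) : C := (repr s : B).1.
Definition alphaZ (s : quotient_bimod psiX psiA) : Z :=
  (repr (s : coker psiX) : Y).1.

Lemma alphaC_pi p : alphaC (coker_pi psiA p) = p.1.
Proof.
have /coker_piP/range_psiA :
    coker_pi psiA (repr (coker_pi psiA p)) = coker_pi psiA p.
  exact: coker_reprK.
by move=> e; apply/subr0_eq.
Qed.

Lemma alphaZ_pi y : alphaZ (coker_pi psiX y) = y.1.
Proof.
have /coker_piP/range_psiX :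
    coker_pi psiX (repr (coker_pi psiX y)) = coker_pi psiX y.
  exact: coker_reprK.
by move=> e; apply/subr0_eq.
Qed.

Lemma alphaC_linear : linear alphaC.
Proof.
move=> k s t; rewrite -(coker_reprK s) -(coker_reprK t) !alphaC_pi.
by rewrite -[k *: coker_pi _ _ + _]linearP alphaC_pi.
Qed.

Lemma alphaZ_linear : linear alphaZ.
Proof.
move=> k s t.
rewrite -(coker_reprK (s : coker psiX)) -(coker_reprK (t : coker psiX)).
rewrite !alphaZ_pi.
rewrite -[LHS]/(alphaZ (k *: coker_pi psiX (repr (s : coker psiX)) +
  coker_pi psiX (repr (t : coker psiX)))).
by rewrite -linearP alphaZ_pi.
Qed.

HB.instance Definition _ :=
  GRing.isLinear.Build R[i] (coker psiA) C _ alphaC alphaC_linear.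
HB.instance Definition _ :=
  GRing.isLinear.Build R[i] (quotient_bimod psiX psiA) Z _ alphaZ alphaZ_linear.

Lemma alpha_morphism : bimod_morphism
  (alphaZ : {linear quotient_bimod psiX psiA -> Z})
  (alphaC : {linear coker psiA -> C}).
Proof.
split; first split.
- move=> s t; rewrite -[LHS]/(alphaC (coker_pi psiA (repr s ** repr t))).
  exact: alphaC_pi.
- by move=> s; rewrite -[LHS]/(alphaC (coker_pi psiA (repr s)^#)) alphaC_pi.
- move=> s t; rewrite -[LHS]/(alphaZ (coker_pi psiX
    (@ract R B Y (repr (s : coker psiX)) (repr t)))); exact: alphaZ_pi.
- move=> t s; rewrite -[LHS]/(alphaZ (coker_pi psiX
    (@lact R B Y (repr t) (repr (s : coker psiX))))); exact: alphaZ_pi.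
- move=> s t; rewrite -[LHS]/(alphaC (coker_pi psiA
    (@rip R B Y (repr (s : coker psiX)) (repr (t : coker psiX))))); exact: alphaC_pi.
- move=> s t; rewrite -[LHS]/(alphaC (coker_pi psiA
    (@lip R B Y (repr (s : coker psiX)) (repr (t : coker psiX))))); exact: alphaC_pi.
Qed.

Lemma inj_surj_bij (T U : Type) (f : T -> U) :
  injective f -> (forall u, exists t, f t = u) -> bijective f.
Proof.
move=> fi /choice[g gK]; exists g => // t; apply: fi; exact: gK.
Qed.

Lemma alphaC_bij : bijective alphaC.
Proof.
apply: inj_surj_bij => [s t st|c].
  rewrite -(coker_reprK s) -(coker_reprK t); apply/coker_piP/range_psiA.
  by rewrite -[LHS]/(alphaC s - alphaC t) st subrr.
have [m cm] := lifts_ex delta c.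
by exists (coker_pi psiA (pull (bimod_morph_star h) cm)); rewrite alphaC_pi.
Qed.

Lemma alphaZ_bij : bijective alphaZ.
Proof.
apply: inj_surj_bij => [s t st|z].
  rewrite -(coker_reprK (s : coker psiX)) -(coker_reprK (t : coker psiX)).
  apply/coker_piP/range_psiX.
  by rewrite -[LHS]/(alphaZ s - alphaZ t) st subrr.
have [T zT] := mod_lifts_ex deltaZ z.
by exists (coker_pi psiX (mpull fullX h zT)); rewrite alphaZ_pi.
Qed.

Definition pull_snd p : multalg A := p.2.
Definition mpull_snd y : multmod X := y.2.

Lemma pull_snd_linear : linear pull_snd. Proof. by []. Qed.
Lemma mpull_snd_linear : linear mpull_snd. Proof. by []. Qed.

HB.instance Definition _ :=
  GRing.isLinear.Build R[i] B (multalg A) _ pull_snd pull_snd_linear.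
HB.instance Definition _ :=
  GRing.isLinear.Build R[i] Y (multmod X) _ mpull_snd mpull_snd_linear.

Lemma snd_morphism : bimod_morphism
  (mpull_snd : {linear Y -> multmod X}) (pull_snd : {linear B -> multalg A}).
Proof.
split; first split.
- by [].
- by [].
- by [].
(* The left action on Y is built from [mult_op], the one on M(X) from [phibar]. *)
- move=> p y; rewrite -[RHS]/(adjcomp (phibar X (p.2 : mult A)) y.2) phibarE //.
- by [].
- by [].
Qed.

Lemma bimod_morphism_comp (A1 A2 A3 : starAlgType R) (X1 : bimodOpsType A1)
    (X2 : bimodOpsType A2) (X3 : bimodOpsType A3)
    (fX : {linear X1 -> X2}) (fA : {linear A1 -> A2})
    (gX : {linear X2 -> X3}) (gA : {linear A2 -> A3}) :
  bimod_morphism fX fA -> bimod_morphism gX gA ->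
  bimod_morphism (gX \o fX) (gA \o fA).
Proof.
move=> [[fM fs] fr fl fri fli] [[gM gs] gr gl gri gli].
by split; first split; move=> *; rewrite /= ?fM ?fs ?fr ?fl ?fri ?fli.
Qed.

Lemma pull_busby : @busby_morphism R A X E
  (deltaZ \o (alphaZ : {linear quotient_bimod psiX psiA -> Z}))
  (delta \o (alphaC : {linear coker psiA -> C})).
Proof.
split; first exact: bimod_morphism_comp alpha_morphism h.
exists mpull_snd, pull_snd; split.
- by split; [exact: snd_morphism | |].
- move=> y; rewrite -[LHS]/(deltaZ (alphaZ (coker_pi psiX y))) alphaZ_pi.
  exact: pullmodP.
- move=> p; rewrite -[LHS]/(delta (alphaC (coker_pi psiA p))) alphaC_pi.
  exact: pullalgP.
Qed.

Lemma pull_essential : essential_extension E <-> injective delta.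
Proof.
have ker0 c : delta c = 0 -> lifts delta c 0.
  by move=> c0; rewrite /lifts c0; apply/esym; exact: raddf0.
split=> [ess|dinj J [_ J0 _ _ _ Jr] Jn0 IJ].
  move=> c d cd; apply/subr0_eq; apply: contrapT => cd0.
  have dcd : delta (c - d) = 0 by rewrite raddfB /= cd subrr.
  pose J : set B := [set p | p.2 = 0].
  apply: (ess J).
  - split.
    + apply: closed_nm => p hp; apply/nm_eps0 => e /hp[q q0 pq].
      rewrite (le_trans _ pq) // [leRHS]pull_nmE le_max.
      rewrite -[(p - q).2]/(p.2 - q.2) q0 subr0 lexx orbT //.
    + by [].
    + by move=> p q p0 q0; rewrite /J /= -[LHS]/(p.2 + q.2) p0 q0 addr0.
    + by move=> k p p0; rewrite /J /= -[LHS]/(k *: p.2) p0 scaler0.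
    + by move=> q p p0; rewrite /J /= -[LHS]/(q.2 ** p.2) p0 amul0r.
    + by move=> p q p0; rewrite /J /= -[LHS]/(p.2 ** q.2) p0 amul0l.
  - move/seteqP=> [/(_ (pull (bimod_morph_star h) (ker0 _ dcd)) erefl) +  _].
    by move/(congr1 (fun p : B => p.1)).
  - apply/seteqP; split=> [p [/range_psiA p1 p2]|_ ->].
      exact: pullalg_eq.
    by split=> //; exact/range_psiA.
apply: Jn0; apply/seteqP; split=> [p Jp|_ -> //].
have pa0 a : p ** psiA a = 0.
  suff : (range psiA `&` J) (p ** psiA a) by rewrite IJ.
  split; last exact: Jr.
  by apply/range_psiA; rewrite -[LHS]/(p.1 ** (0 : C)) amul0r.
have p20 : p.2 = 0.
  apply: adjopP => a; apply: iotaA_inj; rewrite -iotaA_mul_l.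
  have /(congr1 (fun p : B => p.2)) := pa0 a.
  by rewrite -[LHS]/(p.2 ** iotaA a) => ->; rewrite -[RHS]/(iotaA 0) iotaA0.
apply: pullalg_eq => //; apply: dinj.
have := pullalgP p; rewrite /lifts p20 => ->.
have -> : delta (0 : B).1 = 0 by exact: raddf0.
exact: raddf0.
Qed.

End PullbackBusby.

Theorem proposition3p7 (R : realType)
    (A : cstarType R) (X : hilbertBimodType A) (fullX : full_bimod X)
    (C : cstarType R) (Z : hilbertBimodType C)
    (deltaZ : {linear Z -> corona_mod X})
    (deltaC : {linear C -> corona_alg A})
    (delta_morph : bimod_morphism deltaZ deltaC) :
  exists (E : extension X)
         (alphaZ : {linear ext_quot_mod E -> Z})
         (alphaC : {linear ext_quot_alg E -> C}),
    [/\ bimod_isomorphism alphaZ alphaC,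
        busby_morphism (deltaZ \o alphaZ) (deltaC \o alphaC) &
        essential_extension E <-> injective deltaC].
Proof.
exists (pull_extension fullX delta_morph).
exists (@alphaZ _ _ _ _ _ _ _ fullX delta_morph).
exists (@alphaC _ _ _ _ _ _ _ delta_morph).
split; [split | exact: pull_busby | exact: pull_essential].
- exact: alpha_morphism.
- exact: alphaZ_bij.
- exact: alphaC_bij.
Qed.
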